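(* Let $r\ge 0$ and $n\ge r+2$. A kernel $K$ on the projection bundle $\pi_{S^{n-1},(S^{n-1})^r}$ is invariant under the action of $O_n$ and p.d. if and only if there are p.d. kernels $c_i$, $i=0,1,\dots$, on the projection subbundle $$f:\left\{\begin{bmatrix}1&y^\top\\ y&Y\end{bmatrix}\in\Lambda^{r+1}: Y\succ 0\right\}\to\{Y\in\Lambda^r: Y\succ 0\},$$ such that for all $x,y\in S^{n-1}$ and $Z\in(S^{n-1})^r$, $$K_Z(x,y)=\sum_{i\in\mathbb{N}}(c_i)_{Z^\top Z}(Z^\top x,Z^\top y)\;P_i^{\frac{n-r}{2}-1}\!\left(\frac{(\Pi_Z^{\perp}x)^\top\,\Pi_Z^{\perp}y}{\|\Pi_Z^{\perp}x\|\,\|\Pi_Z^{\perp}y\|}\right).$$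
   Context: $S^{n-1}$ is the unit sphere in $\mathbb{R}^n$, $O_n$ is the orthogonal group in dimension $n$, and $\mathbb{N}=\{0,1,2,\dots\}$. An element $Z=[z_1,\dots,z_r]\in(S^{n-1})^r$ is viewed as an $n\times r$ matrix with columns $z_j$. $\mathcal{R}(Z)$ is its range, $\Pi_Z=Z(Z^\top Z)^{-1}Z^\top$ is the orthogonal projection onto $\mathcal{R}(Z)$, and $\Pi_Z^\perp=I-\Pi_Z$ is the orthogonal projection onto $\mathcal{R}(Z)^\perp$. $\Lambda^r=\{Y\in\mathbb{S}^r: Y\succeq 0,\ Y_{ii}=1\text{ for all } i\in\{1,\dots,r\}\}$, where $\mathbb{S}^r$ is the space of real symmetric $r\times r$ matrices; $Y\succeq 0$ and $Y\succ 0$ mean positive semidefinite and positive definite. A kernel on a set $V$ is a symmetric continuous function $V\times V\to\mathbb{R}$; it is positive definite (p.d.) if its restriction to $U\times U$ is a positive semidefinite matrix for every finite $U\subset V$. A bundle is a map $f:A\to B$, with fibers $A_b=f^{-1}(b)$. A kernel on $f$ is a continuous map $K:\{(a_1,a_2)\in A\times A: f(a_1)=f(a_2)\}\to\mathbb{R}$ whose restriction $K_b$ to $A_b\times A_b$ is a kernel for every $b\in B$; it is p.d. on $f$ if each $K_b$ is p.d. The projection bundle $\pi_{A,B}:A\times B\to B$ is $(a,b)\mapsto b$; a projection subbundle is the restriction of a projection bundle to a subset of its total space. For projection subbundles, fibers are identified with subsets of $A$. Thus a kernel on $\pi_{S^{n-1},(S^{n-1})^r}$ is a continuous function $(x,y,Z)\mapsto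 K_Z(x,y)$ on $S^{n-1}\times S^{n-1}\times(S^{n-1})^r$, symmetric in $x,y$; it is p.d. if $K_Z$ is p.d. on $S^{n-1}$ for every $Z$, and it is invariant under the action of $O_n$ if $K_{MZ}(Mx,My)=K_Z(x,y)$ for all $M\in O_n$, $x,y\in S^{n-1}$, $Z\in(S^{n-1})^r$. The bundle $f$ of the claim sends $\begin{bmatrix}1&y^\top\\ y&Y\end{bmatrix}$, identified with $(y,Y)$, to $Y$; so a kernel $c$ on it is a continuous function $(y_1,y_2,Y)\mapsto c_Y(y_1,y_2)$, symmetric in $y_1,y_2$, defined for $Y\in\Lambda^r$, $Y\succ 0$, and $y_1,y_2\in\mathbb{R}^r$ with $\begin{bmatrix}1&y_j^\top\\ y_j&Y\end{bmatrix}\in\Lambda^{r+1}$, $j=1,2$. Gegenbauer polynomials. For any $\alpha\in\mathbb{R}$ and $d\ge 0$, the Gegenbauer polynomial $P_d^\alpha:[-1,1]\to\mathbb{R}$ of order $\alpha$ and degree $d$ is defined inductively by $P_0^\alpha(t)=1$, $P_1^\alpha(t)=2\alpha t$, and, for $d>1$, $dP_d^\alpha(t)=2t(d+\alpha-1)P_{d-1}^\alpha(t)-(d+2\alpha-2)P_{d-2}^\alpha(t)$.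
   Formalization: For n=r+2 the recursion gives P_i^0=0 for i≥1, making the claim false (r=0, n=2, K=x^T y); P_i^0 is taken to be the Chebyshev polynomial instead. The identity is required only for Z with Z^T Z≻0, where its right side is defined, and a cosine 0/0 is read as 0. *)

(* Defs.v *)
From HB Require Import structures.
From mathcomp Require Import all_boot all_order all_algebra.
From mathcomp Require Import all_classical all_reals all_analysis.

Set Implicit Arguments.
Unset Strict Implicit.
Unset Printing Implicit Defensive.

Import Order.TTheory GRing.Theory Num.Theory.
Import numFieldNormedType.Exports.

Local Open Scope classical_set_scope.
Local Open Scope ring_scope.

(* Points of R^n are column vectors. The library norm on matrices is the
   sup norm, whence a separate Euclidean inner product and norm. *)
Definition dotv (R : realType) (n : nat) (x y : 'cV[R]_n) : R :=
  (x^T *m y) 0 0.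

Definition enorm (R : realType) (n : nat) (x : 'cV[R]_n) : R :=
  Num.sqrt (dotv x x).

(* For x : 'cV_n this is the sphere S^(n-1). *)
Definition sphere (R : realType) (n : nat) : set 'cV[R]_n :=
  [set x | enorm x = 1].

(* (S^(n-1))^r, as n x r matrices with columns on the sphere. *)
Definition spheres (R : realType) (n r : nat) : set 'M[R]_(n, r) :=
  [set Z | forall j : 'I_r, sphere (col j Z)].

Definition orthogonal_mx (R : realType) (n : nat) : set 'M[R]_n :=
  [set M | M^T *m M = 1%:M].

Definition psdmx (R : realType) (m : nat) (A : 'M[R]_m) : Prop :=
  A^T = A /\ forall v : 'cV[R]_m, 0 <= dotv v (A *m v).

Definition pdmx (R : realType) (m : nat) (A : 'M[R]_m) : Prop :=
  A^T = A /\ forall v : 'cV[R]_m, v != 0 -> 0 < dotv v (A *m v).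

(* Lambda^r *)
Definition elliptope (R : realType) (r : nat) : set 'M[R]_r :=
  [set Y | psdmx Y /\ forall i, Y i i = 1].

Definition is_kernel (R : realType) (T : topologicalType)
    (V : set T) (k : T -> T -> R) : Prop :=
  {within V `*` V, continuous (fun p : T * T => k p.1 p.2)} /\
  forall x y, V x -> V y -> k x y = k y x.

(* The finite subsets U of V are enumerated without repetition by u. *)
Definition pd_kernel (R : realType) (T : topologicalType)
    (V : set T) (k : T -> T -> R) : Prop :=
  forall (m : nat) (u : 'I_m -> T), injective u -> (forall i, V (u i)) ->
    psdmx (\matrix_(i, j) k (u i) (u j)).

(* A projection subbundle of A * B -> B is given by its total space
   S : set (A * B); the fiber over b, identified with a subset of A, is
   [fiber S b].  A kernel on it is written [K b a1 a2]; the pairs of points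
   of S lying over the same b are identified with triples (a1, a2, b).
   Values of K outside of these triples are irrelevant. *)
Definition fiber (A B : Type) (S : set (A * B)) (b : B) : set A :=
  [set a | S (a, b)].

Definition bundle_kernel (R : realType) (A B : topologicalType)
    (S : set (A * B)) (K : B -> A -> A -> R) : Prop :=
  {within [set p : A * A * B | S (p.1.1, p.2) /\ S (p.1.2, p.2)],
     continuous (fun p : A * A * B => K p.2 p.1.1 p.1.2)} /\
  forall b, is_kernel (fiber S b) (K b).

Definition bundle_pd (R : realType) (A B : topologicalType)
    (S : set (A * B)) (K : B -> A -> A -> R) : Prop :=
  forall b, pd_kernel (fiber S b) (K b).

Definition sphere_bundle (R : realType) (n r : nat) :
    set ('cV[R]_n * 'M[R]_(n, r)) :=
  @sphere R n `*` @spheres R n r.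

(* The bordered matrix [1, y^T; y, Y] is identified with the pair (y, Y).
   Membership of it in Lambda^(r+1) forces Y to be in Lambda^r. *)
Definition gram_bundle (R : realType) (r : nat) :
    set ('cV[R]_r * 'M[R]_r) :=
  [set p | elliptope (block_mx (1%:M : 'M[R]_1) p.1^T p.1 p.2) /\ pdmx p.2].

Definition orthogonal_invariant (R : realType) (n r : nat)
    (K : 'M[R]_(n, r) -> 'cV[R]_n -> 'cV[R]_n -> R) : Prop :=
  forall (M : 'M[R]_n) (x y : 'cV[R]_n) (Z : 'M[R]_(n, r)),
    orthogonal_mx M -> sphere x -> sphere y -> spheres Z ->
    K (M *m Z) (M *m x) (M *m y) = K Z x y.

(* Pi_Z and its complement; meaningful when Z^T Z is invertible. *)
Definition range_proj (R : realType) (n r : nat) (Z : 'M[R]_(n, r)) : 'M[R]_n :=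
  Z *m invmx (Z^T *m Z) *m Z^T.

Definition perp_proj (R : realType) (n r : nat) (Z : 'M[R]_(n, r)) : 'M[R]_n :=
  1%:M - range_proj Z.

(* Cosine of the angle between the components of x and y orthogonal to the
   range of Z.  If one of these components vanishes the quotient is 0 / 0,
   which evaluates to 0. *)
Definition perp_cos (R : realType) (n r : nat) (Z : 'M[R]_(n, r))
    (x y : 'cV[R]_n) : R :=
  dotv (perp_proj Z *m x) (perp_proj Z *m y) /
    (enorm (perp_proj Z *m x) * enorm (perp_proj Z *m y)).

(* The three-term recursion
   d P_d = 2 t (d + alpha - 1) P_(d-1) - (d + 2 alpha - 2) P_(d-2). *)
Fixpoint gegenbauer_rec (R : realType) (alpha : R) (d : nat) : {poly R} :=
  match d with
  | 0 => 1
  | d1.+1 => match d1 with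
    | 0 => (2 * alpha) *: 'X
    | d2.+1 =>
      (d%:R)^-1 *: ((2 * (d%:R + alpha - 1)) *: ('X * gegenbauer_rec alpha d1)
                    - (d%:R + 2 * alpha - 2) *: gegenbauer_rec alpha d2)
    end
  end.

(* Chebyshev polynomials of the first kind. *)
Fixpoint chebyshev (R : realType) (d : nat) : {poly R} :=
  match d with
  | 0 => 1
  | d1.+1 => match d1 with
    | 0 => 'X
    | d2.+1 => 2 *: ('X * chebyshev R d1) - chebyshev R d2
    end
  end.

(* At alpha = 0 the recursion collapses. *)
Lemma gegenbauer_rec0 (R : realType) (d : nat) :
  gegenbauer_rec (0 : R) d.+1 = 0.
Proof.
elim/ltn_ind: d => -[|[|d]] IH; first by rewrite /= mulr0 scale0r.
  by rewrite /= mulr0 addr0 subrr !(scale0r, mulr0, scaler0) subr0 scaler0.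
have E1 := IH d.+1 (ltnSn _); have E2 := IH d (leqnSn _).
rewrite [LHS]/= -/(gegenbauer_rec 0 d.+2) -/(gegenbauer_rec 0 d.+1).
by move: E1 E2 => /= -> ->; rewrite mulr0 !scaler0 subr0 scaler0.
Qed.

(* Order 0 is understood in the usual limiting sense: for every d,
   P_d^alpha(t) / P_d^alpha(1) tends to the Chebyshev polynomial T_d(t) as
   alpha tends to 0, whereas the recursion itself gives the zero polynomial
   in every degree d >= 1 (gegenbauer_rec0).  For alpha <> 0 this is the
   recursion verbatim. *)
Definition gegenbauer (R : realType) (alpha : R) (d : nat) : {poly R} :=
  if alpha == 0 then chebyshev R d else gegenbauer_rec alpha d.

(* Main.v *)
(* An orthogonally invariant K depends only on the Gram matrix of (x, y, Z),
   because configurations with equal Gram matrices differ by a product of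
   reflections; it is a continuous function of that matrix since the Gram map is
   continuous on a compact set.  For fixed Z^T Z, Z^T x and Z^T y the remaining
   variable is the cosine t of the angle between the components of x and y
   orthogonal to the range of Z, and K becomes a matrix-valued positive definite
   zonal kernel on S^(m-1), m = n - r.  The kernels c_i are its Gegenbauer
   coefficients.

   Schoenberg's theorem is proved without integrating over the sphere.  The mean
   of a zonal polynomial is given by explicit moments, and its positivity follows
   from exact cubature rules with positive weights, obtained by projecting products
   of Gauss-Hermite rules to the sphere; the latter are read off the spectral
   decomposition of Jacobi matrices.  Coefficients of p.d. functions are then
   nonnegative, and the series is summed by convolution with the peak
   t^(2N) (1 + t).

   Conversely each term of the series is p.d. on the points outside the range of a
   full rank Z, by the Schur product argument, and the general case follows by
   density. *)
Require Import Defs.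
From HB Require Import structures.
From mathcomp Require Import all_boot all_order all_algebra.
From mathcomp Require Import complex.
From mathcomp Require Import all_classical all_reals all_analysis.
From mathcomp Require Import ring lra zify.
Set Implicit Arguments.
Unset Strict Implicit.
Unset Printing Implicit Defensive.
Import Order.TTheory GRing.Theory Num.Theory.
Import numFieldNormedType.Exports.
Local Open Scope classical_set_scope.
Local Open Scope ring_scope.

(** * Quadrature and cubature *)

(** The mean [mom] and the convolution [star] are defined on coefficients, where neither positivity
    nor the adjunction [mom_star] can be seen. Written with a cubature, both are finite sums with
    nonnegative weights, and Fubini is an exchange of sums. A cubature enters through the recursion
    of its mixed moments, which is Gaussian integration by parts, E[x p(x)] = E[p'(x)] in each
    coordinate. For the Jacobi matrix this identity is the canonical commutation relation, true up
    to a corner that low powers do not reach.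

    The power t^(2N) peaks at both ends of [-1, 1]. The factor 1 + t suppresses the end -1, leaves
    the mean unchanged because odd moments vanish, and multiplies 1 - t to 1 - t^2, so that the
    concentration at 1 is measured by a ratio of even moments. The multipliers of this peak lie in
    [0, 1], which allows the coefficients of a p.d. function to be summed at t = 1. Off the
    diagonal, coefficients may have any sign and are dominated by diagonal ones. *)

Section SpectralMeasure.
Local Open Scope sesquilinear_scope.

(** The nodes are the eigenvalues, the weights the squared moduli of the coordinates of index 0 of
    an orthonormal eigenbasis. The matrix is diagonalized over [R[i]] as a hermitian one. *)
Lemma spectral_measure (R : rcfType) n (A : 'M[R]_n.+1) : A^T = A ->
  exists l w : 'I_n.+1 -> R, (forall k, 0 <= w k) /\
    forall p, (A ^+ p) 0 0 = \sum_k w k * l k ^+ p.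
Proof.
move=> As.
pose AC := map_mx (real_complex R) A.
have ACr : AC \is a realmx.
  by apply/mxOverP => i j; rewrite mxE; apply/complex_realP; exists (A i j).
have ACh : AC \is hermsymmx.
  apply: realsym_hermsym => //.
  by apply/is_hermitianmxP; rewrite expr0 scale1r map_mx_id // map_trmx As.
have /orthomx_spectralP := hermitian_normalmx ACh.
have dr := hermitian_spectral_diag_real ACh.
have uP := spectral_unitarymx AC.
have uP' := spectral_unit AC.
rewrite (invmx_unitary uP).
set P := spectralmx AC in uP uP' *; set d := spectral_diag AC in dr *.
move=> eA.
have eAp p : AC ^+ p = P ^t* *m diag_mx (map_mx (fun x => x ^+ p) d) *m P.
  elim: p => [|p IH].
    rewrite expr0; have -> : map_mx (fun x => x ^+ 0) d = const_mx 1.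
      by apply/rowP => i; rewrite !mxE.
    by rewrite diag_const_mx mulmx1 -(invmx_unitary uP) mulVmx.
  rewrite exprSr IH -[_ * AC]/(_ *m AC) {1}eA.
  rewrite !mulmxA -[_ *m _ *m P *m P^t* ]mulmxA (unitarymxP uP) mulmx1.
  rewrite -[_ *m _ *m diag_mx d]mulmxA mulmx_diag; congr (_ *m diag_mx _ *m _).
  by apply/rowP => i; rewrite !mxE exprSr.
exists (fun k => complex.Re (d 0 k)), (fun k => complex.Re (P k 0 * (P k 0)^*)).
split=> [k|p].
  have : 0 <= P k 0 * (P k 0)^* by rewrite mul_conjC_ge0.
  by rewrite lecE => /andP[].
have cplx (z : R[i]) : z \is Num.real -> z = (complex.Re z)%:C%C.
  by move=> zr; rewrite RRe_real.
have : ((A ^+ p) 0 0)%:C%C = (AC ^+ p) 0 0.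
  by rewrite /AC -rmorphXn mxE.
rewrite eAp mxE => E.
apply: (@complexI R); rewrite E rmorph_sum; apply: eq_bigr => k _.
rewrite mul_mx_diag !mxE rmorphM rmorphXn /= -!cplx; first by ring.
- by move/mxOverP : dr; apply.
- by apply: ger0_real; rewrite mul_conjC_ge0.
Qed.

End SpectralMeasure.

(** Annihilation operator of the harmonic oscillator, e_j to sqrt(j) e_(j-1), truncated to indices
    at most N. Adding its transpose gives the Jacobi matrix of the Hermite polynomials orthonormal
    for the standard Gaussian. *)
Definition lowering (R : rcfType) N : 'M[R]_N.+1 :=
  \matrix_(i, j) (if j == i.+1 :> nat then Num.sqrt (j%:R) else 0).

Definition jacobi (R : rcfType) N : 'M[R]_N.+1 := lowering R N + (lowering R N)^T.

Lemma jacobi_band (R : rcfType) N k (i : 'I_N.+1) : (k < i)%N ->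
  (jacobi R N ^+ k) i 0 = 0.
Proof.
elim: k i => [|k IH] i ki; first by rewrite expr0 mxE (gtn_eqF ki : (i == 0) = false).
rewrite exprS -[_ * _]/(_ *m _) mxE big1 // => j _.
have [kj|jk] := ltnP k j; first by rewrite IH ?mulr0.
rewrite !mxE; case: eqP => [e|_]; first by lia.
by case: eqP => [e|_]; [lia | rewrite addr0 mul0r].
Qed.

(** Truncation spoils the canonical commutation relation only at the last basis vector, where a a^T
    gives 0 and a^T a gives N. *)
Lemma lowering_comm (R : rcfType) N : let a := lowering R N in
  a *m a^T - a^T *m a = 1%:M - (N.+1)%:R *: delta_mx ord_max ord_max.
Proof.
move=> a; apply/matrixP => i j; rewrite !mxE.
have -> : \sum_k a i k * a^T k j = (if (i < N)%N then (i.+1)%:R else 0) *+ (i == j).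
  case: ltnP => [iN|Ni].
    have h : (i.+1 < N.+1)%N by [].
    rewrite (bigD1 (Ordinal h)) //= !mxE /= eqxx big1 => [|k]; last first.
      rewrite -val_eqE /= !mxE => /negbTE ->; exact: mul0r.
    rewrite addr0 eqSS -[(i : nat) == j]/(i == j); case: eqP => _.
      by rewrite -expr2 sqr_sqrtr // ler0n.
    by rewrite mulr0.
  rewrite mul0rn big1 // => k _; rewrite !mxE; case: eqP => [e|]; last by rewrite mul0r.
  by have := ltn_ord k; lia.
have -> : \sum_k a^T i k * a k j = (i%:R) *+ (i == j).
  case: (posnP i) => [i0|ip].
    rewrite i0 mul0rn big1 // => k _; rewrite !mxE i0 /=; exact: mul0r.
  have h : (i.-1 < N.+1)%N by apply: leq_ltn_trans (ltn_ord i); lia.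
  rewrite (bigD1 (Ordinal h)) //= !mxE /= prednK // eqxx big1 => [|k]; last first.
    rewrite -val_eqE /= !mxE => /negbTE e; case: eqP => [e'|]; last by rewrite mul0r.
    by move: e; rewrite e' /= eqxx.
  rewrite addr0 eq_sym -[(i : nat) == j]/(i == j); case: eqP => [->|_].
    by rewrite -expr2 sqr_sqrtr // ler0n.
  by rewrite mulr0.
case: (eqVneq i j) => [<-|ij]; last first.
  rewrite !mulr0n subr0; case: (eqVneq i ord_max) => [e|_].
    by rewrite -e eq_sym (negbTE ij) mulr0 subr0.
  by rewrite mulr0 subr0.
rewrite !mulr1n andbb; case: ltnP => iN.
  rewrite (_ : (i == ord_max) = false) ?mulr0 ?subr0; last first.
    by apply/negbTE; rewrite -val_eqE /=; lia.
  by rewrite -natr1; ring.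
have -> : (i == ord_max) by rewrite -val_eqE /=; have := ltn_ord i; lia.
have -> : (i : nat) = N by have := ltn_ord i; lia.
by rewrite -natr1 /=; ring.
Qed.

(** By the commutation relation, [lowering] differentiates polynomials in [jacobi] applied to e_0,
    and it kills e_0. The corner defect is invisible while k <= N: by [jacobi_band], J^j e_0 has no
    component on e_N for j < N. *)
Lemma lowering_jacobi (R : rcfType) N k : (k <= N)%N ->
  lowering R N *m (jacobi R N ^+ k) *m delta_mx 0 0 =
  k%:R *: (jacobi R N ^+ k.-1 *m (delta_mx 0 0 : 'cV_N.+1)).
Proof.
set a := lowering R N; set J := jacobi R N.
elim: k => [|k IH] kN.
  rewrite expr0 mulmx1 scale0r -colE; apply/colP => i; rewrite !mxE /=.
  by [].
have aJ : a *m J = J *m a + (a *m a^T - a^T *m a).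
  by rewrite /J /jacobi -/a mulmxDr mulmxDl -addrA [_ + (_ - _)]addrC subrK.
rewrite exprS -[J * _]/(J *m _) !mulmxA aJ mulmxDl mulmxDl -!mulmxA [a *m (_ *m _)]mulmxA.
rewrite IH ?(ltnW kN) //.
rewrite lowering_comm mulmxBl mul1mx -scalemxAl.
have -> : (delta_mx ord_max ord_max : 'M[R]_N.+1) *m (J ^+ k *m delta_mx 0 0 : 'cV_N.+1) = 0.
  apply/matrixP => i j; rewrite mxE big1 ?mxE // => l _.
  rewrite ord1 -colE !mxE; case: (eqVneq l ord_max) => [->|_].
    by rewrite jacobi_band ?mulr0.
  by rewrite andbF mul0r.
rewrite scaler0 subr0 -scalemxAr mulmxA /=.
case: k {IH} kN => [|k] kN; first by rewrite scale0r add0r scale1r.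
by rewrite -[J *m _]/(J * _) -exprS /= -[in RHS]natr1 scalerDl scale1r.
Qed.

(** Row 0 of the transpose of [lowering] vanishes, so only the derivative remains: this is the
    recursion of the Gaussian moments. *)
Lemma jacobi_moment (R : rcfType) N k : (k <= N)%N ->
  (jacobi R N ^+ k.+1) 0 0 = k%:R * (jacobi R N ^+ k.-1) 0 0.
Proof.
move=> kN; set J := jacobi R N.
have E (B : 'M[R]_N.+1) : B 0 0 = (B *m (delta_mx 0 0 : 'cV_N.+1)) 0 0.
  by rewrite -colE mxE.
have /matrixP/(_ 0 0) := lowering_jacobi R kN.
rewrite [RHS]mxE -!E => <-.
rewrite exprS -[J * _]/(J *m _) {1}/J /jacobi mulmxDl mxE -/J.
rewrite [X in _ + X]mxE [X in _ + X]big1 ?addr0 // => j _.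
by rewrite !mxE /= mul0r.
Qed.

(** Exactness takes the form of Stein's identity, which determines the Gaussian moments and is the
    form used for integration by parts. *)
Lemma gauss_hermite (R : rcfType) (d : nat) :
  exists N (l w : 'I_N.+1 -> R), [/\ forall k, 0 <= w k, \sum_k w k = 1 &
    forall p : {poly R}, (size p <= d)%N ->
      \sum_k w k * (l k * p.[l k]) = \sum_k w k * p^`().[l k]].
Proof.
have Js : (jacobi R d)^T = jacobi R d.
  by rewrite /jacobi linearD /= trmxK addrC.
have [l [w [w0 E]]] := spectral_measure Js.
exists d, l, w; split=> // [|p sp].
  have := E 0%N; rewrite expr0 mxE eqxx => e; apply: etrans (esym e).
  by apply: eq_bigr => k _; rewrite mulr1.
rewrite -[p]coefK poly_def raddf_sum.
under eq_bigr => k _ do rewrite horner_sum !mulr_sumr.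
under [in RHS]eq_bigr => k _ do rewrite horner_sum !mulr_sumr.
rewrite exchange_big [RHS]exchange_big /=; apply: eq_bigr => i _.
have id : (i <= d)%N by apply: leq_trans (ltnW (ltn_ord i)) sp.
have := jacobi_moment R id; rewrite !E mulr_sumr => H.
transitivity (p`_i * \sum_k w k * l k ^+ i.+1).
  by rewrite mulr_sumr; apply: eq_bigr => k _; rewrite hornerZ hornerXn exprS; ring.
rewrite H mulr_sumr; apply: eq_bigr => k _.
by rewrite derivZ derivXn hornerZ hornerMn hornerXn -mulr_natl; ring.
Qed.

(** * Mixed moments of product Gauss-Hermite rules *)

Section ProductRule.
Variables (R : rcfType) (N m d : nat) (l w : 'I_N.+1 -> R).
Hypotheses (w_sum : \sum_k w k = 1)
  (w_stein : forall p : {poly R}, (size p <= d)%N ->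
      \sum_k w k * (l k * p.[l k]) = \sum_k w k * p^`().[l k]).

Let T := {ffun 'I_m -> 'I_N.+1}.

Definition upd (f : T) i k : T := [ffun j => if j == i then k else f j].

Definition prodw (f : T) := \prod_i w (f i).

Lemma upd_same f i k : upd f i k i = k. Proof. by rewrite ffunE eqxx. Qed.

Lemma upd_upd f i k k' : upd (upd f i k) i k' = upd f i k'.
Proof. by apply/ffunP => j; rewrite !ffunE; case: eqP. Qed.

Lemma upd_id f i : upd f i (f i) = f.
Proof. by apply/ffunP => j; rewrite !ffunE; case: eqP => // ->. Qed.

Lemma sum_upd (i : 'I_m) (F : T -> R) :
  \sum_f F f = \sum_(g : T | g i == ord0) \sum_k F (upd g i k).
Proof.
rewrite pair_big_dep /=.
rewrite (reindex_onto (fun p : T * 'I_N.+1 => upd p.1 i p.2)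
                      (fun f => (upd f i ord0, f i))) /=; last first.
  by move=> f _; rewrite upd_upd upd_id.
apply: eq_bigl => -[g k] /=; rewrite upd_same upd_upd andbT; apply/eqP/eqP.
  by case=> <-; rewrite upd_same.
by move=> e; rewrite -e upd_id.
Qed.

Lemma prodw_upd f i k : prodw (upd f i k) = w k * \prod_(j | j != i) w (f j).
Proof.
rewrite /prodw (bigD1 i) //= upd_same; congr (_ * _); apply: eq_bigr => j ji.
by rewrite ffunE (negbTE ji).
Qed.

(** Conditioning on all coordinates but the i-th: F may be replaced by its mean in that
    coordinate. *)
Lemma prodw_cond (i : 'I_m) (F : T -> R) :
  \sum_f prodw f * F f = \sum_f prodw f * \sum_k w k * F (upd f i k).
Proof.
rewrite (sum_upd i) [RHS](sum_upd i); apply: eq_bigr => g _.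
under [in RHS]eq_bigr => k _.
  under [X in _ * X]eq_bigr => k' _ do rewrite upd_upd.
  rewrite prodw_upd -mulrA.
  over.
rewrite -mulr_suml w_sum mul1r mulr_sumr; apply: eq_bigr => k _.
by rewrite prodw_upd; ring.
Qed.

Lemma prodw_sum : \sum_f prodw f = 1.
Proof. by rewrite /prodw -(bigA_distr_bigA (fun=> w)) /= big1 // => i _; exact: w_sum. Qed.

Lemma prodw_stein (i : 'I_m) (P : T -> {poly R}) :
  (forall f k, P (upd f i k) = P f) -> (forall f, (size (P f) <= d)%N) ->
  \sum_f prodw f * (l (f i) * (P f).[l (f i)]) =
  \sum_f prodw f * (P f)^`().[l (f i)].
Proof.
move=> Pu sP; rewrite (prodw_cond i) [RHS](prodw_cond i); apply: eq_bigr => f _.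
congr (_ * _).
under eq_bigr => k _ do rewrite Pu upd_same.
under [RHS]eq_bigr => k _ do rewrite Pu upd_same.
exact: w_stein.
Qed.

Definition lf (u : 'cV[R]_m) (f : T) := \sum_i u i 0 * l (f i).
Definition nf (f : T) := \sum_i l (f i) ^+ 2.

Definition gmom (u v : 'cV[R]_m) a b c :=
  \sum_f prodw f * (lf u f ^+ a * lf v f ^+ b * nf f ^+ c).

Let lf' (u : 'cV[R]_m) i (f : T) := \sum_(j | j != i) u j 0 * l (f j).
Let nf' i (f : T) := \sum_(j | j != i) l (f j) ^+ 2.
(** The integrand of [gmom] as a polynomial in the i-th coordinate, the others being frozen; Stein's
    identity applies in this form. *)
Let pol (u v : 'cV[R]_m) a b c i f : {poly R} :=
  (u i 0 *: 'X + (lf' u i f)%:P) ^+ a * (v i 0 *: 'X + (lf' v i f)%:P) ^+ b *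
  ('X^2 + (nf' i f)%:P) ^+ c.

Let pol_upd u v a b c i f k : pol u v a b c i (upd f i k) = pol u v a b c i f.
Proof.
rewrite /pol /lf' /nf'; congr ((_ + _%:P) ^+ _ * (_ + _%:P) ^+ _ * (_ + _%:P) ^+ _);
by apply: eq_bigr => j ji; rewrite ffunE (negbTE ji).
Qed.

Let size_pol u v a b c i f : (size (pol u v a b c i f) <= (a + b + 2 * c).+1)%N.
Proof.
have lin (x y : R) : (size (x *: 'X + y%:P)%R <= 2)%N.
  rewrite (leq_trans (size_polyD _ _)) // geq_max (leq_trans (size_scale_leq _ _)) ?size_polyX //.
  by rewrite (leq_trans (size_polyC_leq1 _)).
have quad (y : R) : (size ('X^2 + y%:P)%R <= 3)%N.
  rewrite (leq_trans (size_polyD _ _)) // geq_max size_polyXn /=.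
  by rewrite (leq_trans (size_polyC_leq1 _)).
have pw (p : {poly R}) k e : (size p <= e.+1)%N -> (size (p ^+ k) <= (e * k).+1)%N.
  move=> sp; apply: leq_trans (size_poly_exp_leq _ _) _.
  by rewrite ltnS leq_mul2r; apply/orP; right; lia.
have h1 := pw _ a _ (lin (u i 0) (lf' u i f)).
have h2 := pw _ b _ (lin (v i 0) (lf' v i f)).
have h3 := pw _ c _ (quad (nf' i f)).
rewrite /pol.
move: (_ ^+ a) (_ ^+ b) (_ ^+ c) h1 h2 h3 => p q s h1 h2 h3.
apply: leq_trans (size_polyMleq _ _) _.
move: (size_polyMleq p q) h1 h2 h3.
move: (size p) (size q) (size s) (size (p * q)%R) => n1 n2 n3 n4; lia.
Qed.

Let lfE (u : 'cV[R]_m) i (f : T) : (u i 0 *: 'X + (lf' u i f)%:P).[l (f i)] = lf u f.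
Proof. by rewrite !hornerE /lf (bigD1 i). Qed.

Let nfE i (f : T) : ('X^2 + (nf' i f)%:P).[l (f i)] = nf f.
Proof. by rewrite !hornerE /nf (bigD1 i). Qed.

Let polE u v a b c i f : (pol u v a b c i f).[l (f i)] =
  lf u f ^+ a * lf v f ^+ b * nf f ^+ c.
Proof. by rewrite !hornerM !horner_exp lfE lfE nfE. Qed.

Let dpolE u v a b c i f : (pol u v a b c i f)^`().[l (f i)] =
  a%:R * u i 0 * (lf u f ^+ a.-1 * lf v f ^+ b * nf f ^+ c) +
  b%:R * v i 0 * (lf u f ^+ a * lf v f ^+ b.-1 * nf f ^+ c) +
  2 * c%:R * l (f i) * (lf u f ^+ a * lf v f ^+ b * nf f ^+ c.-1).
Proof.
rewrite /pol !derivM !deriv_exp !derivD !derivZ !derivX !derivXn !derivC !addr0.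
rewrite -(lfE u i f) -(lfE v i f) -(nfE i f).
rewrite !(hornerD, hornerM, hornerMn, horner_exp, hornerZ, hornerC, hornerX).
rewrite -[_ *+ a]mulr_natl -[_ *+ b]mulr_natl -[_ *+ c]mulr_natl [2.-1]/= expr1 -!expr2.
move: (l (f i)) (_ + lf' u i f) (_ + lf' v i f) (_ + nf' i f) => x A B C; ring.
Qed.

Let dotvE (u v : 'cV[R]_m) : (u^T *m v) 0 0 = \sum_i u i 0 * v i 0.
Proof. by rewrite mxE; apply: eq_bigr => i _; rewrite mxE. Qed.

(** One factor <u, X> is expanded in coordinates and Stein's identity is applied to each. The
    derivative hits the remaining factors <u, X>, the factors <v, X>, or the squared norm. *)
Lemma gmom_rec u v a b c : (a + b + 2 * c < d)%N ->
  gmom u v a.+1 b c = a%:R * (u^T *m u) 0 0 * gmom u v a.-1 b c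
     + b%:R * (u^T *m v) 0 0 * gmom u v a b.-1 c + 2 * c%:R * gmom u v a.+1 b c.-1.
Proof.
move=> hd.
transitivity (\sum_i u i 0 *
    \sum_f prodw f * (l (f i) * (pol u v a b c i f).[l (f i)])).
  under [RHS]eq_bigr => i _ do rewrite mulr_sumr.
  rewrite exchange_big; apply: eq_bigr => f _ /=.
  under eq_bigr => i _ do rewrite polE.
  rewrite exprS {1}/lf -!mulrA mulr_suml mulr_sumr; apply: eq_bigr => i _; ring.
transitivity (\sum_i u i 0 * \sum_f prodw f *
    (a%:R * u i 0 * (lf u f ^+ a.-1 * lf v f ^+ b * nf f ^+ c) +
     b%:R * v i 0 * (lf u f ^+ a * lf v f ^+ b.-1 * nf f ^+ c) +
     2 * c%:R * l (f i) * (lf u f ^+ a * lf v f ^+ b * nf f ^+ c.-1))).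
  apply: eq_bigr => i _; rewrite prodw_stein; first last.
  - by move=> f; apply: leq_trans hd; exact: size_pol.
  - by move=> f k; exact: pol_upd.
  by congr (_ * _); apply: eq_bigr => f _; rewrite dpolE.
under eq_bigr => i _ do rewrite mulr_sumr.
rewrite exchange_big /gmom !mulr_sumr -!big_split; apply: eq_bigr => f _ /=.
rewrite !dotvE.
transitivity (\sum_i (prodw f * a%:R * (lf u f ^+ a.-1 * lf v f ^+ b * nf f ^+ c) * (u i 0 * u i 0)
   + prodw f * b%:R * (lf u f ^+ a * lf v f ^+ b.-1 * nf f ^+ c) * (u i 0 * v i 0)
   + prodw f * 2 * c%:R * (lf u f ^+ a * lf v f ^+ b * nf f ^+ c.-1) * (u i 0 * l (f i)))).
  by apply: eq_bigr => i _; ring.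
rewrite !big_split /= -!mulr_sumr -/(lf u f) exprS; ring.
Qed.

(** Stein's identity is applied to each X_i times X_i times the integrand; summing the derivatives
    over i gives Euler's relation for homogeneous polynomials. *)
Lemma gmom_euler u v a b c : (a + b + 2 * c + 1 < d)%N ->
  gmom u v a b c.+1 = (m%:R + a%:R + b%:R + 2 * c%:R) * gmom u v a b c.
Proof.
move=> hd.
transitivity (\sum_i
    \sum_f prodw f * (l (f i) * ('X * pol u v a b c i f).[l (f i)])).
  rewrite exchange_big; apply: eq_bigr => f _ /=.
  under eq_bigr => i _ do rewrite hornerM hornerX polE.
  transitivity (nf f * (prodw f * (lf u f ^+ a * lf v f ^+ b * nf f ^+ c))).
    by rewrite exprS; ring.
  rewrite {1}/nf mulr_suml; apply: eq_bigr => i _; ring.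
transitivity (\sum_i \sum_f prodw f *
    (lf u f ^+ a * lf v f ^+ b * nf f ^+ c + l (f i) *
    (a%:R * u i 0 * (lf u f ^+ a.-1 * lf v f ^+ b * nf f ^+ c) +
     b%:R * v i 0 * (lf u f ^+ a * lf v f ^+ b.-1 * nf f ^+ c) +
     2 * c%:R * l (f i) * (lf u f ^+ a * lf v f ^+ b * nf f ^+ c.-1)))).
  apply: eq_bigr => i _; rewrite prodw_stein; first last.
  - move=> f; apply: leq_trans (size_polyMleq _ _) _; rewrite size_polyX.
    have := size_pol u v a b c i f; lia.
  - by move=> f k; rewrite pol_upd.
  apply: eq_bigr => f _.
  by rewrite derivM derivX mul1r hornerD polE hornerM dpolE hornerX.
rewrite exchange_big /gmom !mulr_sumr; apply: eq_bigr => f _ /=.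
transitivity (\sum_(i < m) (prodw f * (lf u f ^+ a * lf v f ^+ b * nf f ^+ c)
   + prodw f * a%:R * (lf u f ^+ a.-1 * lf v f ^+ b * nf f ^+ c) * (u i 0 * l (f i))
   + prodw f * b%:R * (lf u f ^+ a * lf v f ^+ b.-1 * nf f ^+ c) * (v i 0 * l (f i))
   + prodw f * 2 * c%:R * (lf u f ^+ a * lf v f ^+ b * nf f ^+ c.-1) * (l (f i) ^+ 2))).
  by apply: eq_bigr => i _; ring.
rewrite !big_split /= -!mulr_sumr sumr_const card_ord.
rewrite -/(lf u f) -/(lf v f) -/(nf f) -mulr_natl.
case: a b c {hd} => [|a] [|b] [|c] /=; rewrite ?exprS; ring.
Qed.

(* The Euler identity makes this recursion homogeneous, so that the powers of
   the norm can be divided out when the nodes are projected to the sphere. *)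
Lemma gmom_sphere_rec u v a b c : (a + b + 2 * c + 1 < d)%N ->
  (m%:R + a%:R + b%:R - 1) * gmom u v a.+1 b c =
  a%:R * (u^T *m u) 0 0 * gmom u v a.-1 b c.+1
     + b%:R * (u^T *m v) 0 0 * gmom u v a b.-1 c.+1.
Proof.
move=> hd.

have h0 : gmom u v a.+1 b c = a%:R * (u^T *m u) 0 0 * gmom u v a.-1 b c
     + b%:R * (u^T *m v) 0 0 * gmom u v a b.-1 c + 2 * c%:R * gmom u v a.+1 b c.-1.
  by apply: gmom_rec; lia.
(* The three terms on the right of [gmom_rec] have the same total degree a + b + 2c - 1, so
   [gmom_euler] raises the power of the norm by the same factor K in each. *)
pose K : R := m%:R + a%:R + b%:R - 1 + 2 * c%:R.
have e1 : a%:R * gmom u v a.-1 b c.+1 = a%:R * (K * gmom u v a.-1 b c).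
  case: a @K hd {h0} => [|a] K hd; first by rewrite !mul0r.
  rewrite /= gmom_euler; last by lia.
  by rewrite /K -natr1; ring.
have e2 : b%:R * gmom u v a b.-1 c.+1 = b%:R * (K * gmom u v a b.-1 c).
  case: b @K hd {h0 e1} => [|b] K hd; first by rewrite !mul0r.
  rewrite /= gmom_euler; last by lia.
  by rewrite /K -natr1; ring.
have e3 : c%:R * gmom u v a.+1 b c = c%:R * (K * gmom u v a.+1 b c.-1).
  case: c @K hd {h0 e1 e2} => [|c] K hd; first by rewrite !mul0r.
  rewrite /= gmom_euler; last by lia.
  by rewrite /K -!natr1; ring.
rewrite [a%:R * _ * _]mulrAC e1 [b%:R * _ * _]mulrAC e2.
transitivity ((K - 2 * c%:R) * gmom u v a.+1 b c); first by rewrite /K; ring.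
rewrite mulrBl -[2 * _ * _]mulrA e3 h0; ring.
Qed.
End ProductRule.

(* Positive quadrature rule on the unit sphere, exact for products of at most
   [d] linear forms: the recursion determines all the mixed moments. *)
Definition cubature (R : realType) (m d : nat) (T : finType)
    (x : T -> 'cV[R]_m) (w : T -> R) : Prop :=
  [/\ forall k, 0 <= w k, forall k, dotv (x k) (x k) = 1, \sum_k w k = 1 &
   forall (u v : 'cV[R]_m) a b, dotv u u = 1 -> dotv v v = 1 -> (a + b < d)%N ->
   (m%:R + a%:R + b%:R - 1) *
      \sum_k w k * (dotv u (x k) ^+ a.+1 * dotv v (x k) ^+ b) =
   a%:R * (\sum_k w k * (dotv u (x k) ^+ a.-1 * dotv v (x k) ^+ b)) +
   b%:R * dotv u v * (\sum_k w k * (dotv u (x k) ^+ a * dotv v (x k) ^+ b.-1))].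

(** The nodes of a product rule are projected radially and reweighted by the power D of the squared
    norm. An even monomial of degree at most 2D on the sphere, times that power, is a homogeneous
    polynomial of degree 2D in the original nodes; G is the mass that normalizes the weights. *)
Lemma cubature_exists (R : realType) (m d : nat) : (0 < m)%N ->
  exists (T : finType) (x : T -> 'cV[R]_m) (w : T -> R), cubature d x w.
Proof.
move=> m0; pose D := d.+1.
have [N [l [w [w0 w1 wS]]]] := gauss_hermite R (4 * D).
pose T : finType := {ffun 'I_m -> 'I_N.+1}.
have pw0 (f : T) : 0 <= prodw w f by apply: prodr_ge0.
have nf0 (f : T) : 0 <= nf l f by apply: sumr_ge0 => i _; exact: sqr_ge0.
pose X (f : T) : 'cV[R]_m := \col_i l (f i).
have XX (f : T) : dotv (X f) (X f) = nf l f.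
  by rewrite /dotv mxE; apply: eq_bigr => i _; rewrite !mxE -expr2.
have uX u (f : T) : dotv u (X f) = lf l u f.
  by rewrite /dotv mxE; apply: eq_bigr => i _; rewrite !mxE.
pose e : 'cV[R]_m := delta_mx (Ordinal m0) 0.
have ee : dotv e e = 1.
  rewrite /dotv mxE (bigD1 (Ordinal m0)) //= big1 => [|j ji].
    by rewrite !mxE !eqxx mulr1 addr0.
  by rewrite !mxE (negbTE ji) mul0r.
have dotZ (a b : R) (u v : 'cV[R]_m) : dotv (a *: u) (b *: v) = a * b * dotv u v.
  by rewrite /dotv -scalemxAr [(a *: u)^T]linearZ /= -scalemxAl mxE [in LHS]mxE; ring.
pose s (f : T) := Num.sqrt (nf l f).
have ss f : s f ^+ 2 = nf l f by rewrite sqr_sqrtr.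
(* A node at the origin gets weight 0, since D > 0, so its image may be any unit vector. *)
pose y (f : T) : 'cV[R]_m := if nf l f == 0 then e else (s f)^-1 *: X f.
(* The nodes come in opposite pairs, which kills the odd moments. *)
pose x (p : T * bool) : 'cV[R]_m := (-1) ^+ p.2 *: y p.1.
pose g (u v : 'cV[R]_m) a b c := gmom l w u v a b c.
pose G := g 0 0 0%N 0%N D.
have gE0 u v c : g u v 0%N 0%N c = g 0 0 0%N 0%N c.
  by apply: eq_bigr => f _; rewrite !expr0.
have Gpos c : (c <= D)%N -> 0 < g 0 0 0%N 0%N c.
  elim: c => [|c IH] cD.
    rewrite /g /gmom; under eq_bigr => f _ do rewrite !expr0 !mulr1.
    by rewrite (prodw_sum m w1).
  rewrite /g (gmom_euler w1 wS); last by lia.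
  rewrite mulr_gt0 ?IH ?ltW // ?(ltnW cD) //.
  by rewrite !addr0 ltr_wpDr ?ltr0n // mulr_ge0 // ler0n.
pose W (p : T * bool) := prodw w p.1 * nf l p.1 ^+ D / (2 * G).
have G0 : 0 < G by apply: Gpos.
pose S (u v : 'cV[R]_m) a b := \sum_p W p * (dotv u (x p) ^+ a * dotv v (x p) ^+ b).
have ux u f c : dotv u (x (f, c)) = (-1) ^+ c * dotv u (y f).
  by rewrite -[u in LHS]scale1r dotZ mul1r.
have SE u v a b : S u v a b = (1 + (-1) ^+ (a + b)) / (2 * G) *
    \sum_f prodw w f * (nf l f ^+ D * (dotv u (y f) ^+ a * dotv v (y f) ^+ b)).
  rewrite /S -(pair_bigA _ (fun f c => W (f, c) *
    (dotv u (x (f, c)) ^+ a * dotv v (x (f, c)) ^+ b))) mulr_sumr /=.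
  apply: eq_bigr => f _; rewrite big_bool !ux /W /= expr1 expr0 !mul1r !mulN1r.
  by rewrite [(- _) ^+ a]exprNn [(- _) ^+ b]exprNn exprD; ring.
have Sodd u v a b : odd (a + b) -> S u v a b = 0.
  by move=> o; rewrite SE -signr_odd o expr1 subrr !mul0r.
have Seven u v a b c : (a + b + 2 * c = 2 * D)%N ->
    S u v a b = g u v a b c / G.
  move=> h; rewrite SE -signr_odd.
  have -> : odd (a + b) = false.
    by have /(congr1 odd) := h; rewrite oddD !oddM /= addbF.
  rewrite expr0 invfM mulrA divff ?mul1r; last by lra.
  rewrite mulrC; congr (_ / _); apply: eq_bigr => f _; congr (_ * _).
  rewrite /y; case: eqP => [n0|/eqP n0].
    have X0 : X f = 0.
      apply/colP => i; rewrite !mxE; apply/eqP; rewrite -sqrf_eq0.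
      have /psumr_eq0P := n0; move=> /(_ (fun i _ => sqr_ge0 _)) => H.
      by rewrite (H i).
    rewrite -!uX X0 n0 /D exprS !mul0r.
    have d0 u' : dotv u' (0 : 'cV[R]_m) = 0 by rewrite /dotv mulmx0 mxE.
    rewrite !d0; move: h; case: a => [|a]; last by rewrite exprS !mul0r.
    case: b => [|b]; last by rewrite [0 ^+ b.+1]exprS mul0r mulr0 mul0r.
    by case: c => [|c] //; rewrite exprS mul0r mulr0.
  have s0 : s f != 0 by rewrite -sqrf_eq0 ss.
  rewrite -[u in LHS]scale1r -[v in LHS]scale1r !dotZ !mul1r !uX -ss -!exprM -h.
  rewrite !exprMn !exprD !exprVn; field.
  by rewrite !expf_neq0.
exists (T * bool)%type, x, W; split.
- by move=> p; rewrite divr_ge0 ?mulr_ge0 ?exprn_ge0 // ltW.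
- move=> [f c]; rewrite dotZ -expr2 sqrr_sign mul1r /y.
  case: eqP => [//|/eqP n0]; rewrite dotZ XX -expr2 exprVn ss mulVf //.
- transitivity (S 0 0 0%N 0%N).
    by apply: eq_bigr => p _; rewrite !expr0 !mulr1.
  by rewrite (Seven _ _ _ _ D) // divff // gt_eqF.
- move=> u v a b uu vv abd; rewrite -!/(S u v _ _).
  have [oab|eab] := boolP (odd (a + b)); last first.
    rewrite Sodd ?mulr0; last by rewrite addSn /= eab.
    have -> : a%:R * S u v a.-1 b = 0.
      case: a abd eab => [|a] abd eab; first by rewrite mul0r.
      by rewrite Sodd ?mulr0 //; move: eab; rewrite addSn /= negbK.
    have -> : b%:R * dotv u v * S u v a b.-1 = 0.
      case: b abd eab => [|b] abd eab; first by rewrite !mul0r.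
      by rewrite Sodd ?mulr0 //; move: eab; rewrite addnS /= negbK.
    by rewrite addr0.
  pose c := (D - uphalf (a + b))%N.
  have hc : (a.+1 + b + 2 * c = 2 * D)%N by rewrite /c /D; lia.
  rewrite (Seven _ _ _ _ _ hc) mulrA (gmom_sphere_rec w1 wS); last by lia.
  rewrite -/(dotv u u) -/(dotv u v) uu mulr1 mulrDl.
  have -> : a%:R * S u v a.-1 b = a%:R * (g u v a.-1 b c.+1 / G).
    case: a @c hc {oab abd} => [|a] c hc; first by rewrite !mul0r.
    by rewrite (@Seven _ _ _ _ c.+1) //; simpl in *; lia.
  have -> : b%:R * dotv u v * S u v a b.-1 = b%:R * dotv u v * (g u v a b.-1 c.+1 / G).
    case: b @c hc {oab abd} => [|b] c hc; first by rewrite !mul0r.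
    by rewrite (@Seven _ _ _ _ c.+1) //; simpl in *; lia.
  by rewrite !mulrA.
Qed.

(** * Gegenbauer polynomials *)

(* Moments of a coordinate of a uniform random point of the sphere S^(m-1), so
   that [mom m p] below is the mean of [p] at such a coordinate. *)
Fixpoint smom (R : realType) (m k : nat) : R :=
  match k with
  | 0 => 1
  | k1.+1 => if k1 is k2.+1 then k1%:R / (m + k2)%:R * smom R m k2 else 0
  end.

Lemma smomS2 (R : realType) m k :
  smom R m k.+2 = k.+1%:R / (m + k)%:R * smom R m k.
Proof. by []. Qed.

Definition mom (R : realType) (m : nat) (p : {poly R}) : R :=
  \sum_(i < size p) p`_i * smom R m i.

Lemma mom_widen (R : realType) m (p : {poly R}) n : (size p <= n)%N ->
  mom m p = \sum_(i < n) p`_i * smom R m i.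
Proof.
move=> sp; rewrite /mom (big_ord_widen n (fun i => p`_i * smom R m i)) //.
rewrite [RHS](bigID (fun i : 'I_n => (i < size p)%N)) /= [X in _ + X]big1 ?addr0 // => i.
by rewrite -leqNgt => h; rewrite nth_default // mul0r.
Qed.

Fact mom_is_scalar (R : realType) m : scalar (@mom R m).
Proof.
move=> a p q; pose n := maxn (size (a *: p + q)) (maxn (size p) (size q)).
rewrite (@mom_widen _ _ _ n) ?leq_maxl // (@mom_widen _ _ p n); last by rewrite /n; lia.
rewrite (@mom_widen _ _ q n); last by rewrite /n; lia.
rewrite mulr_sumr -big_split; apply: eq_bigr => i _ /=.
by rewrite coefD coefZ; ring.
Qed.
HB.instance Definition _ (R : realType) m :=
  GRing.isLinear.Build R {poly R} R _ (@mom R m) (@mom_is_scalar R m).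

Lemma momXn (R : realType) m k : mom m 'X^k = smom R m k.
Proof.
rewrite /mom size_polyXn (bigD1 ord_max) //= coefXn eqxx mul1r big1 ?addr0 // => i.
by rewrite -val_eqE /= coefXn => /negbTE ->; rewrite mul0r.
Qed.

(* Gegenbauer polynomials of order m/2 - 1, normalized to be 1 at 1; the case
   m = 2 gives the Chebyshev polynomials. *)
Fixpoint geg (R : realType) (m d : nat) : {poly R} :=
  match d with
  | 0 => 1
  | d1.+1 => if d1 is d2.+1 then
      (m%:R + d2%:R - 1)^-1 *: ((m%:R + 2 * d2%:R) *: ('X * geg R m d1)
                    - d1%:R *: geg R m d2)
    else 'X
  end.

Section Gegenbauer.
Variables (R : realType) (m : nat).
Hypothesis m2 : (2 <= m)%N.
Local Notation Q := (geg R m).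
Local Notation mom := (@mom R m).
Local Notation smom := (smom R m).

Let m2R : 2 <= m%:R :> R. Proof. by rewrite ler_nat. Qed.

Lemma geg_rec i : (m%:R + i%:R - 1) *: Q i.+2 =
  (m%:R + 2 * i%:R) *: ('X * Q i.+1) - i.+1%:R *: Q i.
Proof.
rewrite [Q i.+2]/= scalerA divff ?scale1r //.
have mR := m2R; have i0 := ler0n R i; rewrite lt0r_neq0 //; lra.
Qed.

Lemma geg_at1 i : (Q i).[1] = 1.
Proof.
elim/ltn_ind: i => -[|[|i]] IH; rewrite ?hornerC ?hornerX //.
have := congr1 (fun p => p.[1]) (geg_rec i).
move: (IH i.+1 (ltnSn _)) (IH i (leqnSn _)).
move: (Q i.+2) (Q i.+1) (Q i) => A B C hB hC.
rewrite !(hornerZ, hornerD, hornerN, hornerM, hornerX) hB hC !mulr1 => h.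
have mR := m2R; have i0 := ler0n R i.
have n0 : m%:R + i%:R - 1 != 0 :> R by rewrite lt0r_neq0 //; lra.
by apply: (mulfI n0); rewrite h mulr1 -natr1; ring.
Qed.

Lemma size_geg_lead i : size (Q i) = i.+1 /\ 0 < lead_coef (Q i).
Proof.
elim/ltn_ind: i => -[|[|i]] IH.
- by rewrite size_poly1 lead_coef1.
- by rewrite size_polyX lead_coefX.
have [s1 l1] := IH i.+1 (ltnSn _); have [s0 l0] := IH i (leqnSn _).
have mR := m2R; have i0 := ler0n R i.
have X1 : size ('X * Q i.+1) = i.+3.
  by rewrite mulrC size_mulX ?s1 // -size_poly_gt0 s1.
have c1 : m%:R + 2 * i%:R != 0 :> R by rewrite lt0r_neq0 //; lra.
have c2 : (m%:R + i%:R - 1)^-1 != 0 :> R by rewrite invr_eq0 lt0r_neq0 //; lra.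
have ss : (size (- (i.+1%:R *: Q i)) < size ((m%:R + 2 * i%:R) *: ('X * Q i.+1)))%N.
  by rewrite size_polyN [X in (_ < X)%N]size_scale // X1 (leq_ltn_trans (size_scale_leq _ _)) // s0.
split; first by rewrite /= size_scale // size_polyDl // size_scale.
rewrite /= lead_coefZ lead_coefDl // lead_coefZ lead_coefM lead_coefX mul1r.
by rewrite !mulr_gt0 // ?invr_gt0; lra.
Qed.

Lemma size_geg i : size (Q i) = i.+1. Proof. by have [] := size_geg_lead i. Qed.

(* The moments [b i j] satisfy two-term recursions, which give at once their
   vanishing for j < i and their sign. *)
Let b i j := mom ('X^j * Q i).

Let b_rec i j : (m%:R + i%:R - 1) * b i.+2 j =
  (m%:R + 2 * i%:R) * b i.+1 j.+1 - i.+1%:R * b i j.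
Proof.
rewrite /b; move: (geg_rec i); move: (Q i.+2) (Q i.+1) (Q i) => A B C e.
rewrite -!linearZ -linearB /= scalerAr e mulrBr -!scalerAr.
by rewrite mulrA exprSr.
Qed.

Let smomSS k : (m%:R + k%:R) * smom k.+2 = k.+1%:R * smom k.
Proof.
have mR := m2R; have k0 := ler0n R k.
rewrite [smom _]/= natrD; field; rewrite lt0r_neq0 //; lra.
Qed.

Let b0 j : b 0 j = smom j. Proof. by rewrite /b /= mulr1 momXn. Qed.
Let b1 j : b 1 j = smom j.+1. Proof. by rewrite /b /= -exprSr momXn. Qed.

(** The two relations are carried together: with them every term of [b_rec] becomes a multiple of
    [b i j], so the difference in [b_rec] can be evaluated, which it does not reveal by itself. *)
Let b_closed i : (forall j, (m%:R + j%:R + i%:R - 1) * b i.+1 j = j%:R * b i j.-1) /\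
  (forall j, j%:R * b i.+1 j.-1 = (j%:R - i%:R) * b i j).
Proof.
elim: i => [|i [P Rc]].
  split=> j; rewrite b1 b0.
    case: j => [|j]; first by rewrite mulr0 mul0r.
    by rewrite -smomSS -natr1; ring.
  by case: j => [|j]; rewrite ?mul0r ?subr0 //= mul0r.
have P' j : (m%:R + j%:R + i.+1%:R - 1) * b i.+2 j = j%:R * b i.+1 j.-1.
  have mR := m2R; have i0 := ler0n R i; have j0 := ler0n R j.
  have n1 : m%:R + i%:R - 1 != 0 :> R by rewrite lt0r_neq0 //; lra.
  apply: (mulfI n1); rewrite mulrCA b_rec Rc.
  have := P j.+1 => /= h.
  transitivity ((m%:R + 2 * i%:R) * ((m%:R + j.+1%:R + i%:R - 1) * b i.+1 j.+1)
      - i.+1%:R * (m%:R + j%:R + i.+1%:R - 1) * b i j).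
    by rewrite -!natr1; ring.
  by rewrite h -!natr1; ring.
split=> // j.
case: j => [|j].
  rewrite mul0r; have := P 0%N; rewrite mul0r => /eqP; rewrite mulf_eq0 => /orP[/eqP h|/eqP ->].
    by have mR := m2R; have i0 := ler0n R i; lra.
  by rewrite mulr0.
have mR := m2R; have i0 := ler0n R i; have j0 := ler0n R j.
have n1 : m%:R + j%:R + i%:R != 0 :> R by rewrite lt0r_neq0 //; lra.
apply: (mulfI n1); rewrite /=.
have h1 := P' j; have h2 := P j.+1; have h3 := Rc j; move: h1 h2 h3; rewrite -!natr1 /= => h1 h2 h3.
transitivity ((j%:R + 1) * ((m%:R + j%:R + (i%:R + 1) - 1) * b i.+2 j)); first ring.
rewrite h1 h3.
transitivity ((j%:R - i%:R) * ((m%:R + (j%:R + 1) + i%:R - 1) * b i.+1 j.+1)); last ring.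
by rewrite h2; ring.
Qed.

(** The first relation of [b_closed] lowers i and j together and brings out the factor j, which
    reaches 0 before i does. *)
Lemma mom_geg_Xn i j : (j < i)%N -> mom ('X^j * Q i) = 0.
Proof.
rewrite -/(b i j); elim: i j => // i IH j ji.
have [/(_ j) h _] := b_closed i.
have mR := m2R; have i0 := ler0n R i; have j0 := ler0n R j.
have n1 : m%:R + j%:R + i%:R - 1 != 0 :> R by rewrite lt0r_neq0 //; lra.
apply: (mulfI n1); rewrite h mulr0.
by case: j ji {h j0 n1} => [|j] ji; rewrite ?mul0r // IH ?mulr0.
Qed.

Lemma smom_ge0 k : 0 <= smom k.
Proof.
elim/ltn_ind: k => -[|[|k]] IH //=.
by rewrite mulr_ge0 ?divr_ge0 ?ler0n // IH.
Qed.

(** This sign is what makes the multipliers [phi] nonnegative. *)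
Lemma mom_geg_Xn_ge0 i j : 0 <= mom ('X^j * Q i).
Proof.
rewrite -/(b i j); elim: i j => [|i IH] j; first by rewrite b0 smom_ge0.
have [/(_ j) h _] := b_closed i.
have mR := m2R; have i0 := ler0n R i; have j0 := ler0n R j.
have n1 : 0 < m%:R + j%:R + i%:R - 1 :> R by lra.
by rewrite -(pmulr_rge0 _ n1) h mulr_ge0.
Qed.

Lemma mom_geg_orth i (p : {poly R}) : (size p <= i)%N -> mom (p * Q i) = 0.
Proof.
move=> sp; rewrite -[p]coefK poly_def mulr_suml raddf_sum big1 //= => j _.
by rewrite -scalerAl linearZ /= mom_geg_Xn ?mulr0 // (leq_trans _ sp).
Qed.

Lemma mom_geg_diag i : 0 < mom ('X^i * Q i).
Proof.
rewrite -/(b i i); elim: i => [|i IH]; first by rewrite b0.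
have [/(_ i.+1) h _] := b_closed i.
have mR := m2R; have i0 := ler0n R i.
have n1 : 0 < m%:R + i.+1%:R + i%:R - 1 :> R by rewrite -natr1; lra.
by rewrite -(pmulr_rgt0 _ n1) h mulr_gt0 // ltr0n.
Qed.

Definition gnorm i := mom (Q i * Q i).

(** Orthogonality to lower degrees leaves only the leading term of one factor, which pairs
    positively with Q_i by [mom_geg_diag]. *)
Lemma gnorm_gt0 i : 0 < gnorm i.
Proof.
have [s l] := size_geg_lead i.
have e : Q i = take_poly i (Q i) + lead_coef (Q i) *: 'X^i.
  apply/polyP => j; rewrite coefD coef_take_poly coefZ coefXn lead_coefE s /=.
  have [ji|ij|->] := ltngtP j i; rewrite ?mulr0 ?addr0 ?mulr1 ?add0r //.
  by rewrite nth_default // s.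
rewrite /gnorm {1}e mulrDl linearD /= mom_geg_orth ?size_take_poly // add0r.
by rewrite -scalerAl linearZ /= mulr_gt0 // mom_geg_diag.
Qed.

Lemma geg_orth i j : i != j -> mom (Q i * Q j) = 0.
Proof.
have [ij|ji|//] := ltngtP i j => _; first by rewrite mom_geg_orth // size_geg.
by rewrite mulrC mom_geg_orth // size_geg.
Qed.

Lemma geg_expand n (p : {poly R}) : (size p <= n)%N ->
  p = \sum_(i < n) (mom (p * Q i) / gnorm i) *: Q i.
Proof.
move=> sp.
have [c e] : exists c : nat -> R, p = \sum_(i < n) c i *: Q i.
  elim: n p sp => [|n IH] p sp.
    by exists (fun=> 0); rewrite big_ord0; apply/eqP; rewrite -size_poly_leq0.
  have [s l] := size_geg_lead n.
  pose k := p`_n / lead_coef (Q n).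
  have [|c e] := IH (p - k *: Q n).
    apply/leq_sizeP => j; rewrite leq_eqVlt => /orP[/eqP <-|nj].
      by rewrite coefB coefZ /k lead_coefE s /= divfK ?subrr // -[X in _`_X]/(n.+1.-1) -s -lead_coefE gt_eqF.
    rewrite coefB coefZ !nth_default ?mulr0 ?subr0 //.
      by rewrite s.
    exact: leq_trans sp nj.
  exists (fun i => if i == n then k else c i).
  rewrite big_ord_recr /= eqxx -[LHS](subrK (k *: Q n)) e; congr (_ + _).
  by apply: eq_bigr => i _; rewrite ltn_eqF.
rewrite {1}e; apply: eq_bigr => i _; congr (_ *: _).
have -> : mom (p * Q i) = c i * gnorm i.
  rewrite e [_ * Q i]mulr_suml raddf_sum (bigD1 i) //= -scalerAl linearZ /= big1 ?addr0 // => j ji.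
  by rewrite -scalerAl linearZ /= geg_orth ?mulr0.
by rewrite mulfK // gt_eqF ?gnorm_gt0.
Qed.

End Gegenbauer.

Lemma dotvE (R : realType) n (x y : 'cV[R]_n) : dotv x y = \sum_i x i 0 * y i 0.
Proof. by rewrite /dotv mxE; apply: eq_bigr => i _; rewrite mxE. Qed.

Lemma dotvC (R : realType) n (x y : 'cV[R]_n) : dotv x y = dotv y x.
Proof. by rewrite !dotvE; apply: eq_bigr => i _; rewrite mulrC. Qed.

Lemma dotvDl (R : realType) n (x y z : 'cV[R]_n) : dotv (x + y) z = dotv x z + dotv y z.
Proof. by rewrite !dotvE -big_split; apply: eq_bigr => i _; rewrite mxE mulrDl. Qed.

Lemma dotvZl (R : realType) n a (x z : 'cV[R]_n) : dotv (a *: x) z = a * dotv x z.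
Proof. by rewrite !dotvE mulr_sumr; apply: eq_bigr => i _; rewrite mxE mulrA. Qed.

Lemma dotvDr (R : realType) n (x y z : 'cV[R]_n) : dotv z (x + y) = dotv z x + dotv z y.
Proof. by rewrite !(dotvC z) dotvDl. Qed.

Lemma dotvZr (R : realType) n a (x z : 'cV[R]_n) : dotv z (a *: x) = a * dotv z x.
Proof. by rewrite !(dotvC z) dotvZl. Qed.

Lemma dotvBl (R : realType) n (x y z : 'cV[R]_n) : dotv (x - y) z = dotv x z - dotv y z.
Proof. by rewrite dotvDl -scaleN1r dotvZl mulN1r. Qed.

Lemma dotvBr (R : realType) n (x y z : 'cV[R]_n) : dotv z (x - y) = dotv z x - dotv z y.
Proof. by rewrite !(dotvC z) dotvBl. Qed.

Lemma dotv_ge0 (R : realType) n (x : 'cV[R]_n) : 0 <= dotv x x.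
Proof. by rewrite dotvE sumr_ge0 // => i _; rewrite -expr2 sqr_ge0. Qed.

Lemma dotv_eq0 (R : realType) n (x : 'cV[R]_n) : (dotv x x == 0) = (x == 0).
Proof.
apply/eqP/eqP => [|->]; last by rewrite /dotv mulmx0 mxE.
rewrite dotvE => /psumr_eq0P h; apply/colP => i; rewrite mxE; apply/eqP.
by rewrite -sqrf_eq0 expr2 h // => j _; rewrite -expr2 sqr_ge0.
Qed.

Lemma dotv0 (R : realType) n (x : 'cV[R]_n) : dotv x 0 = 0.
Proof. by rewrite /dotv mulmx0 mxE. Qed.

Lemma dotv_CS (R : realType) n (x y : 'cV[R]_n) : dotv x y ^+ 2 <= dotv x x * dotv y y.
Proof.
have [->|y0] := eqVneq y 0; first by rewrite !dotv0 mulr0 expr0n.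
have yy : 0 < dotv y y by rewrite lt_neqAle eq_sym dotv_eq0 y0 dotv_ge0.
have := dotv_ge0 (dotv y y *: x - dotv x y *: y).
rewrite !(dotvBl, dotvBr, dotvZl, dotvZr) (dotvC y x) => h.
rewrite -subr_ge0 -(pmulr_rge0 _ yy); apply: le_trans h _.
by rewrite le_eqVlt; apply/orP; left; apply/eqP; ring.
Qed.

Lemma dotv_unit_bound (R : realType) n (x y : 'cV[R]_n) :
  dotv x x = 1 -> dotv y y = 1 -> -1 <= dotv x y <= 1.
Proof.
move=> x1 y1; have := dotv_CS x y; rewrite x1 y1 mulr1 => h.
by rewrite -ler_norml -[1]ger0_norm // -ler_sqr ?nnegrE // real_normK ?num_real // normr1 expr1n.
Qed.

(* [(gam m a b).[dotv u v]] is the mean of dotv u x ^ a * dotv v x ^ b over x in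
   the sphere S^(m-1), for unit u and v; likewise [star] is the convolution of
   zonal functions. *)
Fixpoint gam (R : realType) (m a b : nat) : {poly R} :=
  match a with
  | 0 => (smom R m b)%:P
  | a1.+1 => (m%:R + a1%:R + b%:R - 1)^-1 *:
     ((if a1 is a2.+1 then a1%:R *: gam R m a2 b else 0) +
      b%:R *: ('X * gam R m a1 b.-1))
  end.

Definition star (R : realType) m (p q : {poly R}) : {poly R} :=
  \sum_(i < size p) \sum_(j < size q) (p`_i * q`_j) *: gam R m i j.

(* [lia] does not identify all the instances of [size]. *)
Ltac size_lia := repeat (let n := fresh in move: (size _) => n); lia.

(** * Convolution of zonal polynomials and its consequences for positivity *)

Section Star.
Variables (R : realType) (m : nat).
Hypothesis m2 : (2 <= m)%N.
Local Notation Q := (geg R m).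

Lemma m2R : 2 <= m%:R :> R. Proof. by rewrite ler_nat. Qed.

Lemma size_gam a b : (size (gam R m a b) <= (minn a b).+1)%N.
Proof.
elim/ltn_ind: a b => -[|a] IH b; first by rewrite min0n size_polyC_leq1.
rewrite [gam _ _ _ _]/= (leq_trans (size_scale_leq _ _)) //.
rewrite (leq_trans (size_polyD _ _)) // geq_max; apply/andP; split.
  case: a IH => [|a] IH; first by rewrite size_poly0.
  by rewrite (leq_trans (size_scale_leq _ _)) // (leq_trans (IH _ _ _)) //; lia.
case: b => [|b]; first by rewrite scale0r size_poly0.
rewrite (leq_trans (size_scale_leq _ _)) //.
have := size_polyMleq 'X (gam R m a b); have := IH a (ltnSn _) b.
rewrite size_polyX [b.+1.-1]/=; move: (size _) (size _) => k l; lia.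
Qed.

(** In the recursion of [gam], a factor X uses up one unit of both exponents. This degree bound
    forces [star] to be diagonal on the Gegenbauer polynomials. *)
Lemma size_star (p q : {poly R}) : (size (star m p q) <= minn (size p) (size q))%N.
Proof.
rewrite /star; apply: (leq_trans (size_sum _ _ _)); apply/bigmax_leqP => i _.
apply: (leq_trans (size_sum _ _ _)); apply/bigmax_leqP => j _.
apply: (leq_trans (size_scale_leq _ _)); apply: (leq_trans (size_gam _ _)).
by have := ltn_ord i; have := ltn_ord j; lia.
Qed.

Section Cub.
Variables (d : nat) (T : finType) (x : T -> 'cV[R]_m) (w : T -> R).
Hypothesis cub : cubature d x w.

(** The recursion in [cubature] is the one that defines [gam], and it determines all the moments. *)
Lemma cub_gam u v a b : dotv u u = 1 -> dotv v v = 1 -> (a + b <= d)%N ->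
  \sum_k w k * (dotv u (x k) ^+ a * dotv v (x k) ^+ b) = (gam R m a b).[dotv u v].
Proof.
have [_ _ w1 rec] := cub => uu vv.
have mR := m2R.
(* The case a = 0, obtained from the recursion with v in place of u and b = 0. *)
have base : forall c, (c <= d)%N -> \sum_k w k * dotv v (x k) ^+ c = smom R m c.
  elim/ltn_ind => -[|[|c]] IH cd.
  - by under eq_bigr => k _ do rewrite expr0 mulr1.
  - have := rec v v 0%N 0%N vv vv; rewrite add0n => /(_ cd).
    rewrite !mul0r !addr0 => /eqP; rewrite mulf_eq0 => /orP[/eqP h|/eqP h]; first by lra.
    by rewrite /= -[RHS]h; apply: eq_bigr => k _; rewrite expr0 mulr1.
  - have := rec v v c.+1 0%N vv vv; rewrite addn0 => /(_ cd).
    rewrite /= mul0r mul0r addr0 addr0.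
    have -> : \sum_k w k * (dotv v (x k) ^+ c * dotv v (x k) ^+ 0) = smom R m c.
      by rewrite -IH ?(ltnW (ltnW cd)) //; apply: eq_bigr => k _; rewrite expr0 mulr1.
    move=> h; have c0 := ler0n R c.
    have n0 : m%:R + c.+1%:R - 1 != 0 :> R by rewrite -natr1 lt0r_neq0 //; lra.
    apply: (mulfI n0).
    transitivity ((m%:R + c.+1%:R - 1) * (\sum_k w k * (dotv v (x k) ^+ c.+2 * dotv v (x k) ^+ 0))).
      by congr (_ * _); apply: eq_bigr => k _; rewrite expr0 mulr1.
    rewrite h natrD -natr1; field; rewrite lt0r_neq0 //; lra.
elim/ltn_ind: a b => -[|a] IH b abd.
  rewrite /= hornerC -base //; apply: eq_bigr => k _; by rewrite expr0 mul1r.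
have a0 := ler0n R a; have b0 := ler0n R b.
have [/eqP|n0] := boolP (m%:R + a%:R + b%:R - 1 == 0 :> R); first by move=> h; lra.
apply: (mulfI n0); rewrite rec // [gam _ _ _ _]/= hornerZ mulrA divff // mul1r hornerD.
congr (_ + _).
  case: a IH abd {a0 n0} => [|a] IH abd; first by rewrite mul0r horner0.
  by rewrite /= IH ?hornerZ //; lia.
case: b abd {b0 n0} => [|b] abd; first by rewrite scale0r horner0 !mul0r.
by rewrite /= IH //; [rewrite hornerZ hornerM hornerX mulrA | lia].
Qed.

Lemma cub_star u v (p q : {poly R}) : dotv u u = 1 -> dotv v v = 1 ->
  (size p + size q <= d)%N ->
  \sum_k w k * (p.[dotv u (x k)] * q.[dotv v (x k)]) = (star m p q).[dotv u v].
Proof.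
move=> uu vv sd; rewrite /star horner_sum.
transitivity (\sum_k \sum_(i < size p) \sum_(j < size q)
   (p`_i * q`_j) * (w k * (dotv u (x k) ^+ i * dotv v (x k) ^+ j))).
  apply: eq_bigr => k _; rewrite !horner_coef mulr_suml mulr_sumr.
  apply: eq_bigr => i _; rewrite !mulr_sumr; apply: eq_bigr => j _; ring.
rewrite exchange_big; apply: eq_bigr => i _ /=.
rewrite exchange_big horner_sum; apply: eq_bigr => j _ /=.
rewrite -mulr_sumr cub_gam ?hornerZ //.
by apply: leq_trans sd; rewrite leq_add // ltnW.
Qed.

Lemma cub_mom u (p : {poly R}) : dotv u u = 1 -> (size p <= d)%N ->
  \sum_k w k * p.[dotv u (x k)] = mom m p.
Proof.
move=> uu sd; rewrite /mom.
transitivity (\sum_k \sum_(i < size p)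
   p`_i * (w k * (dotv u (x k) ^+ 0 * dotv u (x k) ^+ i))).
  apply: eq_bigr => k _; rewrite !horner_coef mulr_sumr.
  apply: eq_bigr => i _; ring.
rewrite exchange_big; apply: eq_bigr => i _ /=.
rewrite -mulr_sumr cub_gam /= ?hornerC //.
by rewrite add0n (leq_trans _ sd) // ltnW.
Qed.
End Cub.

Let cub_ex d : exists (T : finType) (x : T -> 'cV[R]_m) (w : T -> R), cubature d x w.
Proof. by apply: cubature_exists; lia. Qed.

Lemma unit_pair (t : R) : -1 <= t <= 1 ->
  exists u v : 'cV[R]_m, [/\ dotv u u = 1, dotv v v = 1 & dotv u v = t].
Proof.
move=> /andP[t1 t2].
have h0 : (0 < m)%N by lia.
pose i0 := Ordinal h0; pose i1 := Ordinal m2.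
pose e0 : 'cV[R]_m := delta_mx i0 0; pose e1 : 'cV[R]_m := delta_mx i1 0.
have dd (i j : 'I_m) : dotv (delta_mx i 0 : 'cV[R]_m) (delta_mx j 0) = (i == j)%:R.
  rewrite dotvE (bigD1 i) //= big1 ?addr0 => [|k ki]; last by rewrite !mxE (negbTE ki) mul0r.
  by rewrite !mxE eqxx mul1r andbT.
exists e0, (t *: e0 + Num.sqrt (1 - t ^+ 2) *: e1).
have i01 : (i0 == i1) = false by []. have i10 : (i1 == i0) = false by [].
rewrite !(dotvDl, dotvDr, dotvZl, dotvZr) !dd !eqxx i01 i10.
rewrite !(mulr0, addr0, add0r, mulr1); split=> //.
rewrite -!expr2 sqr_sqrtr; first by ring.
by nra.
Qed.

Let one_unit : exists u : 'cV[R]_m, dotv u u = 1.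
Proof. by have [|u [v []]] := @unit_pair 1; [lra | exists u]. Qed.

(** Both sides are the same double sum over nodes x_k, x_l, of p(<u, x_l>) q(<x_k, x_l>) r(<u,
    x_k>), taken in different orders. *)
Lemma mom_star (p q r : {poly R}) : mom m (star m p q * r) = mom m (p * star m q r).
Proof.
have [T [x [w cub]]] := cub_ex
  (size (star m p q * r)%R + size (p * star m q r)%R + size p + size q + size r)%N.
have [_ x1 _ _] := cub.
have [u uu] := one_unit.
rewrite -(cub_mom cub uu); last by size_lia.
rewrite -(cub_mom cub uu); last by size_lia.
transitivity (\sum_k w k * \sum_l w l * (p.[dotv u (x l)] * q.[dotv (x k) (x l)] * r.[dotv u (x k)])).
  apply: eq_bigr => k _; rewrite hornerM -(cub_star cub uu (x1 k)); last by size_lia.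
  by rewrite mulr_suml; congr (_ * _); apply: eq_bigr => l _; ring.
transitivity (\sum_l w l * \sum_k w k * (p.[dotv u (x l)] * q.[dotv (x k) (x l)] * r.[dotv u (x k)])).
  under eq_bigr => k _ do rewrite mulr_sumr.
  under [RHS]eq_bigr => k _ do rewrite mulr_sumr.
  by rewrite exchange_big; apply: eq_bigr => l _; apply: eq_bigr => k _; rewrite mulrCA.
apply: eq_bigr => k _; rewrite hornerM [dotv u (x k) in X in _ = _ * (_ * X)]dotvC.
rewrite -(cub_star cub (x1 k) uu); last by size_lia.
congr (_ * _); rewrite mulr_sumr; apply: eq_bigr => l _.
by rewrite (dotvC (x l) (x k)); ring.
Qed.

(** By [size_star] the expansion stops at degree j. By [mom_star] each coefficient pairs Q_i with a
    polynomial of degree at most j < i. *)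
Lemma geg_star_lt i j : (j < i)%N -> star m (Q i) (Q j) = 0.
Proof.
move=> ji.
have sz : (size (star m (Q i) (Q j)) <= j.+1)%N.
  by apply: (leq_trans (size_star _ _)); rewrite !size_geg //; lia.
rewrite (geg_expand m2 sz) big1 // => k _; rewrite mom_star.
rewrite [Q i * _]mulrC mom_geg_orth ?mul0r ?scale0r //.
by apply: (leq_trans (size_star _ _)); rewrite !size_geg //; lia.
Qed.

(** For i < j, [mom_star] moves the pairing to [star m (Q j) (Q k)] with k <= i, which vanishes by
    [geg_star_lt]. *)
Lemma geg_star_neq i j : i != j -> star m (Q i) (Q j) = 0.
Proof.
have [ij|ji|//] := ltngtP i j => _; last exact: geg_star_lt.
have sz : (size (star m (Q i) (Q j)) <= i.+1)%N.
  by apply: (leq_trans (size_star _ _)); rewrite !size_geg //; lia.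
rewrite (geg_expand m2 sz) big1 // => k _; rewrite mom_star.
rewrite geg_star_lt ?mulr0 ?linear0 ?mul0r ?scale0r //.
by have := ltn_ord k; lia.
Qed.

(** The adjunction leaves a multiple of Q_i. The factor is read off at t = 1, where the convolution
    is the mean of Q_i^2. *)
Lemma geg_star_diag i : star m (Q i) (Q i) = gnorm R m i *: Q i.
Proof.
have sz : (size (star m (Q i) (Q i)) <= i.+1)%N.
  by apply: (leq_trans (size_star _ _)); rewrite !size_geg //; lia.
rewrite (geg_expand m2 sz) big_ord_recr big1 /= ?add0r => [|k _]; last first.
  by rewrite mom_star geg_star_lt // mulr0 linear0 mul0r scale0r.
set c := _ / _; congr (_ *: _).
have e : star m (Q i) (Q i) = c *: Q i.
  rewrite (geg_expand m2 sz) big_ord_recr big1 /= ?add0r => [//|k _].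
  by rewrite mom_star geg_star_lt // mulr0 linear0 mul0r scale0r.
have := congr1 (fun p => p.[1]) e; rewrite hornerZ geg_at1 // mulr1 => <-.
have [T [x [w cub]]] := cub_ex (size (Q i) + size (Q i) + size (Q i * Q i)%R)%N.
have [u uu] := one_unit.
rewrite -uu -(cub_star cub uu uu); last by size_lia.
rewrite /gnorm -(cub_mom cub uu); last by size_lia.
by apply: eq_bigr => k _; rewrite hornerM.
Qed.

(** Repeated points are allowed, since the nodes of a cubature may coincide. *)
Definition sphere_pd (h : R -> R) := forall (N : nat) (u : 'I_N -> 'cV[R]_m) (z : 'I_N -> R),
  (forall k, dotv (u k) (u k) = 1) ->
  0 <= \sum_k \sum_l z k * z l * h (dotv (u k) (u l)).

(* The reproducing property [geg_star_diag] writes the kernel [Q i] as a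
   positive combination of rank one kernels, indexed by the nodes of a
   cubature. *)
Lemma geg_schur i (N : nat) (u : 'I_N -> 'cV[R]_m) (A : 'I_N -> 'I_N -> R) :
  (forall k, dotv (u k) (u k) = 1) ->
  (forall z : 'I_N -> R, 0 <= \sum_k \sum_l z k * z l * A k l) ->
  forall z : 'I_N -> R,
  0 <= \sum_k \sum_l z k * z l * (A k l * (Q i).[dotv (u k) (u l)]).
Proof.
move=> u1 Apsd z.
have [T [x [w cub]]] := cub_ex (size (Q i) + size (Q i))%N.
have [w0 _ _ _] := cub.
rewrite -(pmulr_rge0 _ (gnorm_gt0 R m2 i)).
pose y t k := z k * (Q i).[dotv (u k) (x t)].
suff -> : gnorm R m i * (\sum_k \sum_l z k * z l * (A k l * (Q i).[dotv (u k) (u l)])) =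
   \sum_t w t * (\sum_k \sum_l y t k * y t l * A k l).
  by rewrite sumr_ge0 // => t _; rewrite mulr_ge0.
transitivity (\sum_k \sum_l \sum_t w t * (y t k * y t l * A k l)).
  rewrite mulr_sumr; apply: eq_bigr => k _; rewrite mulr_sumr; apply: eq_bigr => l _.
  transitivity (z k * z l * A k l * (gnorm R m i * (Q i).[dotv (u k) (u l)])); first ring.
  rewrite -hornerZ -geg_star_diag -(cub_star cub) // mulr_sumr.
  by apply: eq_bigr => t _; rewrite /y; ring.
under eq_bigr => k _ do rewrite exchange_big.
rewrite exchange_big; apply: eq_bigr => t _ /=.
by rewrite mulr_sumr; apply: eq_bigr => k _; rewrite mulr_sumr.
Qed.

Lemma geg_pd i : sphere_pd (horner (Q i)).
Proof.
move=> N u z u1; have := @geg_schur i N u (fun _ _ => 1) u1 _ z.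
under eq_bigr => k _ do under eq_bigr => l _ do rewrite mul1r.
apply=> y; suff -> : \sum_k \sum_l y k * y l * 1 = (\sum_k y k) ^+ 2 by rewrite sqr_ge0.
rewrite expr2 mulr_suml; apply: eq_bigr => k _; rewrite mulr_sumr.
by apply: eq_bigr => l _; rewrite mulr1.
Qed.

(** Positive definiteness on two points at cosine t, with coefficients 1, 1 and 1, -1. *)
Lemma geg_bound i (t : R) : -1 <= t <= 1 -> `|(Q i).[t]| <= 1.
Proof.
move=> /unit_pair[u [v [uu vv uv]]].
have H (s : R) : s ^+ 2 = 1 -> 0 <= 2 + 2 * s * (Q i).[t].
  move=> s1.
  have /= := @geg_pd i 2 (fun k => if k == 0 then u else v) (fun k => if k == 0 then 1 else s).
  rewrite !big_ord_recl !big_ord0 /= !addr0 uu vv uv (dotvC v u) uv geg_at1 // => h.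
  apply: le_trans (h _) _; first by move=> k; case: eqP.
  by rewrite -[s * s]expr2 s1; lra.
have := H 1; have := H (-1); rewrite sqrrN !expr1n => /(_ erefl) h1 /(_ erefl) h2.
by rewrite ler_norml; lra.
Qed.

Lemma mom_norm_le (p : {poly R}) (c : R) :
  (forall t, -1 <= t <= 1 -> `|p.[t]| <= c) -> `|mom m p| <= c.
Proof.
move=> h; have [T [x [w cub]]] := cub_ex (size p); have [w0 x1 w1 _] := cub.
have [u uu] := one_unit.
rewrite -(cub_mom cub uu) // (le_trans (ler_norm_sum _ _ _)) //.
rewrite -[c]mul1r -w1 mulr_suml ler_sum // => k _.
by rewrite normrM ger0_norm // ler_wpM2l // h // dotv_unit_bound.
Qed.

Lemma mom_ge0 (p : {poly R}) :
  (forall t, -1 <= t <= 1 -> 0 <= p.[t]) -> 0 <= mom m p.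
Proof.
move=> h; have [T [x [w cub]]] := cub_ex (size p); have [w0 x1 w1 _] := cub.
have [u uu] := one_unit.
rewrite -(cub_mom cub uu) // sumr_ge0 // => k _.
by rewrite mulr_ge0 // h // dotv_unit_bound.
Qed.

(** The nodes of a cubature serve as test points and its weights as coefficients: every row of the
    double sum of p(<x_k, x_l>) is the mean of p. *)
Lemma sphere_pd_mom_approx (h : R -> R) (p : {poly R}) e : sphere_pd h ->
  (forall t, -1 <= t <= 1 -> `|h t - p.[t]| <= e) -> - e <= mom m p.
Proof.
move=> hpd hp.
have [T [x [w cub]]] := cub_ex (size p); have [w0 x1 w1 _] := cub.
have E k : \sum_l w l * p.[dotv (x k) (x l)] = mom m p by rewrite (cub_mom cub).
have -> : mom m p = \sum_k \sum_l w k * w l * p.[dotv (x k) (x l)].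
  rewrite -[LHS]mul1r -w1 mulr_suml; apply: eq_bigr => k _.
  by rewrite -(E k) mulr_sumr; apply: eq_bigr => l _; rewrite mulrA.
pose nu (k : 'I_#|T|) : T := @enum_val T T k.
have := hpd #|T| (fun k => x (nu k)) (fun k => w (nu k)) (fun k => x1 _).
have -> : \sum_k \sum_l w (nu k) * w (nu l) * h (dotv (x (nu k)) (x (nu l)))
   = \sum_k \sum_l w k * w l * h (dotv (x k) (x l)).
  symmetry; rewrite (reindex nu); last exact: onW_bij (enum_val_bij T).
  apply: eq_bigr => k _.
  by rewrite (reindex nu); last exact: onW_bij (enum_val_bij T).
move=> h0; rewrite -subr_ge0 opprK; apply: le_trans h0 _.
have -> : e = \sum_k \sum_l w k * w l * e.
  rewrite -[LHS]mul1r -w1 mulr_suml; apply: eq_bigr => k _.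
  rewrite -[e in LHS]mul1r -w1 mulr_suml mulr_sumr.
  by apply: eq_bigr => l _; rewrite mulrA.
rewrite -big_split ler_sum // => k _; rewrite -big_split ler_sum // => l _ /=.
rewrite -mulrDr ler_wpM2l ?mulr_ge0 //.
by have := hp _ (dotv_unit_bound (x1 k) (x1 l)); rewrite ler_norml; lra.
Qed.

End Star.

(** * Zonal positive definite functions *)

Definition apx (R : realType) (h : R -> R) (p : {poly R}) (e : R) :=
  forall t, -1 <= t <= 1 -> `|h t - p.[t]| <= e.

(* By Weierstrass these are the continuous functions on [-1, 1]. *)
Definition papx (R : realType) (h : R -> R) :=
  forall e, 0 < e -> exists p, apx h p e.

(** The mean over the sphere as the best lower bound that polynomial approximations provide; for h
    in [papx], [smeanP] pins the value down. *)
Definition smean (R : realType) (m : nat) (h : R -> R) : R :=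
  sup [set x | exists p e, apx h p e /\ x = mom m p - e]%classic.

Lemma poly_bounded (R : realType) (p : {poly R}) :
  exists2 c, 0 <= c & forall t, -1 <= t <= 1 -> `|p.[t]| <= c.
Proof.
exists (\sum_(i < size p) `|p`_i|) => [|t ht]; first exact: sumr_ge0.
rewrite horner_coef (le_trans (ler_norm_sum _ _ _)) // ler_sum // => i _.
rewrite normrM normrX ler_piMr // exprn_ile1 // ler_norml; lra.
Qed.

Lemma le_eps (R : realType) (x y K : R) : 0 <= K ->
  (forall e, 0 < e -> x <= y + e * K) -> x <= y.
Proof.
move=> K0 h; apply/ler_addgt0Pr => e e0.
have K1 : 0 < K + 1 by lra.
apply: le_trans (h (e / (K + 1)) _) _; first by rewrite divr_gt0.
rewrite lerD2l -mulrA ler_piMr ?(ltW e0) // mulrC ler_pdivrMr // mul1r; lra.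
Qed.

Lemma eq_eps (R : realType) (x y K : R) : 0 <= K ->
  (forall e, 0 < e -> `|x - y| <= e * K) -> x = y.
Proof.
move=> K0 h; apply/eqP; rewrite -subr_eq0 -normr_le0.
by apply: (@le_eps _ _ _ K) => // e e0; rewrite add0r h.
Qed.

Section Mean.
Variables (R : realType) (m : nat).
Hypothesis m2 : (2 <= m)%N.
Local Notation Q := (geg R m).
Local Notation avg := (@smean R m).

Lemma apx_lin a b f g p q e e' : apx f p e -> apx g q e' ->
  apx (fun t : R => a * f t + b * g t) (a *: p + b *: q) (`|a| * e + `|b| * e').
Proof.
move=> hf hg t ht; rewrite hornerD !hornerZ.
have -> : a * f t + b * g t - (a * p.[t] + b * q.[t]) =
   a * (f t - p.[t]) + b * (g t - q.[t]) by ring.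
rewrite (le_trans (ler_normD _ _)) // !normrM lerD // ler_wpM2l //.
  exact: hf.
exact: hg.
Qed.

Lemma apx_poly p : apx (horner p) p (0 : R).
Proof. by move=> t _; rewrite subrr normr0. Qed.

Lemma papx_poly (p : {poly R}) : papx (horner p).
Proof. by move=> e e0; exists p => t ht; rewrite subrr normr0 ltW. Qed.

Lemma papx_lin a b (f g : R -> R) : papx f -> papx g -> papx (fun t => a * f t + b * g t).
Proof.
move=> hf hg e e0; pose k := `|a| + `|b| + 1.
have k0 : 0 < k by rewrite /k; have := normr_ge0 a; have := normr_ge0 b; lra.
have [p hp] := hf (e / k) (divr_gt0 e0 k0).
have [q hq] := hg (e / k) (divr_gt0 e0 k0).
exists (a *: p + b *: q) => t ht; apply: le_trans (apx_lin a b hp hq ht) _.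
rewrite -mulrDl mulrA ler_pdivrMr // mulrC ler_wpM2l ?(ltW e0) // /k; lra.
Qed.

Lemma apx_mulp (f : R -> R) p q e c : (forall t, -1 <= t <= 1 -> `|q.[t]| <= c) -> 0 <= e ->
  apx f p e -> apx (fun t => f t * q.[t]) (p * q) (e * c).
Proof.
move=> hq e0 hf t ht; rewrite hornerM -mulrBl normrM ler_pM //.
  exact: hf.
exact: hq.
Qed.

Lemma papx_mulp (f : R -> R) q : papx f -> papx (fun t => f t * q.[t]).
Proof.
move=> hf e e0; have [c c0 hc] := poly_bounded q.
have c1 : 0 < c + 1 by lra.
have [p hp] := hf (e / (c + 1)) (divr_gt0 e0 c1).
exists (p * q) => t ht; apply: le_trans (apx_mulp hc (ltW (divr_gt0 e0 c1)) hp ht) _.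
rewrite mulrAC ler_pdivrMr // ler_wpM2l ?(ltW e0) //; lra.
Qed.

Lemma apx_mom_le (h : R -> R) p q e e' : apx h p e -> apx h q e' -> mom m p - mom m q <= e + e'.
Proof.
move=> hp hq; apply: le_trans (ler_norm _) _; rewrite -linearB /=.
apply: mom_norm_le => // t ht; rewrite hornerD hornerN.
have := hp t ht; have := hq t ht; rewrite !ler_norml; lra.
Qed.

Lemma smeanP h p e : apx h p e -> `|avg h - mom m p| <= e.
Proof.
move=> hp; rewrite ler_norml; set S := [set x | exists p e, apx h p e /\ x = mom m p - e]%classic.
have ubS : ubound S (mom m p + e).
  by move=> _ [q [e' [hq ->]]]; have := apx_mom_le hq hp; lra.
have Sp : S (mom m p - e) by exists p, e.
have h1 : avg h <= mom m p + e by apply: ge_sup => //; exists (mom m p - e).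
have h2 : mom m p - e <= avg h by apply: ub_le_sup => //; exists (mom m p + e).
lra.
Qed.

Lemma smean_poly p : avg (horner p) = mom m p.
Proof.
by apply/eqP; rewrite -subr_eq0 -normr_le0; apply: smeanP; exact: apx_poly.
Qed.

Lemma smean_lin a b f g : papx f -> papx g ->
  avg (fun t => a * f t + b * g t) = a * avg f + b * avg g.
Proof.
move=> hf hg; pose K := 2 * (`|a| + `|b|).
have a0 := normr_ge0 a; have b0 := normr_ge0 b.
apply: (@eq_eps _ _ _ K) => [|e e0]; first by rewrite /K; lra.
have [p hp] := hf e e0; have [q hq] := hg e e0.
have h1 := smeanP (apx_lin a b hp hq); have h2 := smeanP hp; have h3 := smeanP hq.
rewrite linearD !linearZ /= in h1.
set X := avg _ in h1 *.
have -> : X - (a * avg f + b * avg g) = (X - (a * mom m p + b * mom m q))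
   - a * (avg f - mom m p) - b * (avg g - mom m q) by ring.
rewrite (le_trans (ler_normB _ _)) //.
have h4 : `|b * (avg g - mom m q)| <= `|b| * e by rewrite normrM ler_wpM2l.
have h5 : `|a * (avg f - mom m p)| <= `|a| * e by rewrite normrM ler_wpM2l.
have h6 := ler_normB (X - (a * mom m p + b * mom m q)) (a * (avg f - mom m p)).
by rewrite /K; nra.
Qed.

Lemma smean_ext f g : (forall t, -1 <= t <= 1 -> f t = g t) -> avg f = avg g.
Proof.
move=> fg; rewrite /smean; congr sup; apply/seteqP; split=> x [p [e [hp ->]]];
  exists p, e; split=> // t ht; [rewrite -fg | rewrite fg] => //; exact: hp.
Qed.

Lemma smean_norm_le f c : papx f -> (forall t, -1 <= t <= 1 -> `|f t| <= c) ->
  `|avg f| <= c.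
Proof.
move=> hf hc; apply: (@le_eps _ _ _ 2) => // e e0.
have [p hp] := hf e e0.
have h1 := smeanP hp.
have h2 : `|mom m p| <= c + e.
  apply: mom_norm_le => // t ht; have := hc t ht; have := hp t ht.
  by rewrite !ler_norml; lra.
by move: h1 h2; rewrite !ler_norml; lra.
Qed.

Lemma smean_pd h : papx h -> sphere_pd m h -> 0 <= avg h.
Proof.
move=> hh hpd; apply: (@le_eps _ _ _ 2) => // e e0.
have [p hp] := hh e e0.
have := sphere_pd_mom_approx m2 hpd hp; have := smeanP hp.
by rewrite ler_norml; lra.
Qed.

Definition gcoef i (h : R -> R) := avg (fun t => h t * (Q i).[t]) / gnorm R m i.

Let gn i : 0 < gnorm R m i. Proof. exact: gnorm_gt0. Qed.

Lemma gcoef_lin i a b f g : papx f -> papx g ->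
  gcoef i (fun t => a * f t + b * g t) = a * gcoef i f + b * gcoef i g.
Proof.
move=> hf hg; rewrite /gcoef !mulrA -mulrDl -smean_lin; try exact: papx_mulp.
by congr (_ / _); apply: smean_ext => t _; ring.
Qed.

Lemma gcoef_poly i p : gcoef i (horner p) = mom m (p * Q i) / gnorm R m i.
Proof.
by rewrite /gcoef -smean_poly; congr (_ / _); apply: smean_ext => t _; rewrite hornerM.
Qed.

Lemma gcoef_ext i f g : (forall t, -1 <= t <= 1 -> f t = g t) -> gcoef i f = gcoef i g.
Proof. by move=> fg; congr (_ / _); apply: smean_ext => t ht; rewrite fg. Qed.

Lemma gcoef_norm_le i f c : papx f -> (forall t, -1 <= t <= 1 -> `|f t| <= c) ->
  `|gcoef i f| <= c / gnorm R m i.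
Proof.
move=> hf hc; rewrite /gcoef normrM [`|_^-1|]gtr0_norm ?invr_gt0 //.
rewrite ler_pM2r ?invr_gt0 //; apply: smean_norm_le; first exact: papx_mulp.
move=> t ht; rewrite normrM -[c]mulr1 ler_pM // ?hc //.
exact: geg_bound.
Qed.

(** The product of h and Q_i is again p.d. by [geg_schur], and p.d. functions have nonnegative
    mean. *)
Lemma gcoef_ge0 i h : papx h -> sphere_pd m h -> 0 <= gcoef i h.
Proof.
move=> hh hpd; rewrite divr_ge0 ?(ltW (gn i)) //; apply: smean_pd; first exact: papx_mulp.
move=> N u z u1; apply: (geg_schur m2 i u1) => y; exact: hpd.
Qed.

Lemma smom_gt0 k : 0 < smom R m (2 * k).
Proof.
elim: k => [|k IH] //; rewrite mulnS add2n smomS2 mulr_gt0 // divr_gt0 // ltr0n //.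
by lia.
Qed.

(* An approximate unit at [t = 1] for the convolution [star]. *)
Definition peak N : {poly R} := (smom R m (2 * N))^-1 *: ('X^(2 * N) * (1 + 'X)).

(** The factor by which convolution with [peak N] multiplies Q_i, by [cub_funk]. *)
Definition phi N i := mom m (peak N * Q i).

Lemma peak_ge0 N (t : R) : -1 <= t <= 1 -> 0 <= (peak N).[t].
Proof.
move=> ht; have -> : (peak N).[t] = (smom R m (2 * N))^-1 * ((t ^+ 2) ^+ N * (1 + t)).
  by rewrite /peak hornerZ hornerM hornerXn hornerD hornerX hornerC exprM.
have t1 : 0 <= 1 + t by lra.
by rewrite mulr_ge0 ?invr_ge0 ?(ltW (smom_gt0 N)) // mulr_ge0 // exprn_ge0 // sqr_ge0.
Qed.

Lemma smom_odd k : smom R m (2 * k).+1 = 0.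
Proof. by elim: k => [|k IH] //; rewrite mulnS add2n smomS2 IH mulr0. Qed.

Lemma mom_peak N : mom m (peak N) = 1.
Proof.
rewrite /peak linearZ /= mulrDr mulr1 -exprSr linearD /= !momXn smom_odd addr0.
by rewrite mulVf // gt_eqF ?smom_gt0.
Qed.

Lemma mom_peak_1X N : mom m (peak N * (1 - 'X)) = (m%:R - 1) / (m%:R + 2 * N%:R).
Proof.
rewrite /peak -scalerAl linearZ /=.
have -> : 'X^(2 * N) * (1 + 'X) * (1 - 'X) = 'X^(2 * N) - 'X^((2 * N).+2) :> {poly R}.
  by rewrite -mulrA !exprS; ring.
rewrite linearB /= !momXn smomS2.
have := smom_gt0 N; set s := smom R m _ => s0.
have mR := m2R R m2; have n0 := ler0n R N.
have n1 : m%:R + 2 * N%:R != 0 :> R by rewrite lt0r_neq0 //; lra.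
have s1 : s != 0 by rewrite gt_eqF.
by rewrite natrD !natrM -natr1 natrM; field; rewrite n1 s1.
Qed.

Lemma mom_peak_le N (g : {poly R}) c : (forall t, -1 <= t <= 1 -> `|g.[t]| <= c) ->
  `|mom m (peak N * (1 - 'X) * g)| <= c * ((m%:R - 1) / (m%:R + 2 * N%:R)).
Proof.
move=> hg; rewrite -mom_peak_1X -linearZ /=.
have pos t : -1 <= t <= 1 -> 0 <= (peak N * (1 - 'X)).[t].
  by move=> ht; rewrite hornerM mulr_ge0 ?peak_ge0 // !hornerE; lra.
rewrite ler_norml -subr_ge0 opprK -linearD /= -[X in _ && X]subr_ge0 -linearB /=.
move: (peak N * (1 - 'X)) pos => A pos.
rewrite !mom_ge0 // => t ht; rewrite !(hornerD, hornerN, hornerZ, hornerM);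
  have := pos t ht; have := hg t ht; rewrite ler_norml => /andP[]; nra.
Qed.

Lemma phi_ge0 N i : 0 <= phi N i.
Proof.
rewrite /phi /peak -scalerAl linearZ /= mulr_ge0 ?invr_ge0 ?(ltW (smom_gt0 N)) //.
rewrite mulrDr mulr1 mulrDl linearD /= -exprSr.
by rewrite addr_ge0 // mom_geg_Xn_ge0.
Qed.

Lemma phi_le1 N i : phi N i <= 1.
Proof.
rewrite -(mom_peak N) -subr_ge0 -linearB /= mom_ge0 // => t ht.
rewrite hornerD hornerN hornerM.
have := peak_ge0 N ht; have := geg_bound m2 i ht; rewrite ler_norml => /andP[]; nra.
Qed.

(** Q_i - 1 vanishes at 1, so it is a multiple of 1 - t, whose mean against the peak is of order
    1/N. *)
Lemma phi_lim i : exists2 c, 0 <= c & forall N, `|1 - phi N i| <= c / (m%:R + 2 * N%:R).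
Proof.
have /factor_theorem[g hg] : root (Q i - 1) 1 by rewrite rootE !hornerE geg_at1 // subrr.
have [c c0 hc] := poly_bounded g.
have mR := m2R R m2.
exists (c * (m%:R - 1)) => [|N]; first by rewrite mulr_ge0 //; lra.
have -> : 1 - phi N i = mom m (peak N * (1 - 'X) * g).
  rewrite -(mom_peak N) /phi -linearB /=; congr mom.
  rewrite -[Q i](subrK 1) hg polyC1; ring.
by rewrite -[leRHS]mulrA; exact: mom_peak_le.
Qed.

(** Convolution of h with [peak N], written as a Gegenbauer sum; the number of terms is the bound of
    [size_peak]. *)
Definition gpart N h t := \sum_(i < (2 * N).+2) phi N i * gcoef i h * (Q i).[t].

Lemma size_peak N : (size (peak N) <= (2 * N).+2)%N.
Proof.
apply: (leq_trans (size_scale_leq _ _)); apply: (leq_trans (size_polyMleq _ _)).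
rewrite size_polyXn -[1 + 'X]addrC -[1]/(1%:P) size_XaddC; lia.
Qed.

(** Funk-Hecke formula: p is expanded in Gegenbauer polynomials and only the term of degree i
    survives the convolution. *)
Lemma cub_funk d (T : finType) (x : T -> 'cV[R]_m) (w : T -> R) u v (p : {poly R}) i :
  cubature d x w -> dotv u u = 1 -> dotv v v = 1 -> (maxn (size p) i.+1 + i.+1 <= d)%N ->
  \sum_k w k * (p.[dotv u (x k)] * (Q i).[dotv v (x k)]) = mom m (p * Q i) * (Q i).[dotv u v].
Proof.
move=> cub uu vv hd.
have hs : (size p <= maxn (size p) i.+1)%N by rewrite leq_maxl.
transitivity (\sum_(j < maxn (size p) i.+1) mom m (p * Q j) / gnorm R m j * (star m (Q j) (Q i)).[dotv u v]).
  transitivity (\sum_(j < maxn (size p) i.+1) mom m (p * Q j) / gnorm R m j *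
     \sum_k w k * ((Q j).[dotv u (x k)] * (Q i).[dotv v (x k)])).
    under [RHS]eq_bigr => j _ do rewrite mulr_sumr.
    rewrite exchange_big; apply: eq_bigr => k _ /=.
    rewrite {1}(geg_expand m2 hs) horner_sum mulr_suml mulr_sumr; apply: eq_bigr => j _.
    by rewrite hornerZ; ring.
  apply: eq_bigr => j _; rewrite (cub_star m2 cub) // !size_geg //.
  by apply: leq_trans hd; rewrite leq_add2r ltn_ord.
have hi : (i < maxn (size p) i.+1)%N by rewrite leq_maxr.
rewrite (bigD1 (Ordinal hi)) //= big1 ?addr0 => [|j ji]; last first.
  by rewrite geg_star_neq ?horner0 ?mulr0.
by rewrite geg_star_diag // hornerZ mulrA divfK // gt_eqF.
Qed.

(** [gpart] averages p against [peak N], which is nonnegative and of mean 1, hence contracts the sup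
    norm on [-1, 1]. *)
Lemma gpart_poly_le N (p : {poly R}) c t :
  (forall s, -1 <= s <= 1 -> `|p.[s]| <= c) -> -1 <= t <= 1 ->
  `|gpart N (horner p) t| <= c.
Proof.
move=> hp ht; have [u [v [uu vv uv]]] := unit_pair m2 ht.
have [T [x [w cub]]] := @cubature_exists R m (size p + (2 * N).+2 + (2 * N).+2)%N (ltnW m2).
have [w0 x1 _ _] := cub.
have -> : gpart N (horner p) t = \sum_k w k * (p.[dotv u (x k)] * (peak N).[dotv v (x k)]).
  under [RHS]eq_bigr => k _.
    rewrite {1}(geg_expand m2 (size_peak N)) horner_sum !mulr_sumr.
    over.
  rewrite exchange_big; apply: eq_bigr => i _ /=.
  transitivity (phi N i / gnorm R m i *
     \sum_k w k * (p.[dotv u (x k)] * (Q i).[dotv v (x k)])).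
    rewrite (cub_funk cub uu vv); last by have := ltn_ord i; size_lia.
    by rewrite gcoef_poly uv; ring.
  by rewrite mulr_sumr; apply: eq_bigr => k _; rewrite hornerZ -/(phi N i); ring.
rewrite (le_trans (ler_norm_sum _ _ _)) //.
have -> : c = \sum_k w k * (c * (peak N).[dotv v (x k)]).
  under eq_bigr => k _ do rewrite mulrCA.
  rewrite -mulr_sumr (cub_mom m2 cub) ?mom_peak ?mulr1 //.
  by have := size_peak N; size_lia.
apply: ler_sum => k _; rewrite !normrM ger0_norm // ler_wpM2l //.
rewrite [`|(peak _).[_]|]ger0_norm ?peak_ge0 ?dotv_unit_bound //.
by rewrite ler_wpM2r ?peak_ge0 ?hp ?dotv_unit_bound.
Qed.

Lemma gpart_lin N a b f g t : papx f -> papx g ->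
  gpart N (fun t => a * f t + b * g t) t = a * gpart N f t + b * gpart N g t.
Proof.
move=> hf hg; rewrite /gpart !mulr_sumr -big_split; apply: eq_bigr => i _ /=.
by rewrite gcoef_lin //; ring.
Qed.

Lemma gpart_le N h c t : papx h ->
  (forall s, -1 <= s <= 1 -> `|h s| <= c) -> -1 <= t <= 1 ->
  `|gpart N h t| <= c.
Proof.
(* K depends on N, which stays fixed while the approximation error e goes to 0. *)
move=> hh hc ht; pose K := \sum_(i < (2 * N).+2) (gnorm R m i)^-1.
have K0 : 0 <= K by apply: sumr_ge0 => i _; rewrite invr_ge0 ltW.
apply: (@le_eps _ _ _ (1 + K)) => [|e e0]; first by lra.
have [p hp] := hh e e0.
have pd : papx (fun s => 1 * h s + (-1) * p.[s]) by apply: papx_lin => //; exact: papx_poly.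
have h1 : `|gpart N (horner p) t| <= c + e.
  apply: gpart_poly_le => // s hs; have := hp s hs; have := hc s hs; rewrite !ler_norml; lra.
have h2 : `|gpart N (fun s => 1 * h s + (-1) * p.[s]) t| <= e * K.
  rewrite /gpart (le_trans (ler_norm_sum _ _ _)) // /K mulr_sumr ler_sum // => i _.
  have : `|gcoef i (fun s => 1 * h s + (-1) * p.[s])| <= e / gnorm R m i.
    by apply: gcoef_norm_le => // s hs; rewrite mul1r mulN1r; exact: hp.
  move: (gcoef i _) => g hg.
  rewrite !normrM -[leRHS]mulr1 ler_pM ?mulr_ge0 // ?geg_bound //.
  by rewrite [`|phi _ _|]ger0_norm ?phi_ge0 // -[leRHS]mul1r ler_pM ?phi_ge0 ?phi_le1.
rewrite gpart_lin // in h2; last exact: papx_poly.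
by move: h1 h2; rewrite !ler_norml; lra.
Qed.

Lemma gpart_poly_lim (p : {poly R}) : exists2 c, 0 <= c &
  forall N t, (size p <= (2 * N).+2)%N -> -1 <= t <= 1 ->
  `|p.[t] - gpart N (horner p) t| <= c / (m%:R + 2 * N%:R).
Proof.
have [cc hcc] := choice (fun i => let: ex_intro2 c c0 hc := phi_lim i in ex_intro _ c (conj c0 hc)).
pose c := \sum_(i < size p) cc i * `|gcoef i (horner p)|.
exists c => [|N t sp ht]; first by apply: sumr_ge0 => i _; rewrite mulr_ge0 //; case: (hcc i).
have -> : gpart N (horner p) t = \sum_(i < size p) phi N i * gcoef i (horner p) * (Q i).[t].
  rewrite /gpart (big_ord_widen _ (fun i => phi N i * gcoef i (horner p) * (Q i).[t]) sp).
  rewrite [LHS](bigID (fun i : 'I__ => (i < size p)%N)) /= [X in _ + X]big1 ?addr0 // => i.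
  rewrite -leqNgt => hi.
  by rewrite gcoef_poly mom_geg_orth // mul0r mulr0 mul0r.
rewrite {1}(geg_expand m2 (leqnn (size p))) horner_sum -sumrB.
rewrite (le_trans (ler_norm_sum _ _ _)) // /c mulr_suml ler_sum // => i _.
rewrite hornerZ -gcoef_poly; move: (gcoef i _) => g.
have -> : g * (Q i).[t] - phi N i * g * (Q i).[t] = (1 - phi N i) * g * (Q i).[t] by ring.
rewrite !normrM -[leRHS]mulr1 ler_pM ?mulr_ge0 // ?geg_bound //.
by rewrite mulrAC ler_wpM2r //; case: (hcc i).
Qed.

(** The contraction bound is uniform in N, which reduces the convergence to polynomials. *)
Lemma gpart_lim h : papx h -> forall e, 0 < e -> exists N0, forall N t, (N0 <= N)%N ->
  -1 <= t <= 1 -> `|h t - gpart N h t| <= e.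
Proof.
move=> hh e e0.
have e3 : 0 < e / 3 by rewrite divr_gt0.
have [p hp] := hh _ e3.
have [c c0 hc] := gpart_poly_lim p.
have [N1 hN1] : exists N1 : nat, c / (e / 3) < N1%:R.
  by exists (Num.bound (c / (e / 3))); apply: archi_boundP; rewrite divr_ge0 // ltW.
exists (maxn N1 (size p)) => N t hN ht.
have h1 := hp t ht.
have h2 : `|p.[t] - gpart N (horner p) t| <= e / 3.
  apply: le_trans (hc N t _ ht) _; first by lia.
  have mR := m2R R m2; have n1 : N1%:R <= N%:R :> R by rewrite ler_nat; lia.
  have n0 := ler0n R N.
  rewrite ler_pdivrMr; last lra.
  rewrite ltr_pdivrMr // in hN1; nra.
have h3 : `|gpart N (fun s => 1 * h s + (-1) * p.[s]) t| <= e / 3.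
  apply: gpart_le => //; first by apply: papx_lin => //; exact: papx_poly.
  by move=> s hs; rewrite mul1r mulN1r; exact: hp.
rewrite gpart_lin // in h3; last exact: papx_poly.
by move: h1 h2 h3; rewrite !ler_norml; lra.
Qed.

(** At t = 1 all terms of [gpart] are nonnegative, so the first I of them stay below its limit h(1),
    while each [phi] tends to 1. *)
Lemma gcoef_sum_le h I : papx h -> sphere_pd m h -> \sum_(i < I) gcoef i h <= h 1.
Proof.
move=> hh hpd.
have [cc hcc] := choice (fun i => let: ex_intro2 c c0 hc := phi_lim i in ex_intro _ c (conj c0 hc)).
pose K := 1 + \sum_(i < I) cc i * gcoef i h.
have g0 i : 0 <= gcoef i h by exact: gcoef_ge0.
have K0 : 0 <= K.
  by rewrite addr_ge0 // sumr_ge0 // => i _; rewrite mulr_ge0 //; case: (hcc i).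
apply: (@le_eps _ _ _ K) => // e e0.
have [N0 hN0] := gpart_lim hh e0.
have [N1 hN1] : exists N1 : nat, e^-1 < N1%:R.
  by exists (Num.bound e^-1); apply: archi_boundP; rewrite invr_ge0 ltW.
pose N := maxn (maxn N0 I) N1.
have hN : (m%:R + 2 * N%:R)^-1 <= e.
  have n1 : N1%:R <= N%:R :> R by rewrite ler_nat leq_maxr.
  have n0 := ler0n R N; have mR := m2R R m2.
  by rewrite -[e]invrK lef_pV2 ?posrE ?invr_gt0 //; lra.
have NN0 : (N0 <= N)%N by rewrite /N; lia.
have hI : (I <= (2 * N).+2)%N by rewrite /N; lia.
have one : -1 <= (1 : R) <= 1 by lra.
have := hN0 N 1 NN0 one; rewrite ler_norml => /andP[h1 _].
have h2 : \sum_(i < I) phi N i * gcoef i h <= gpart N h 1.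
  rewrite /gpart (big_ord_widen _ (fun i => phi N i * gcoef i h) hI).
  rewrite [leRHS](bigID (fun i : 'I__ => (i < I)%N)) /= -[leLHS]addr0 lerD //.
    by apply: ler_sum => i _; rewrite geg_at1 // mulr1.
  by apply: sumr_ge0 => i _; rewrite geg_at1 // mulr1 mulr_ge0 ?phi_ge0.
have h3 : \sum_(i < I) gcoef i h - \sum_(i < I) phi N i * gcoef i h <=
    e * \sum_(i < I) cc i * gcoef i h.
  rewrite -sumrB mulr_sumr ler_sum // => i _.
  have [ci hi] := hcc i.
  move: (gcoef i h) (g0 i) => g gg.
  have -> : g - phi N i * g = (1 - phi N i) * g by ring.
  rewrite mulrA ler_wpM2r //; apply: le_trans (ler_norm _) _.
  by apply: le_trans (hi N) _; rewrite mulrC ler_wpM2r.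
rewrite /K; lra.
Qed.

Lemma sum_tail (b : nat -> R) B : (forall i, 0 <= b i) ->
  (forall n, \sum_(0 <= i < n) b i <= B) -> forall e, 0 < e ->
  exists I0, forall I n, (I0 <= I)%N -> \sum_(I <= i < n) b i <= e.
Proof.
move=> b0 bB e e0.
pose S := [set x | exists n : nat, x = \sum_(0 <= i < n) b i]%classic.
have ubS : has_ubound S by exists B => _ [n ->].
have [|_ [I0 ->] hI0] := @sup_adherent R S e e0.
  by split=> //; exists 0, 0%N; rewrite big_nil.
exists I0 => I n hI.
have [nI|In] := leqP n I; first by rewrite big_geq // ltW.
have h1 : \sum_(0 <= i < n) b i <= sup S by apply: ub_le_sup => //; exists n.
move: h1; rewrite (@big_cat_nat _ _ _ I0) //=; last by lia.
rewrite (@big_cat_nat _ _ _ I I0) //=; last by lia.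
have : 0 <= \sum_(I0 <= i < I) b i by apply: sumr_ge0.
lra.
Qed.

(** The convolutions converge to h. Their tails are small uniformly in N, because [phi] is at most 1
    and b is summable; on the finite head, [phi] tends to 1. *)
Lemma gegenbauer_series h (b : nat -> R) B : papx h ->
  (forall i, `|gcoef i h| <= b i) -> (forall n, \sum_(0 <= i < n) b i <= B) ->
  forall t, -1 <= t <= 1 -> forall e, 0 < e -> exists I0, forall I, (I0 <= I)%N ->
  `|h t - \sum_(0 <= i < I) gcoef i h * (Q i).[t]| <= e.
Proof.
move=> hh hb hB t ht e e0.
have b0 i : 0 <= b i by apply: le_trans (hb i).
have e3 : 0 < e / 3 by rewrite divr_gt0.
have [I0 hI0] := sum_tail b0 hB e3.
exists I0 => I /hI0 tail.
have [cc hcc] := choice (fun i => let: ex_intro2 c c0 hc := phi_lim i in ex_intro _ c (conj c0 hc)).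
pose K := \sum_(0 <= i < I) cc i * b i.
have K0 : 0 <= K by apply: sumr_ge0 => i _; rewrite mulr_ge0 //; case: (hcc i).
have [N0 hN0] := gpart_lim hh e3.
have [N1 hN1] : exists N1 : nat, K / (e / 3) < N1%:R.
  by exists (Num.bound (K / (e / 3))); apply: archi_boundP; rewrite divr_ge0 // ltW.
pose N := maxn (maxn N0 I) N1.
have hN : K / (m%:R + 2 * N%:R) <= e / 3.
  have n1 : N1%:R <= N%:R :> R by rewrite ler_nat leq_maxr.
  have n0 := ler0n R N; have mR := m2R R m2.
  rewrite ler_pdivrMr; last lra.
  rewrite ltr_pdivrMr // in hN1; nra.
have h1 : `|h t - gpart N h t| <= e / 3 by apply: hN0 => //; rewrite /N; lia.
have gE : gpart N h t = \sum_(0 <= i < I) phi N i * gcoef i h * (Q i).[t] +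
    \sum_(I <= i < (2 * N).+2) phi N i * gcoef i h * (Q i).[t].
  rewrite /gpart -(big_mkord xpredT (fun i => phi N i * gcoef i h * (Q i).[t])).
  by rewrite (@big_cat_nat _ _ _ I) //= /N; lia.
rewrite gE in h1.
have h2 : `|\sum_(0 <= i < I) gcoef i h * (Q i).[t] -
   \sum_(0 <= i < I) phi N i * gcoef i h * (Q i).[t]| <= K / (m%:R + 2 * N%:R).
  rewrite -sumrB (le_trans (ler_norm_sum _ _ _)) // /K mulr_suml ler_sum // => i _.
  have [ci hi] := hcc i; move: (gcoef i h) (hb i) => g hg.
  have -> : g * (Q i).[t] - phi N i * g * (Q i).[t] = (1 - phi N i) * g * (Q i).[t] by ring.
  rewrite !normrM -[leRHS]mulr1 ler_pM ?mulr_ge0 // ?geg_bound //.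
  by rewrite mulrAC ler_pM.
have h3 : `|\sum_(I <= i < (2 * N).+2) phi N i * gcoef i h * (Q i).[t]| <= e / 3.
  apply: le_trans (tail (2 * N).+2); rewrite (le_trans (ler_norm_sum _ _ _)) // ler_sum // => i _.
  move: (gcoef i h) (hb i) => g hg.
  rewrite !normrM -[leRHS]mulr1 ler_pM ?mulr_ge0 // ?geg_bound //.
  by rewrite [`|phi _ _|]ger0_norm ?phi_ge0 // -[leRHS]mul1r ler_pM ?phi_ge0 ?phi_le1.
by move: h1 h2 h3; rewrite !ler_norml; lra.
Qed.

End Mean.

(** * Weierstrass approximation *)

Section Bernstein.
Variable R : realType.

Definition bernw n (x : R) k : R := x ^+ k * (1 - x) ^+ (n - k) *+ 'C(n, k).

(** Euler operator, with eigenvalue k on X^k. Applied to (1 - x + X)^n and evaluated at X = x, it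
    produces the moments of the Bernstein weights. *)
Let theta (p : {poly R}) := 'X * p^`().

Lemma bernw_moments n (x : R) :
  [/\ \sum_(k < n.+1) bernw n x k = 1,
      \sum_(k < n.+1) bernw n x k * k%:R = n%:R * x &
      \sum_(k < n.+1) bernw n x k * k%:R ^+ 2 = n%:R * x + n%:R * (n%:R - 1) * x ^+ 2].
Proof.
pose p : {poly R} := ((1 - x)%:P + 'X) ^+ n.
pose a k : R := (1 - x) ^+ (n - k) *+ 'C(n, k).
have pE : p = \sum_(k < n.+1) a k *: 'X^k.
  rewrite /p exprDn; apply: eq_bigr => k _.
  by rewrite /a -mul_polyC polyCMn polyC_exp mulrnAl.
have th (b : nat -> R) : theta (\sum_(k < n.+1) b k *: 'X^k) = \sum_(k < n.+1) (b k * k%:R) *: 'X^k.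
  rewrite /theta raddf_sum mulr_sumr; apply: eq_bigr => k _ /=.
  rewrite derivZ derivXn -scalerAr -scalerA; congr (_ *: _).
  case: (k : nat) => [|j]; first by rewrite mulr0n mulr0 scale0r.
  by rewrite /= mulrnAr -exprS scaler_nat.
have ev (b : nat -> R) : (\sum_(k < n.+1) b k *: 'X^k).[x] = \sum_(k < n.+1) b k * x ^+ k.
  by rewrite horner_sum; apply: eq_bigr => k _; rewrite hornerZ hornerXn.
have w k : bernw n x k = a k * x ^+ k by rewrite /bernw /a mulrnAl mulrC.
pose Y : {poly R} := (1 - x)%:P + 'X.
have Y1 k : (Y ^+ k).[x] = 1.
  by rewrite horner_exp hornerD hornerC hornerX subrK expr1n.
have dY k : (Y ^+ k)^`() = k%:R *: Y ^+ k.-1.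
  by rewrite deriv_exp derivD derivC derivX add0r mul1r scaler_nat.
split.
- under eq_bigr => k _ do rewrite w.
  by rewrite -ev -pE Y1.
- under eq_bigr => k _ do rewrite w mulrAC.
  rewrite -(ev (fun k => a k * k%:R)) -th -pE /theta dY hornerM hornerX hornerZ Y1.
  by rewrite mulr1 mulrC.
- under eq_bigr => k _ do rewrite w mulrAC expr2 mulrA.
  rewrite -(ev (fun k => a k * k%:R * k%:R)) -(th (fun k => a k * k%:R)) -th -pE.
  rewrite /theta dY -scalerAr derivZ derivM derivX mul1r dY.
  rewrite hornerM hornerX hornerZ hornerD hornerM hornerX hornerZ !Y1.
  by case: n {p a pE th ev w} => [|n] /=; rewrite -?natr1; ring.
Qed.

Lemma bernw_var n (x : R) : (0 < n)%N ->
  \sum_(k < n.+1) bernw n x k * (x - k%:R / n%:R) ^+ 2 = x * (1 - x) / n%:R.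
Proof.
move=> n0; have [h0 h1 h2] := bernw_moments n x.
have nR : n%:R != 0 :> R by rewrite pnatr_eq0 -lt0n.
transitivity (x ^+ 2 * (\sum_(k < n.+1) bernw n x k)
   - 2 * x / n%:R * (\sum_(k < n.+1) bernw n x k * k%:R)
   + n%:R ^- 2 * (\sum_(k < n.+1) bernw n x k * k%:R ^+ 2)).
  rewrite !mulr_sumr -sumrB -big_split; apply: eq_bigr => k _ /=.
  by field.
by rewrite h0 h1 h2; field.
Qed.

(** A modulus of the form e + C (x - y)^2 is summed against the Bernstein weights at once, without
    separating near and far nodes: the quadratic part is the variance, of order 1/n. *)
Lemma papx_modulus (h : R -> R) :
  (forall e, 0 < e -> exists2 C, 0 <= C &
     forall x y, -1 <= x <= 1 -> -1 <= y <= 1 -> `|h x - h y| <= e + C * (x - y) ^+ 2) ->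
  papx h.
Proof.
move=> hC e e0; have e2 : 0 < e / 2 by lra.
have [C C0 hxy] := hC _ e2.
have [N hN] : exists N : nat, C / (e / 2) < N%:R.
  by exists (Num.bound (C / (e / 2))); apply: archi_boundP; rewrite divr_ge0 // ltW.
pose n := N.+1.
have nR : 0 < n%:R :> R by rewrite ltr0n.
have hn : C / n%:R <= e / 2.
  have : N%:R <= n%:R :> R by rewrite ler_nat.
  rewrite ler_pdivrMr //; rewrite ltr_pdivrMr // in hN; nra.
(* The nodes k/n of [0, 1], transported to [-1, 1]. *)
pose tk k : R := 2 * (k%:R / n%:R) - 1.
pose X : {poly R} := 2^-1 *: (1 + 'X).
exists (\sum_(k < n.+1) h (tk k) *: (X ^+ k * (1 - X) ^+ (n - k) *+ 'C(n, k))) => t ht.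
pose x : R := (1 + t) / 2.
have tx : t = 2 * x - 1 by rewrite /x; field.
have [h0 _ _] := bernw_moments n x.
have hv := bernw_var x (isT : (0 < n)%N).
have w0 k : 0 <= bernw n x k.
  by rewrite mulrn_wge0 // mulr_ge0 // exprn_ge0 // /x; lra.
have -> : (\sum_(k < n.+1) h (tk k) *: (X ^+ k * (1 - X) ^+ (n - k) *+ 'C(n, k))).[t] =
   \sum_(k < n.+1) h (tk k) * bernw n x k.
  rewrite horner_sum; apply: eq_bigr => k _; rewrite hornerZ hornerMn hornerM !horner_exp.
  have -> : X.[t] = x by rewrite /X !hornerE /x mulrC.
  have -> : (1 - X).[t] = 1 - x by rewrite hornerD hornerN hornerC /X !hornerE /x [_ / 2]mulrC.
  by [].
have -> : h t = \sum_(k < n.+1) h t * bernw n x k by rewrite -mulr_sumr h0 mulr1.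
rewrite -sumrB (le_trans (ler_norm_sum _ _ _)) //.
have bound (k : 'I_n.+1) : `|h t * bernw n x k - h (tk k) * bernw n x k| <=
   e / 2 * bernw n x k + C * 4 * (bernw n x k * (x - k%:R / n%:R) ^+ 2).
  rewrite -mulrBl normrM [`|bernw _ _ _|]ger0_norm //.
  have hk : -1 <= tk k <= 1.
    have : 0 <= k%:R / n%:R :> R by rewrite divr_ge0 ?ler0n.
    have : k%:R / n%:R <= 1 :> R by rewrite ler_pdivrMr // mul1r ler_nat -ltnS.
    by rewrite /tk; lra.
  have := hxy _ _ ht hk.
  have -> : t - tk k = 2 * (x - k%:R / n%:R) by rewrite tx /tk; ring.
  have := w0 k; move: (bernw n x k) (`|_|) (x - _) => b z s b0 hz; nra.
apply: le_trans (ler_sum _ (fun k _ => bound k)) _.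
rewrite big_split /= -!mulr_sumr h0 hv mulr1.
have : C * 4 * (x * (1 - x) / n%:R) <= C / n%:R.
  rewrite [leRHS]mulrC [X in X <= _](_ : _ = n%:R^-1 * (C * (4 * (x * (1 - x))))); last by ring.
  rewrite ler_pM2l ?invr_gt0 // ler_piMr //; have : 0 <= (2 * x - 1) ^+ 2 by exact: sqr_ge0.
  by nra.
lra.
Qed.

End Bernstein.

Lemma within_continuousP (R : realType) (T : topologicalType) (A : set T) (f : T -> R) :
  {within A, continuous f} <->
  forall x, A x -> forall e, 0 < e -> \forall y \near x, A y -> `|f x - f y| <= e.
Proof.
rewrite subspace_continuousP; split=> H x Ax.
  move=> e e0; have /cvgrPdist_le/(_ e e0) := H x Ax.
  by rewrite near_withinE.
apply/cvgrPdist_le => e e0; rewrite near_withinE; exact: H.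
Qed.

(** Compactness of [-1, 1] makes the continuity at p0 uniform in t; this later gives the continuity
    of the Gegenbauer coefficients in the Gram data. *)
Lemma compact_tube (R : realType) (P : topologicalType) (D : set P) (H : P -> R -> R)
    (p0 : P) : D p0 ->
  {within [set q : P * R | D q.1 /\ -1 <= q.2 <= 1], continuous (fun q => H q.1 q.2)} ->
  forall e, 0 < e -> \forall p \near p0, D p -> forall t, -1 <= t <= 1 -> `|H p0 t - H p t| <= e.
Proof.
move=> Dp0 /within_continuousP Hc e e0.
have cpt : compact (`[(-1 : R), 1]%classic : set R) by exact: segment_compact.
have e2 : 0 < e / 2 by rewrite divr_gt0.
have := (compact_near_coveringP _).1 cpt P (nbhs p0)
  (fun p t => D p -> -1 <= t <= 1 -> `|H p0 t - H p t| <= e) _.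
move=> cov; have : \forall p \near p0, (`[(-1 : R), 1]%classic : set R) `<=`
    (fun t => D p -> -1 <= t <= 1 -> `|H p0 t - H p t| <= e).
  apply: cov => t; rewrite /= in_itv /= => ht.
  have [[U V] /= [Up Vt] UV] := Hc (p0, t) (conj Dp0 ht) _ e2.
  exists (V, U) => //= -[t' p] /= [Vt' Up'] Dp ht'.
  have h1 := UV (p, t') (conj Up' Vt') (conj Dp ht').
  have h2 := UV (p0, t') (conj (nbhs_singleton Up) Vt') (conj Dp0 ht').
  by move: h1 h2; rewrite /= !ler_norml; lra.
by apply: filterS => p Hp Dp t ht; apply: Hp => //=; rewrite in_itv.
Qed.

Lemma continuous_papx (R : realType) (h : R -> R) :
  {within [set t : R | -1 <= t <= 1], continuous h} -> papx h.
Proof.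
move=> hc; apply: papx_modulus => e e0.
have cpt : compact ([set t : R | -1 <= t <= 1]).
  rewrite (_ : mkset _ = `[(-1 : R), 1]%classic); first exact: segment_compact.
  by apply/seteqP; split=> x /=; rewrite in_itv.
have [B hB] : exists B : R, forall t, -1 <= t <= 1 -> `|h t| <= B.
  have /compact_bounded[M [_ hM]] := continuous_compact hc cpt.
  exists (M + 1) => t ht; apply: (hM (M + 1)); first lra.
  by exists t.
have B0 : 0 <= B by apply: le_trans (normr_ge0 (h 0)) (hB _ _); lra.
move/within_continuousP: hc => hc.
have e2 : 0 < e / 2 by rewrite divr_gt0.
(* Covering along C tending to infinity yields one constant for all x: near pairs are controlled by
   continuity, pairs at distance at least d/2 by 2B <= C (d/2)^2. *)
have := (compact_near_coveringP _).1 cpt R (pinfty_nbhs R)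
  (fun C x => -1 <= x <= 1 -> forall y, -1 <= y <= 1 -> `|h x - h y| <= e + C * (x - y) ^+ 2) _.
move=> /(_ _)[].
  move=> x0 hx0; have /nbhs_ballP[d /= d0 hd] := hc _ hx0 _ e2.
  have d2 : 0 < d / 2 by rewrite divr_gt0.
  exists (ball x0 (d / 2), [set C | 2 * B / (d / 2) ^+ 2 <= C]) => /=.
    split; first by apply/nbhs_ballP; exists (d / 2).
    by exists (2 * B / (d / 2) ^+ 2); split; [exact: num_real | move=> x /ltW].
  move=> [x C] /= [bx hC] hx y hy.
  have h1 : `|h x0 - h x| <= e / 2.
    by apply: hd => //; apply: le_ball bx; lra.
  have Cp : 0 <= C by apply: le_trans hC; rewrite divr_ge0 ?sqr_ge0 ?mulr_ge0.
  have [xy|xy] := lerP (d / 2) `|x - y|.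
    have h2 : `|h x - h y| <= 2 * B.
      by have := hB _ hx; have := hB _ hy; rewrite !ler_norml; lra.
    have h3 : (d / 2) ^+ 2 <= (x - y) ^+ 2.
      by rewrite -[leRHS]real_normK ?num_real // lerXn2r ?nnegrE // ltW.
    rewrite ler_pdivrMr ?exprn_gt0 // in hC.
    by have h4 := ler_wpM2l Cp h3; lra.
  have h2 : `|h x0 - h y| <= e / 2.
    apply: hd => //; rewrite /ball /=.
    have -> : x0 - y = (x0 - x) + (x - y) by ring.
    apply: le_lt_trans (ler_normD _ _) _; rewrite [d]splitr ltrD //.
  have h3 : 0 <= C * (x - y) ^+ 2 by rewrite mulr_ge0 ?sqr_ge0.
  by move: h1 h2; rewrite !ler_norml; lra.
move=> M [_ hM]; exists (`|M| + 1); first by rewrite addr_ge0.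
move=> x y hx hy; apply: (hM (`|M| + 1)) => //.
by have := ler_norm M; lra.
Qed.

(** * Gram matrices *)

Section LinAlg.
Variable R : realType.

Lemma dotv_mull n k (A : 'M[R]_(n, k)) (x : 'cV[R]_k) (y : 'cV[R]_n) :
  dotv (A *m x) y = dotv x (A^T *m y).
Proof. by rewrite /dotv trmx_mul mulmxA. Qed.

Lemma orth_dotv n (M : 'M[R]_n) x y : orthogonal_mx M -> dotv (M *m x) (M *m y) = dotv x y.
Proof. by move=> oM; rewrite dotv_mull mulmxA oM mul1mx. Qed.

Lemma sphereP n (x : 'cV[R]_n) : sphere x <-> dotv x x = 1.
Proof.
rewrite /sphere /enorm /=; split=> [h|->]; last exact: sqrtr1.
by rewrite -(sqr_sqrtr (dotv_ge0 x)) h expr1n.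
Qed.

Lemma householder n (x y : 'cV[R]_n) : dotv x x = dotv y y ->
  exists H : 'M[R]_n, [/\ orthogonal_mx H, H *m x = y &
    forall z, dotv (x - y) z = 0 -> H *m z = z].
Proof.
move=> xy; have [->|neq] := eqVneq x y.
  exists 1%:M; split=> [||z _]; rewrite ?mul1mx //.
  by rewrite /orthogonal_mx /= trmx1 mulmx1.
pose w := x - y; have w0 : dotv w w != 0 by rewrite dotv_eq0 subr_eq0.
pose a := 2 / dotv w w.
pose H : 'M[R]_n := 1%:M - a *: (w *m w^T).
have HE z : H *m z = z - (a * dotv w z) *: w.
  rewrite /H mulmxBl mul1mx -scalemxAl -mulmxA.
  have -> : w^T *m z = (dotv w z)%:M by rewrite [LHS]mx11_scalar.
  by rewrite mul_mx_scalar scalerA.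
have HT : H^T = H.
  by rewrite /H linearB linearZ /= trmx1 trmx_mul trmxK.
exists H; split.
- rewrite /orthogonal_mx /= HT {2}/H mulmxBr mulmx1 -scalemxAr mulmxA HE.
  have -> : a * dotv w w = 2 by rewrite /a divfK.
  by rewrite scaler_nat mulr2n opprD addNKr mulNmx scalerN opprK /H subrK.
- rewrite HE; have ww : dotv w w = 2 * dotv w x.
    by rewrite /w !(dotvBl, dotvBr) -xy (dotvC y x); ring.
  have -> : a * dotv w x = 1.
    rewrite /a ww; field; apply: contraNneq w0 => e; by rewrite ww e mulr0.
  by rewrite scale1r /w opprB addrC subrK.
- by move=> z wz; rewrite HE wz mulr0 scale0r subr0.
Qed.

(** A reflection carries the image of the last vector to its target. Equal inner products make their
    difference orthogonal to the vectors already placed, so these stay fixed. *)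
Lemma gram_orth_family n k (a b : 'I_k -> 'cV[R]_n) :
  (forall i j, dotv (a i) (a j) = dotv (b i) (b j)) ->
  exists M : 'M[R]_n, orthogonal_mx M /\ forall i, M *m a i = b i.
Proof.
elim: k a b => [|k IH] a b ab.
  exists 1%:M; split; last by case.
  by rewrite /orthogonal_mx /= trmx1 mulmx1.
have [M [oM Mab]] := IH (fun i => a (lift ord_max i)) (fun i => b (lift ord_max i))
  (fun i j => ab _ _).
have [|H [oH Hx Hz]] := @householder n (M *m a ord_max) (b ord_max).
  by rewrite orth_dotv.
exists (H *m M); split.
  by rewrite /orthogonal_mx /= trmx_mul mulmxA -(mulmxA M^T) oH mulmx1.
move=> i; rewrite -mulmxA; case: (unliftP ord_max i) => [j|] ->; last exact: Hx.
by rewrite Mab Hz // dotvBl -Mab orth_dotv // ab Mab subrr.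
Qed.

Lemma gram_orth n k (A B : 'M[R]_(n, k)) : A^T *m A = B^T *m B ->
  exists M : 'M[R]_n, orthogonal_mx M /\ M *m A = B.
Proof.
move=> AB.
have E (C : 'M[R]_(n, k)) i j : dotv (col i C) (col j C) = (C^T *m C) i j.
  by rewrite dotvE mxE; apply: eq_bigr => l _; rewrite !mxE.
have [|M [oM h]] := @gram_orth_family n k (fun i => col i A) (fun i => col i B).
  by move=> i j; rewrite !E AB.
exists M; split => //; apply/matrixP => i j.
by have := h j; rewrite [col j A]colE mulmxA -colE => /colP/(_ i); rewrite [LHS]mxE [RHS]mxE.
Qed.

Lemma pdmx_unit r (Y : 'M[R]_r) : pdmx Y -> Y \in unitmx.
Proof.
move=> [Ys Yp]; rewrite -row_free_unit -kermx_eq0; apply/eqP/row_matrixP => i.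
rewrite row0; apply/eqP; apply/negP => /negP nz.
pose v := (row i (kermx Y))^T.
have v0 : v != 0 by apply: contra nz => /eqP e; rewrite -[row _ _]trmxK -/v e trmx0.
have := Yp v v0; rewrite /dotv mulmxA /v trmxK -row_mul mulmx_ker row0 mul0mx mxE.
by rewrite ltxx.
Qed.

Lemma dotv_col n k (a c : 'cV[R]_n) (b d : 'cV[R]_k) :
  dotv (col_mx a b) (col_mx c d) = dotv a c + dotv b d.
Proof. by rewrite /dotv tr_col_mx mul_row_col mxE. Qed.

Lemma pdmx_cholesky r (Y : 'M[R]_r) : pdmx Y -> exists C : 'M[R]_r, C^T *m C = Y.
Proof.
elim: r Y => [|r IH] Y [Ys Yp].
  by exists 0; apply/matrixP => -[].
move: Y Ys Yp; rewrite -[r.+1]/(1 + r)%N => Y Ys Yp.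
pose y := Y 0 0; pose b := dlsubmx Y; pose Y' := drsubmx Y.
have ulE : ulsubmx Y = y%:M.
  rewrite [LHS]mx11_scalar; congr _%:M; rewrite !mxE; congr (Y _ _); exact: val_inj.
have urE : ursubmx Y = b^T by rewrite -[LHS]trmxK trmx_ursub Ys.
have Y's : Y'^T = Y' by rewrite /Y' trmx_drsub Ys.
have YE : Y = block_mx y%:M b^T b Y' by rewrite -ulE -urE submxK.
have form (s : R) (v : 'cV[R]_r) : dotv (col_mx s%:M v) (Y *m col_mx s%:M v) =
   y * s ^+ 2 + 2 * s * dotv b v + dotv v (Y' *m v).
  rewrite YE mul_block_col dotv_col.
  have -> : b^T *m v = (dotv b v)%:M by rewrite [LHS]mx11_scalar.
  rewrite -scalar_mxM -raddfD mul_mx_scalar dotvDr dotvZr (dotvC v b).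
  have -> (c d : R) : dotv (c%:M : 'cV[R]_1) d%:M = c * d.
    by rewrite dotvE big_ord1 !mxE.
  ring.
have y0 : 0 < y.
  have := Yp (col_mx 1%:M 0); rewrite form dotv0 mulmx0 dotv0 expr1n !mulr1 mulr0 !addr0.
  apply; apply/eqP => /(congr1 usubmx); rewrite col_mxKu linear0 => /matrixP/(_ 0 0).
  by rewrite !mxE; apply/eqP; rewrite oner_eq0.
(* The Schur complement of y. It is positive because its form is that of Y at the first coordinate
   minimizing it for given v. *)
have [|C' hC'] := IH (Y' - y^-1 *: (b *m b^T)).
  split; first by rewrite linearB linearZ /= Y's trmx_mul trmxK.
  move=> v v0; have := Yp (col_mx (- y^-1 * dotv b v)%:M v); rewrite form => h.
  have : 0 < y * (- y^-1 * dotv b v) ^+ 2 + 2 * (- y^-1 * dotv b v) * dotv b v + dotv v (Y' *m v).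
    apply: h; apply: contra v0 => /eqP/(congr1 dsubmx); rewrite col_mxKd linear0 => ->//.
  have -> : dotv v ((Y' - y^-1 *: (b *m b^T)) *m v) = dotv v (Y' *m v) - y^-1 * dotv b v ^+ 2.
    rewrite mulmxBl dotvBr -scalemxAl dotvZr -mulmxA.
    have -> : b^T *m v = (dotv b v)%:M by rewrite [LHS]mx11_scalar.
    by rewrite mul_mx_scalar dotvZr (dotvC v b) expr2.
  congr (_ < _); field; exact: lt0r_neq0.
pose s := Num.sqrt y.
have s2 : s * s = y by rewrite -expr2 sqr_sqrtr // ltW.
have s0 : s != 0 by apply: contraTneq y0 => e; rewrite -s2 e mulr0 ltxx.
exists (block_mx s%:M (s^-1 *: b^T) 0 C').
rewrite YE (tr_block_mx s%:M) tr_scalar_mx [(_ *: _)^T]linearZ /= trmxK trmx0 mulmx_block.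
rewrite !mulmx0 !mul0mx !addr0 -scalar_mxM s2 hC'; congr block_mx.
- by rewrite mul_scalar_mx scalerA divff // scale1r.
- by rewrite mul_mx_scalar scalerA divff // scale1r.
- by rewrite -scalemxAl -scalemxAr scalerA -invfM s2 addrC subrK.
Qed.

End LinAlg.

(** * Bordered Gram matrices and components orthogonal to the range *)

Section Bordered.
Variable R : realType.

Lemma dotvNl n (x y : 'cV[R]_n) : dotv (- x) y = - dotv x y.
Proof. by rewrite -scaleN1r dotvZl mulN1r. Qed.

Lemma dotvNr n (x y : 'cV[R]_n) : dotv y (- x) = - dotv y x.
Proof. by rewrite !(dotvC y) dotvNl. Qed.

(** For Y = Z^T Z and y_j = Z^T x_j, the inner product of the projections of x_1 and x_2 to the
    range of Z. For a unit vector x, [radius] is then the norm of the orthogonal component. *)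
Definition qform r (Y : 'M[R]_r) (y1 y2 : 'cV[R]_r) : R := dotv y1 (invmx Y *m y2).

Definition radius r (Y : 'M[R]_r) (y : 'cV[R]_r) : R := Num.sqrt (1 - qform Y y y).

Lemma pdmx_inv_sym r (Y : 'M[R]_r) : pdmx Y -> (invmx Y)^T = invmx Y.
Proof. by move=> [Ys _]; rewrite trmx_inv Ys. Qed.

Lemma qformC r (Y : 'M[R]_r) y1 y2 : pdmx Y -> qform Y y1 y2 = qform Y y2 y1.
Proof. by move=> Yp; rewrite /qform dotvC dotv_mull pdmx_inv_sym. Qed.

Lemma block_psd_form r (Y : 'M[R]_r) (y v : 'cV[R]_r) (s : R) :
  dotv (col_mx s%:M v) (block_mx 1%:M y^T y Y *m col_mx s%:M v) =
  s ^+ 2 + 2 * s * dotv y v + dotv v (Y *m v).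
Proof.
rewrite mul_block_col dotv_col.
have -> : y^T *m v = (dotv y v)%:M by rewrite [LHS]mx11_scalar.
rewrite -scalar_mxM -raddfD mul_mx_scalar dotvDr dotvZr (dotvC v y).
have -> (c d : R) : dotv (c%:M : 'cV[R]_1) d%:M = c * d.
  by rewrite dotvE big_ord1 !mxE.
ring.
Qed.

Lemma gram_bundle_qform r (y : 'cV[R]_r) (Y : 'M[R]_r) :
  gram_bundle (y, Y) -> qform Y y y <= 1.
Proof.
move=> [[[_ psd] _] Yp]; have Yu := pdmx_unit Yp; rewrite /= in psd Yp Yu.
(* This vector minimizes the bordered form among those with first coordinate 1; the minimum is 1 -
   y^T Y^-1 y. *)
have := psd (col_mx 1%:M (- (invmx Y *m y))); rewrite block_psd_form.
rewrite mulmxN mulmxA mulmxV // mul1mx !dotvNr dotvNl -/(qform Y y y).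
by rewrite (dotvC _ y) -/(qform Y y y); lra.
Qed.

Lemma radius_sqr r (y : 'cV[R]_r) (Y : 'M[R]_r) :
  gram_bundle (y, Y) -> radius Y y ^+ 2 = 1 - qform Y y y.
Proof. by move=> /gram_bundle_qform h; rewrite sqr_sqrtr // subr_ge0. Qed.

Lemma gram_bundle_mem n r (Z : 'M[R]_(n, r)) (x : 'cV[R]_n) :
  sphere x -> spheres Z -> pdmx (Z^T *m Z) -> gram_bundle (Z^T *m x, Z^T *m Z).
Proof.
move=> /sphereP xx sZ Yp; split=> //; split; last first.
  move=> i; case: (split_ordP i) => k ->; rewrite ?block_mxEul ?block_mxEdr.
    by rewrite ord1 mxE.
  have /sphereP <- := sZ k; rewrite dotvE mxE.
  by apply: eq_bigr => l _; rewrite !mxE.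
split; first by rewrite tr_block_mx trmx1 trmxK; case: Yp => ->.
move=> v; rewrite -[v]vsubmxK [usubmx v]mx11_scalar; set s := usubmx v 0 0.
rewrite block_psd_form /= -mulmxA -dotv_mull dotv_mull trmxK.
have := dotv_ge0 (s *: x + Z *m dsubmx v).
by rewrite !(dotvDl, dotvDr, dotvZl, dotvZr) xx (dotvC _ x); lra.
Qed.

Section Perp.
Variables (n r : nat) (Z : 'M[R]_(n, r)).
Hypothesis Zp : pdmx (Z^T *m Z).
Let Y := Z^T *m Z.

Lemma perp_proj_orth (x : 'cV[R]_n) : Z^T *m (perp_proj Z *m x) = 0.
Proof.
rewrite /perp_proj /range_proj mulmxBl mul1mx mulmxBr !mulmxA.
by rewrite mulmxV ?pdmx_unit // mul1mx subrr.
Qed.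

Lemma perp_proj_dotv (x y : 'cV[R]_n) : dotv (perp_proj Z *m x) (perp_proj Z *m y) =
  dotv x y - qform Y (Z^T *m x) (Z^T *m y).
Proof.
rewrite {1}/perp_proj mulmxBl mul1mx dotvBl /range_proj -!mulmxA dotv_mull perp_proj_orth dotv0 subr0.
rewrite dotvC /perp_proj mulmxBl mul1mx dotvBl dotvC; congr (_ - _).
by rewrite /range_proj -!mulmxA dotv_mull dotvC.
Qed.

Lemma enorm_perp_proj (x : 'cV[R]_n) : sphere x ->
  enorm (perp_proj Z *m x) = radius Y (Z^T *m x).
Proof. by move=> /sphereP xx; rewrite /enorm perp_proj_dotv xx. Qed.

Lemma perp_cosE (x y : 'cV[R]_n) : sphere x -> sphere y ->
  perp_cos Z x y = (dotv x y - qform Y (Z^T *m x) (Z^T *m y)) /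
    (radius Y (Z^T *m x) * radius Y (Z^T *m y)).
Proof. by move=> sx sy; rewrite /perp_cos perp_proj_dotv !enorm_perp_proj. Qed.

Lemma enorm_sqr (x : 'cV[R]_n) : enorm x ^+ 2 = dotv x x.
Proof. by rewrite sqr_sqrtr // dotv_ge0. Qed.

Lemma dotv_enorm (x y : 'cV[R]_n) : `|dotv x y| <= enorm x * enorm y.
Proof.
rewrite -ler_sqr ?nnegrE ?mulr_ge0 ?sqrtr_ge0 //.
by rewrite exprMn !enorm_sqr real_normK ?num_real // dotv_CS.
Qed.

Lemma perp_cos_bound (x y : 'cV[R]_n) : -1 <= perp_cos Z x y <= 1.
Proof.
rewrite -ler_norml /perp_cos normrM normfV.
have e0 (z : 'cV[R]_n) : 0 <= enorm z by exact: sqrtr_ge0.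
rewrite [`|enorm _ * _|]ger0_norm ?mulr_ge0 //.
have := dotv_enorm (perp_proj Z *m x) (perp_proj Z *m y).
set d := _ * _; have d0 : 0 <= d by rewrite mulr_ge0.
have [->|d1] := eqVneq d 0; first by rewrite invr0 mulr0 ler01.
by rewrite ler_pdivrMr ?mul1r // lt_def d1.
Qed.

(** If an orthogonal component vanishes, [perp_cos] is 0 by default; the identity persists since, by
    Cauchy-Schwarz, the inner product of the components is 0. *)
Lemma dotv_perp_cos (x y : 'cV[R]_n) : sphere x -> sphere y ->
  dotv x y = qform Y (Z^T *m x) (Z^T *m y) +
    radius Y (Z^T *m x) * radius Y (Z^T *m y) * perp_cos Z x y.
Proof.
move=> sx sy; rewrite -!enorm_perp_proj // /perp_cos.
have := dotv_enorm (perp_proj Z *m x) (perp_proj Z *m y).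
set d := enorm _ * _ => h; rewrite mulrC.
have [d0|d0] := eqVneq d 0.
  move: h; rewrite d0 normr_le0 => /eqP h.
  by move: (perp_proj_dotv x y); rewrite h => h'; rewrite mulr0 addr0; lra.
by rewrite divfK // perp_proj_dotv; lra.
Qed.

End Perp.

(** Coefficients at equal points are added up, which reduces to the repetition-free families of
    [pd_kernel]. *)
Lemma pd_kernel_form (T : topologicalType) (V : set T) (k : T -> T -> R) :
  pd_kernel V k -> forall N (u : 'I_N -> T) (z : 'I_N -> R), (forall i, V (u i)) ->
  0 <= \sum_i \sum_j z i * z j * k (u i) (u j).
Proof.
move=> pk N u z Vu.
pose s := undup (codom u); pose M := size s.
have us i : (index (u i) s < M)%N by rewrite index_mem mem_undup codom_f.
pose p i : 'I_M := Ordinal (us i).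
case: N u z Vu @s @M us @p => [|N] u z Vu s M us p; first by rewrite big_ord0.
pose x i := nth (u ord0) s (i : 'I_M).
have xp i : x (p i) = u i by rewrite /x nth_index // mem_undup codom_f.
have xinj : injective x.
  move=> i j /eqP; rewrite nth_uniq ?undup_uniq // => /eqP; exact: val_inj.
have Vx i : V (x i).
  have : x i \in s by rewrite mem_nth.
  by rewrite mem_undup => /codomP[j ->].
have [_ /(_ (\col_i \sum_(k | p k == i) z k))] := pk M x xinj Vx.
rewrite dotvE.
suff -> : \sum_i \sum_j z i * z j * k (u i) (u j) =
  \sum_i (\col_i \sum_(k | p k == i) z k) i 0 *
     ((\matrix_(i, j) k (x i) (x j)) *m (\col_i \sum_(k | p k == i) z k)) i 0 by [].
rewrite (partition_big p xpredT) //=; apply: eq_bigr => a _.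
rewrite !mxE mulr_suml; apply: eq_bigr => i /eqP pi.
rewrite (partition_big p xpredT) //= mulr_sumr; apply: eq_bigr => b _.
rewrite !mxE mulr_sumr mulr_sumr; apply: eq_bigr => j /eqP pj.
by rewrite -pi -pj !xp; ring.
Qed.

Lemma psdmx_form N (A : 'I_N -> 'I_N -> R) : (forall i j, A i j = A j i) ->
  (forall z : 'I_N -> R, 0 <= \sum_i \sum_j z i * z j * A i j) ->
  psdmx (\matrix_(i, j) A i j).
Proof.
move=> As Ap; split; first by apply/matrixP => i j; rewrite !mxE.
move=> v; have := Ap (fun i => v i 0); rewrite dotvE.
suff -> : \sum_i \sum_j v i 0 * v j 0 * A i j = \sum_i v i 0 * ((\matrix_(i, j) A i j) *m v) i 0 by [].
apply: eq_bigr => i _; rewrite mxE mulr_sumr; apply: eq_bigr => j _; rewrite mxE; ring.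
Qed.

Section Model.
Variables (r m : nat).

(** Standard configuration in R^r + R^m with Gram matrix C^T C. Over it, [lift_pt] realizes given
    inner products y with a prescribed direction v in R^m. *)
Definition frame (C : 'M[R]_r) : 'M[R]_(r + m, r) := col_mx C 0.

Definition lift_pt (C : 'M[R]_r) (y : 'cV[R]_r) (v : 'cV[R]_m) : 'cV[R]_(r + m) :=
  col_mx (invmx C^T *m y) (radius (C^T *m C) y *: v).

Lemma frame_gram C : (frame C)^T *m frame C = C^T *m C.
Proof. by rewrite /frame tr_col_mx mul_row_col mulmx0 addr0. Qed.

Lemma chol_unit (C : 'M[R]_r) : pdmx (C^T *m C) -> C \in unitmx.
Proof. by move=> /pdmx_unit; rewrite unitmx_mul => /andP[]. Qed.

Lemma frame_lift_pt C y v : pdmx (C^T *m C) -> (frame C)^T *m lift_pt C y v = y.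
Proof.
move=> /chol_unit Cu; rewrite /frame /lift_pt tr_col_mx mul_row_col trmx0 mul0mx addr0.
by rewrite mulmxA mulmxV ?mul1mx // unitmx_tr.
Qed.

Lemma lift_pt_dotv C y1 y2 v1 v2 : pdmx (C^T *m C) ->
  dotv (lift_pt C y1 v1) (lift_pt C y2 v2) = qform (C^T *m C) y1 y2 +
    radius (C^T *m C) y1 * radius (C^T *m C) y2 * dotv v1 v2.
Proof.
move=> Yp; have Cu := chol_unit Yp.
rewrite /lift_pt dotv_col dotvZl dotvZr mulrA; congr (_ + _).
rewrite dotv_mull /qform mulmxA; congr (dotv _ (_ *m _)).
rewrite trmx_inv trmxK -[LHS]mul1mx -(mulVmx (pdmx_unit Yp)) -mulmxA -[RHS]mulmx1.
by congr (_ *m _); rewrite -mulmxA (mulmxA C) mulmxV ?mul1mx ?mulmxV ?unitmx_tr.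
Qed.

Lemma lift_pt_sphere C y v : gram_bundle (y, C^T *m C) -> sphere v ->
  sphere (lift_pt C y v).
Proof.
move=> gb /sphereP vv; have [_ /= Yp] := gb.
apply/sphereP; rewrite lift_pt_dotv // vv mulr1 -expr2 radius_sqr //; ring.
Qed.

Lemma frame_spheres C : elliptope (C^T *m C) -> spheres (frame C).
Proof.
move=> [_ diag] j; apply/sphereP; rewrite -(diag j) -frame_gram dotvE mxE.
by apply: eq_bigr => i _; rewrite !mxE.
Qed.

(** An orthogonal map carries Z to the frame of a Cholesky factor; vectors orthogonal to Z then have
    zero part in R^r, and their part in R^m keeps all inner products. *)
Lemma perp_gram (Z : 'M[R]_(r + m, r)) N (w : 'I_N -> 'cV[R]_(r + m)) :
  pdmx (Z^T *m Z) -> (forall a, Z^T *m w a = 0) ->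
  exists v : 'I_N -> 'cV[R]_m, forall a b, dotv (v a) (v b) = dotv (w a) (w b).
Proof.
move=> Yp Zw; have [C CY] := pdmx_cholesky Yp.
have Cu : C \in unitmx by apply: chol_unit; rewrite CY.
have [|M [oM MZ]] := @gram_orth R _ _ Z (frame C); first by rewrite frame_gram.
exists (fun a => dsubmx (M *m w a)) => a b.
have u0 c : usubmx (M *m w c) = 0.
  have : C^T *m usubmx (M *m w c) = 0.
    have <- : (frame C)^T *m (M *m w c) = 0.
      by rewrite -MZ trmx_mul -mulmxA (mulmxA M^T) oM mul1mx Zw.
    by rewrite -[M *m w c in RHS]vsubmxK /frame tr_col_mx mul_row_col trmx0 mul0mx addr0.
  move=> /(congr1 (mulmx (invmx C^T))); rewrite mulmxA mulVmx ?unitmx_tr //.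
  by rewrite mul1mx mulmx0.
by rewrite -[RHS](orth_dotv _ _ oM) -[M *m w a in RHS]vsubmxK -[M *m w b in RHS]vsubmxK dotv_col !u0 dotv0 add0r.
Qed.

End Model.
End Bordered.

(** * Continuity and compactness *)

Section Cvg.
Variables (R : realType) (T : Type) (F : set_system T).
Context {FF : Filter F}.

Lemma cvg_bigsum (I : Type) (s : seq I) (P : pred I) (f : I -> T -> R) (l : I -> R) :
  (forall i, f i @ F --> l i) -> (fun x => \sum_(i <- s | P i) f i x) @ F --> \sum_(i <- s | P i) l i.
Proof.
by move=> fl; apply: cvg_big => //; exact: add_continuous.
Qed.

Lemma cvg_bigprod (I : Type) (s : seq I) (P : pred I) (f : I -> T -> R) (l : I -> R) :
  (forall i, f i @ F --> l i) -> (fun x => \prod_(i <- s | P i) f i x) @ F --> \prod_(i <- s | P i) l i.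
Proof.
by move=> fl; apply: cvg_big => //; exact: mul_continuous.
Qed.

Lemma cvg_mxP p q (f : T -> 'M[R]_(p, q)) (l : 'M[R]_(p, q)) :
  f @ F --> l <-> forall i j, (fun x => f x i j) @ F --> l i j.
Proof.
split=> [fl i j|fl].
  by apply: (cvg_comp f (fun M : 'M[R]_(p, q) => M i j) fl); exact: coord_continuous.
move=> U [P lP PU]; apply: (filterS PU); apply: filter_forall => i.
by apply: filter_forall => j; exact: fl (lP i j).
Qed.

Lemma cvg_mulmx p q s (f : T -> 'M[R]_(p, q)) (g : T -> 'M[R]_(q, s)) (a : 'M[R]_(p, q)) (b : 'M[R]_(q, s)) :
  f @ F --> a -> g @ F --> b -> (fun x => f x *m g x) @ F --> a *m b.
Proof.
move=> /cvg_mxP fa /cvg_mxP gb; apply/cvg_mxP => i j.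
under eq_fun do rewrite mxE; rewrite mxE; apply: cvg_bigsum => k; exact: cvgM.
Qed.

Lemma cvg_trmx p q (f : T -> 'M[R]_(p, q)) (a : 'M[R]_(p, q)) : f @ F --> a -> (fun x => (f x)^T) @ F --> a^T.
Proof.
move=> /cvg_mxP fa; apply/cvg_mxP => i j; under eq_fun do rewrite mxE; rewrite mxE. exact: fa.
Qed.

Lemma cvg_dotv p (f g : T -> 'cV[R]_p) (a b : 'cV[R]_p) :
  f @ F --> a -> g @ F --> b -> (fun x => dotv (f x) (g x)) @ F --> dotv a b.
Proof.
by move=> fa gb; have /cvg_mxP/(_ 0 0) := cvg_mulmx (cvg_trmx fa) gb.
Qed.

Lemma cvg_det p (f : T -> 'M[R]_p) (a : 'M[R]_p) : f @ F --> a -> (fun x => \det (f x)) @ F --> \det a.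
Proof.
move=> /cvg_mxP fa; rewrite /determinant; apply: cvg_bigsum => s.
by apply: cvgM; [exact: cvg_cst | apply: cvg_bigprod].
Qed.

Lemma cvg_invmx p (f : T -> 'M[R]_p) (a : 'M[R]_p) : a \in unitmx -> f @ F --> a ->
  (fun x => invmx (f x)) @ F --> invmx a.
Proof.
move=> ua fa; have fd := cvg_det fa.
have da : \det a != 0 by rewrite unitmxE unitfE in ua.
have nu : \forall x \near F, f x \in unitmx.
  have nz : \forall x \near F, \det (f x) != 0 by exact: cvgr_neq0 fd da.
  by apply: filterS nz => x; rewrite unitmxE unitfE.
have E : (fun x => (\det (f x))^-1 *: \adj (f x)) @ F --> (\det a)^-1 *: \adj a.
  apply: cvgZ; first exact: cvgV.
  apply/cvg_mxP => i j; under eq_fun do rewrite mxE; rewrite mxE /cofactor.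
  apply: cvgM; first exact: cvg_cst.
  apply: cvg_det; apply/cvg_mxP => k l; under eq_fun do rewrite !mxE; rewrite !mxE.
  by move/cvg_mxP: fa => fa; exact: fa.
rewrite /invmx ua; apply: cvg_trans E; apply: near_eq_cvg.
by apply: filterS nu => x ->.
Qed.

End Cvg.

(** A continuous map from a compact space to a Hausdorff space is a quotient map onto its image. *)
Lemma quotient_continuous (R : realType) (T U : topologicalType) (X : set T) (phi : T -> U)
    (f : T -> R) (g : U -> R) : compact X -> hausdorff_space U ->
  {within X, continuous phi} -> {within X, continuous f} ->
  (forall x, X x -> g (phi x) = f x) -> {within phi @` X, continuous g}.
Proof.
move=> cX hU /subspace_continuousP phic /within_continuousP fc gf.
apply/within_continuousP => _ [x0 Xx0 <-] e e0.
have := (compact_near_coveringP _).1 cX U (nbhs (phi x0))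
  (fun u x => X x -> phi x = u -> `|g (phi x0) - f x| <= e) _.
move=> cov; have : \forall u \near phi x0, X `<=`
    (fun x => X x -> phi x = u -> `|g (phi x0) - f x| <= e).
  (* If phi x = phi x0, continuity of f at x suffices, since f x = g (phi x0). Otherwise disjoint
     neighbourhoods of phi x and phi x0 rule out phi y = u. *)
  apply: cov => x Xx; have [E|neq] := eqVneq (phi x) (phi x0).
    exists ([set y | X y -> `|f x - f y| <= e], setT) => /=.
      by split; [exact: fc | exact: filterT].
    by move=> [y u] /= [h _] Xy _; rewrite -E gf //; exact: h.
  have := hU; rewrite open_hausdorff => /(_ _ _ neq)[[A B] /= [/set_mem Ax /set_mem Bx] [oA oB /eqP AB]].
  have nA : nbhs x [set y | X y -> A (phi y)] := phic _ Xx A (open_nbhs_nbhs (conj oA Ax)).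
  exists ([set y | X y -> A (phi y)], B) => /=; first by split=> //; exact: open_nbhs_nbhs.
  move=> [y u] /= [h Bu] Xy yu; have : (A `&` B) u by split=> //; rewrite -yu; exact: h.
  by rewrite AB.
by apply: filterS => u h [x Xx xu]; rewrite -xu [g (phi x)]gf //; exact: (h x Xx Xx xu).
Qed.

Lemma continuous_mx (R : realType) (T : topologicalType) p q (f : T -> 'M[R]_(p, q)) :
  (forall i j, continuous (fun x => f x i j)) -> continuous f.
Proof. by move=> h x; apply: (@cvg_mxP R T (nbhs x) _ p q f (f x)).2 => i j; exact: h. Qed.

Lemma cube_compact (R : realType) n k :
  compact [set A : 'M[R]_(n, k) | forall i j, -1 <= A i j <= 1].
Proof.
pose C : set 'rV[R]_(n * k) := [set v | forall i, `[(-1 : R), 1]%classic (v ord0 i)].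
have cC : compact C by apply: (@rV_compact _ _ (fun=> `[(-1 : R), 1]%classic)) => i; exact: segment_compact.
have -> : [set A : 'M[R]_(n, k) | forall i j, -1 <= A i j <= 1] = vec_mx @` C.
  apply/seteqP; split=> [A hA|_ [v hv <-] i j].
    exists (mxvec A); last by rewrite mxvecK.
    by move=> i /=; rewrite in_itv /=; case/mxvec_indexP: i => i j; rewrite mxvecE.
  by have := hv (mxvec_index i j); rewrite /= in_itv /= mxE.
apply: continuous_compact => //; apply: continuous_subspaceT.
by apply: continuous_mx => i j; under eq_fun do rewrite mxE; exact: coord_continuous.
Qed.

Lemma spheres_compact (R : realType) n k : compact (@spheres R n k).
Proof.
apply: subclosed_compact (@cube_compact R n k) _.
  have -> : @spheres R n k = \bigcap_(j in setT) ((fun Z : 'M[R]_(n, k) => dotv (col j Z) (col j Z)) @^-1` [set 1]).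
    apply/seteqP; split=> [Z hZ j _|Z hZ j]; first by apply/sphereP.
    by apply/sphereP; exact: (hZ j I).
  apply: closed_bigI => j _; apply: preimage_closed; last exact: closed_eq.
  have cc : continuous (fun Z : 'M[R]_(n, k) => col j Z).
    by apply: continuous_mx => a b; under eq_fun do rewrite mxE; exact: coord_continuous.
  by move=> Z _; exact: (@cvg_dotv R _ (nbhs Z) _ _ _ _ _ _ (cc Z) (cc Z)).
move=> Z hZ i j; have /sphereP := hZ j; rewrite dotvE (bigD1 i) //= !mxE -expr2 => h.
rewrite -ler_norml -[leRHS]sqrtr1 -sqrtr_sqr ler_wsqrtr // -h lerDl.
by apply: sumr_ge0 => l _; rewrite -expr2 sqr_ge0.
Qed.

Lemma sphere_compact (R : realType) n : compact (@sphere R n).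
Proof.
have -> : @sphere R n = @spheres R n 1.
  apply/seteqP; split=> x hx; first by move=> j; rewrite ord1 col_id.
  by have := hx 0; rewrite col_id.
exact: spheres_compact.
Qed.

(** * Generic configurations *)

Lemma poly_neq0_near_right (R : realType) (p : {poly R}) : p != 0 ->
  \forall e \near (0 : R)^'+, p.[e] != 0.
Proof.
have [k sp] := ubnP (size p); elim: k p sp => // k IH p sp p0.
have [/factor_theorem[q pq]|p00] := boolP (root p 0); last first.
  have c : (fun e : R => p.[e]) @ (0 : R)^'+ --> p.[0].
    by apply: cvg_at_right_filter; exact: continuous_horner.
  exact: cvgr_neq0 c p00.
have q0 : q != 0 by apply: contraNneq p0 => q0; rewrite pq q0 mul0r.
have sq : (size q < k)%N.
  move: sp; rewrite pq subr0 size_mulX // ltnS; exact: leq_trans.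
have h1 := IH q sq q0; have h2 := nbhs_right_neq (0 : R).
apply: filterS2 h1 h2 => e qe e0.
by rewrite pq subr0 hornerM hornerX mulf_neq0.
Qed.

Lemma char_poly_horner (R : realType) k (A : 'M[R]_k) e :
  (char_poly A).[e] = \det (e%:M - A).
Proof.
rewrite -horner_evalE -det_map_mx; congr (\det _); apply/matrixP => i j.
by rewrite !mxE /= /horner_eval !hornerE hornerMn hornerX.
Qed.

Lemma unitmx_shift_near (R : realType) k (A : 'M[R]_k) :
  \forall e \near (0 : R)^'+, A + e%:M \in unitmx.
Proof.
have := poly_neq0_near_right (monic_neq0 (char_poly_monic (- A))).
apply: filterS => e; rewrite char_poly_horner opprK addrC.
by rewrite unitmxE unitfE.
Qed.

Definition generic (R : realType) n r (x : 'cV[R]_n) (Z : 'M[R]_(n, r)) :=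
  forall a v, a *: x + Z *m v = 0 -> a = 0 /\ v = 0.

Lemma generic_pdmx (R : realType) n r (x : 'cV[R]_n) (Z : 'M[R]_(n, r)) :
  generic x Z -> pdmx (Z^T *m Z).
Proof.
move=> g; split; first by rewrite trmx_mul trmxK.
move=> v v0; rewrite -mulmxA -dotv_mull lt_neqAle eq_sym dotv_ge0 andbT dotv_eq0.
apply: contra v0 => /eqP h; have [|_ ->//] := g 0 v.
by rewrite scale0r add0r.
Qed.

Lemma generic_perp (R : realType) n r (x : 'cV[R]_n) (Z : 'M[R]_(n, r)) :
  generic x Z -> perp_proj Z *m x != 0.
Proof.
move=> g; apply/eqP => h.
have [|/eqP] := g 1 (- (invmx (Z^T *m Z) *m (Z^T *m x))); last by rewrite oner_eq0.
rewrite scale1r mulmxN -[RHS]h /perp_proj mulmxBl mul1mx /range_proj.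
by rewrite !mulmxA.
Qed.

Lemma bundle_kernel_cvg (R : realType) n r (K : 'M[R]_(n, r) -> 'cV[R]_n -> 'cV[R]_n -> R)
    (T : Type) (F : set_system T) (FF : Filter F) (x y : 'cV[R]_n) (Z : 'M[R]_(n, r)) xf yf Zf :
  bundle_kernel (@sphere_bundle R n r) K -> sphere x -> sphere y -> spheres Z ->
  (\forall e \near F, [/\ sphere (xf e), sphere (yf e) & spheres (Zf e)]) ->
  xf @ F --> x -> yf @ F --> y -> Zf @ F --> Z ->
  (fun e => K (Zf e) (xf e) (yf e)) @ F --> K Z x y.
Proof.
move=> [/within_continuousP Kc _] sx sy sZ sF cx cy cZ; apply/cvgrPdist_le => d d0.
have h := Kc (x, y, Z) (conj (conj sx sZ) (conj sy sZ)) d d0.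
have h' : \forall e \near F,
    sphere_bundle (xf e, Zf e) /\ sphere_bundle (yf e, Zf e) ->
    `|K Z x y - K (Zf e) (xf e) (yf e)| <= d.
  exact: (cvg_pair (cvg_pair cx cy) cZ h).
by apply: filterS2 h' sF => e he [sx' sy' sZ']; exact: he.
Qed.

Section Path.
Variables (R : realType) (r m : nat).
Hypothesis m0 : (0 < m)%N.
Local Notation n := (r + m)%N.

(* V^T (A + e V) = V^T A + e I is invertible for small e > 0, since the
   characteristic polynomial of - V^T A has finitely many roots; this moves every
   configuration A = [x, Z] to generic ones. *)
Let V : 'M[R]_(n, 1 + r) := pid_mx (1 + r).
Let v0 := lsubmx V.
Let V' := rsubmx V.

Let VV : V^T *m V = 1%:M.
Proof. by rewrite /V tr_pid_mx mul_pid_mx minnn (minn_idPr _) ?pid_mx_1 //; lia. Qed.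

Let xpre (x : 'cV[R]_n) (e : R) := x + e *: v0.
Let Zpre (Z : 'M[R]_(n, r)) (e : R) := Z + e *: V'.

(** The path of x does not involve Z, nor that of Z the point x, so a single path of Z serves
    several points at once. *)
Definition xpath (x : 'cV[R]_n) (e : R) := (enorm (xpre x e))^-1 *: xpre x e.
Definition Zpath (Z : 'M[R]_(n, r)) (e : R) :=
  Zpre Z e *m diag_mx (\row_j (enorm (col j (Zpre Z e)))^-1).

Let pre_generic x Z : \forall e \near (0 : R)^'+, generic (xpre x e) (Zpre Z e).
Proof.
have := unitmx_shift_near (V^T *m row_mx x Z); apply: filterS => e u a v h.
have E : (V^T *m row_mx x Z + e%:M) *m col_mx a%:M v = 0.
  have -> : V^T *m row_mx x Z + e%:M = V^T *m row_mx (xpre x e) (Zpre Z e).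
    have -> : row_mx (xpre x e) (Zpre Z e) = row_mx x Z + e *: V.
      by rewrite -[V]hsubmxK scale_row_mx add_row_mx.
    by rewrite mulmxDr -scalemxAr VV scalemx1.
  by rewrite -mulmxA mul_row_col mul_mx_scalar h mulmx0.
have := congr1 (mulmx (invmx (V^T *m row_mx x Z + e%:M))) E.
rewrite mulmxA mulVmx // mul1mx mulmx0 => /eqP; rewrite col_mx_eq0 => /andP[/eqP ha /eqP hv].
by split=> //; move/matrixP/(_ 0 0): ha; rewrite !mxE.
Qed.

Let enorm_neq0 k (x : 'cV[R]_k) : x != 0 -> enorm x != 0.
Proof. by move=> x0; rewrite gt_eqF // sqrtr_gt0 lt_neqAle eq_sym dotv_eq0 x0 dotv_ge0. Qed.

Let sphere_normalize k (x : 'cV[R]_k) : x != 0 -> sphere ((enorm x)^-1 *: x).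
Proof.
move=> x0; apply/sphereP; rewrite dotvZl dotvZr -enorm_sqr.
by field; exact: enorm_neq0.
Qed.

Lemma path_generic x Z : \forall e \near (0 : R)^'+,
  [/\ sphere (xpath x e), spheres (Zpath Z e) & generic (xpath x e) (Zpath Z e)].
Proof.
have := pre_generic x Z; apply: filterS => e g.
have x0 : xpre x e != 0.
  apply/eqP => h; have [|/eqP] := g 1 0; last by rewrite oner_eq0.
  by rewrite mulmx0 addr0 scale1r.
have z0 j : col j (Zpre Z e) != 0.
  apply/eqP => h; have [|_ /colP/(_ j)] := g 0 (delta_mx j 0).
    by rewrite -colE h scale0r addr0.
  by rewrite !mxE !eqxx => /eqP; rewrite oner_eq0.
have colZ j : col j (Zpath Z e) = (enorm (col j (Zpre Z e)))^-1 *: col j (Zpre Z e).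
  by apply/colP => i; rewrite /Zpath mul_mx_diag !mxE mulrC.
split; first exact: sphere_normalize.
  by move=> j; rewrite colZ; exact: sphere_normalize.
move=> a v; rewrite /xpath /Zpath scalerA -mulmxA => /g[/eqP ha hv]; split.
  by apply/eqP; move: ha; rewrite mulf_eq0 invr_eq0 (negbTE (enorm_neq0 x0)) orbF.
apply/colP => j; move/colP/(_ j): hv; rewrite mul_diag_mx !mxE => /eqP.
by rewrite mulf_eq0 invr_eq0 (negbTE (enorm_neq0 (z0 j))) => /eqP.
Qed.

Let cvg_enorm_inv (T : Type) (F : set_system T) (FF : Filter F) k
  (f : T -> 'cV[R]_k) (a : 'cV[R]_k) : sphere a -> f @ F --> a -> (fun t => (enorm (f t))^-1) @ F --> (1 : R).
Proof.
move=> sa fa; rewrite -[1 in X in _ --> X]invr1 -[1 in X in _ --> X]sa.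
apply: cvgV; first by rewrite sa oner_neq0.
have c : (fun t => dotv (f t) (f t)) @ F --> dotv a a by exact: cvg_dotv.
exact: cvg_comp c (@sqrt_continuous R (dotv a a)).
Qed.

Let cvg_pre k l (A B : 'M[R]_(k, l)) : (fun e => A + e *: B) @ (0 : R)^'+ --> A.
Proof.
rewrite -[A in X in _ --> X]addr0 -[0 in X in _ --> X](scale0r B).
apply: cvgD; first exact: cvg_cst.
apply: cvgZr_tmp; apply: cvg_at_right_filter; exact: cvg_id.
Qed.

Lemma xpath_cvg x : sphere x -> xpath x @ (0 : R)^'+ --> x.
Proof.
move=> sx; rewrite -[X in _ --> X]scale1r; apply: cvgZ; last exact: cvg_pre.
by apply: cvg_enorm_inv sx _; exact: cvg_pre.
Qed.

Lemma Zpath_cvg Z : spheres Z -> Zpath Z @ (0 : R)^'+ --> Z.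
Proof.
move=> sZ; rewrite -[X in _ --> X]mulmx1; apply: cvg_mulmx; first exact: cvg_pre.
rewrite -diag_const_mx; apply/cvg_mxP => i j; under eq_fun do rewrite mxE; rewrite mxE.
apply: cvgMn; under eq_fun do rewrite mxE; rewrite mxE.
apply: cvg_enorm_inv (sZ i) _; apply/cvg_mxP => k l; under eq_fun do rewrite mxE; rewrite mxE.
by have /cvg_mxP := @cvg_pre _ _ Z V'; exact.
Qed.

Lemma kernel_path_cvg (K : 'M[R]_(n, r) -> 'cV[R]_n -> 'cV[R]_n -> R) x y Z :
  bundle_kernel (@sphere_bundle R n r) K -> sphere x -> sphere y -> spheres Z ->
  (fun e => K (Zpath Z e) (xpath x e) (xpath y e)) @ (0 : R)^'+ --> K Z x y.
Proof.
move=> hK sx sy sZ.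
apply: bundle_kernel_cvg => //; first last.
- exact: Zpath_cvg.
- exact: xpath_cvg.
- exact: xpath_cvg.
- by apply: filterS2 (path_generic x Z) (path_generic y Z) => e [? ? _] [? _ _].
Qed.

End Path.

(** * Invariant positive definite kernels *)

(** The factor a_i is the value at 1. For m = 2 the order is 0 and the Chebyshev polynomials are
    already normalized. *)
Lemma gegenbauer_normalized (R : realType) m : (2 <= m)%N ->
  exists2 a : nat -> R, forall i, 0 < a i &
    forall i, gegenbauer (m%:R / 2 - 1) i = a i *: geg R m i.
Proof.
move=> m2; have mR := m2R R m2.
rewrite /gegenbauer; case: eqP => [h|/eqP h].
  have m2R : m%:R = 2 :> R by lra.
  exists (fun=> 1) => // i; rewrite scale1r.
  elim/ltn_ind: i => -[|[|i]] IH //.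
  have i0 := ler0n R i.
  have n0 : m%:R + i%:R - 1 != 0 :> R by rewrite lt0r_neq0 //; lra.
  have e1 := IH i.+1 (ltnSn _); have e2 := IH i (leqnSn _).
  apply: (scalerI n0); rewrite geg_rec // -e1 -e2 m2R.
  rewrite [Defs.chebyshev _ i.+2]/= -/(Defs.chebyshev R i.+1) scalerBr scalerA -natr1.
  by congr (_ *: _ - _ *: _); ring.
pose al : R := m%:R / 2 - 1.
have al0 : 0 < al by rewrite lt_neqAle eq_sym h /al; lra.
(* In closed form, 2 al (2 al + 1) ... (2 al + i - 1) / i!. *)
pose a := fix a i : R := if i is j.+1 then (j%:R + 2 * al) / j.+1%:R * a j else 1.
have a0 i : 0 < a i.
  elim: i => [|i IH] //=; rewrite mulr_gt0 // divr_gt0 ?ltr0n //.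
  have := ler0n R i; lra.
exists a => // i; rewrite -/al.
elim/ltn_ind: i => -[|[|i]] IH.
- by rewrite /= scale1r.
- by rewrite /= add0r divr1 mulr1.
have i0 := ler0n R i.
have e1 := IH i.+1 (ltnSn _); have e2 := IH i (leqnSn _).
have n0 : m%:R + i%:R - 1 != 0 :> R by rewrite lt0r_neq0 //; lra.
have n1 : i.+2%:R != 0 :> R by rewrite pnatr_eq0.
apply: (scalerI n0); rewrite [RHS]scalerA [_ * a _]mulrC -scalerA geg_rec //.
rewrite [gegenbauer_rec _ _]/= -/(gegenbauer_rec al i.+1) e1 e2.
rewrite -!scalerAr !scalerBr !scalerA; congr (_ *: _ - _ *: _).
  rewrite [a i.+2]/= -/(a i.+1) -!natr1 /al; field.
  by rewrite !natr1.
rewrite [a i.+2]/= -!natr1 /al; field.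
by rewrite !natr1 !pnatr_eq0.
Qed.

Lemma pd_kernel_form_fin (R : realType) (T : topologicalType) (V : set T) (k : T -> T -> R) :
  pd_kernel V k -> forall (I : finType) (u : I -> T) (z : I -> R), (forall i, V (u i)) ->
  0 <= \sum_i \sum_j z i * z j * k (u i) (u j).
Proof.
move=> pk I u z Vu; pose nu (i : 'I_#|I|) : I := @enum_val I I i.
have := pd_kernel_form pk (fun i => z (nu i)) (fun i => Vu (nu i)).
congr (0 <= _); symmetry.
rewrite (reindex nu); last exact: onW_bij (enum_val_bij I).
apply: eq_bigr => i _; rewrite (reindex nu) //; exact: onW_bij (enum_val_bij I).
Qed.

Lemma papx_sum (R : realType) (I : Type) (s : seq I) (a : I -> R) (f : I -> R -> R) :
  (forall j, papx (f j)) -> papx (fun t => \sum_(j <- s) a j * f j t).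
Proof.
move=> pf; elim: s => [|j s IH].
  by move=> e e0; exists 0 => t _; rewrite big_nil horner0 subrr normr0 ltW.
have := papx_lin (a j) 1 (pf j) IH.
by congr papx; apply/funext => t; rewrite big_cons mul1r.
Qed.

Lemma gcoef_sum (R : realType) m (m2 : (2 <= m)%N) i (I : Type) (s : seq I) (a : I -> R) (f : I -> R -> R) :
  (forall j, papx (f j)) ->
  gcoef m i (fun t => \sum_(j <- s) a j * f j t) = \sum_(j <- s) a j * gcoef m i (f j).
Proof.
move=> pf; elim: s => [|j s IH].
  have p0 := papx_poly (0 : {poly R}).
  have g0 : gcoef m i (fun t => 0 * (0 : {poly R}).[t] + 0 * (0 : {poly R}).[t]) = 0.
    by rewrite gcoef_lin // !mul0r addr0.
  rewrite big_nil -[RHS]g0; congr gcoef; apply/funext => t.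
  by rewrite big_nil !mul0r addr0.
transitivity (a j * gcoef m i (f j) + 1 * gcoef m i (fun t => \sum_(j <- s) a j * f j t)).
  rewrite -gcoef_lin //; last exact: papx_sum.
  by congr gcoef; apply/funext => t; rewrite big_cons mul1r.
by rewrite mul1r big_cons IH.
Qed.

Lemma gram_bundle_elliptope (R : realType) r (y : 'cV[R]_r) Y :
  gram_bundle (y, Y) -> elliptope Y.
Proof.
move=> [[_ diag] [Ys Yp]]; split; last first.
  by move=> i; have := diag (rshift 1 i); rewrite block_mxEdr.
split=> // v; have [->|v0] := eqVneq v 0; last exact/ltW/Yp.
by rewrite mulmx0 dotv0.
Qed.

(** * From an invariant p.d. kernel to its coefficients *)

Section Forward.
Variables (R : realType) (r m : nat).
Hypothesis m2 : (2 <= m)%N.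
Local Notation n := (r + m)%N.
Variable K : 'M[R]_(n, r) -> 'cV[R]_n -> 'cV[R]_n -> R.
Hypothesis hK : bundle_kernel (@sphere_bundle R n r) K.
Hypothesis Kinv : orthogonal_invariant K.
Hypothesis Kpd : bundle_pd (@sphere_bundle R n r) K.

Let pts : set ('cV[R]_n * 'cV[R]_n * 'M[R]_(n, r)) :=
  (@sphere R n `*` @sphere R n) `*` @spheres R n r.

(* By [gram_orth], an orthogonally invariant K only depends on these inner
   products; [descent] is K as a function of them. *)
Definition gram (p : 'cV[R]_n * 'cV[R]_n * 'M[R]_(n, r)) : R * 'cV[R]_r * 'cV[R]_r * 'M[R]_r :=
  (dotv p.1.1 p.1.2, p.2^T *m p.1.1, p.2^T *m p.1.2, p.2^T *m p.2).

(** Together with the unit norms of x and y, the data of [gram] give the whole Gram matrix of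
    [x, y, Z]. *)
Lemma gram_inv p q : pts p -> pts q -> gram p = gram q ->
  K p.2 p.1.1 p.1.2 = K q.2 q.1.1 q.1.2.
Proof.
case: p q => [[x y] Z] [[x' y'] Z'] [[/= sx sy] sZ] [[/= sx' sy'] sZ'] [/= xy Zx Zy ZZ].
have [|M [oM E]] := @gram_orth R n (1 + (1 + r)) (row_mx x (row_mx y Z)) (row_mx x' (row_mx y' Z')).
  have xx : x^T *m x = x'^T *m x'.
    by rewrite [LHS]mx11_scalar [RHS]mx11_scalar -![(_ *m _) 0 0]/(dotv _ _) (sphereP _).1 // (sphereP _).1.
  have yy : y^T *m y = y'^T *m y'.
    by rewrite [LHS]mx11_scalar [RHS]mx11_scalar -![(_ *m _) 0 0]/(dotv _ _) (sphereP _).1 // (sphereP _).1.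
  have xy' : x^T *m y = x'^T *m y'.
    by rewrite [LHS]mx11_scalar [RHS]mx11_scalar -![(_ *m _) 0 0]/(dotv _ _) xy.
  have yx' : y^T *m x = y'^T *m x' by apply: trmx_inj; rewrite !trmx_mul !trmxK xy'.
  have xZ : x^T *m Z = x'^T *m Z' by apply: trmx_inj; rewrite !trmx_mul !trmxK Zx.
  have yZ : y^T *m Z = y'^T *m Z' by apply: trmx_inj; rewrite !trmx_mul !trmxK Zy.
  by rewrite !tr_row_mx !mul_col_row !mul_mx_row !mul_col_mx xx xy' xZ yx' yy yZ Zx Zy ZZ.
move: E; rewrite !mul_mx_row => /eq_row_mx[<- /eq_row_mx[<- <-]].
by rewrite Kinv.
Qed.

Let pts_compact : compact pts.
Proof.
apply: compact_setX; last exact: spheres_compact.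
by apply: compact_setX; exact: sphere_compact.
Qed.

Definition descent (q : R * 'cV[R]_r * 'cV[R]_r * 'M[R]_r) : R :=
  let p := xget (0, 0, 0) [set p | pts p /\ gram p = q] in K p.2 p.1.1 p.1.2.

Lemma descentE p : pts p -> descent (gram p) = K p.2 p.1.1 p.1.2.
Proof.
move=> hp; rewrite /descent; case: xgetP => [q _ [hq e]|/(_ p)[]//].
exact: gram_inv.
Qed.

Let proj_cvg (A B C : topologicalType) (p : A * B * C) :
  [/\ (fun q : A * B * C => q.1.1) @ p --> p.1.1, (fun q : A * B * C => q.1.2) @ p --> p.1.2
   & (fun q : A * B * C => q.2) @ p --> p.2].
Proof.
have h : (fun q : A * B * C => q.1) @ p --> p.1 by exact: cvg_fst.
split; last exact: cvg_snd.
- exact: cvg_comp h cvg_fst.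
- exact: cvg_comp h cvg_snd.
Qed.

Lemma descent_continuous : {within gram @` pts, continuous descent}.
Proof.
apply: (@quotient_continuous R _ _ pts gram (fun p => K p.2 p.1.1 p.1.2) _ pts_compact) => //.
- apply: continuous_subspaceT => p.
  have [c1 c2 c3] := proj_cvg p.
  exact: cvg_pair (cvg_pair (cvg_pair (cvg_dotv c1 c2) (cvg_mulmx (cvg_trmx c3) c1))
    (cvg_mulmx (cvg_trmx c3) c2)) (cvg_mulmx (cvg_trmx c3) c3).
- have [c _] := hK; rewrite (_ : pts = [set p | sphere_bundle (p.1.1, p.2) /\ sphere_bundle (p.1.2, p.2)]) //.
  by apply/seteqP; split=> p [[h1 h2] h3] //; case: h3.
- exact: descentE.
Qed.

(* K at points with Gram data Y, y1, y2 whose components orthogonal to the range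
   of Z form an angle of cosine t. *)
Definition profile (Y : 'M[R]_r) (y1 y2 : 'cV[R]_r) (t : R) : R :=
  descent (qform Y y1 y2 + radius Y y1 * radius Y y2 * t, y1, y2, Y).

Lemma profile_lift (C : 'M[R]_r) y1 y2 v1 v2 :
  gram_bundle (y1, C^T *m C) -> gram_bundle (y2, C^T *m C) -> sphere v1 -> sphere v2 ->
  profile (C^T *m C) y1 y2 (dotv v1 v2) = K (frame m C) (lift_pt C y1 v1) (lift_pt C y2 v2).
Proof.
move=> g1 g2 s1 s2; have [_ /= Yp] := g1.
rewrite /profile -lift_pt_dotv // -{2}(frame_lift_pt y1 v1 Yp) -{2}(frame_lift_pt y2 v2 Yp) -(frame_gram m C).
rewrite -/(gram (lift_pt C y1 v1, lift_pt C y2 v2, frame m C)) descentE //.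
split; first by split; exact: lift_pt_sphere.
exact/frame_spheres/gram_bundle_elliptope/g1.
Qed.

Lemma profile_perp_cos x y Z : sphere x -> sphere y -> spheres Z -> pdmx (Z^T *m Z) ->
  profile (Z^T *m Z) (Z^T *m x) (Z^T *m y) (perp_cos Z x y) = K Z x y.
Proof.
move=> sx sy sZ Yp; rewrite /profile -dotv_perp_cos //.
by rewrite -/(gram (x, y, Z)) descentE.
Qed.

Definition gram_dom : set ('cV[R]_r * 'cV[R]_r * 'M[R]_r) :=
  [set p | @gram_bundle R r (p.1.1, p.2) /\ @gram_bundle R r (p.1.2, p.2)].

(** Since m >= 2, two unit vectors of R^m form any angle. Hence on its domain [profile] never meets
    the arbitrary values of [descent]. *)
Lemma profile_realize (Y : 'M[R]_r) (y1 y2 : 'cV[R]_r) t :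
  gram_dom (y1, y2, Y) -> -1 <= t <= 1 ->
  exists p, pts p /\ gram p = (qform Y y1 y2 + radius Y y1 * radius Y y2 * t, y1, y2, Y).
Proof.
move=> [/= g1 g2] /(unit_pair m2)[u [v [uu vv <-]]].
have [_ /= Yp] := g1; have [C CY] := pdmx_cholesky Yp; move: g1 g2 Yp; rewrite -CY => g1 g2 Yp.
exists (lift_pt C y1 u, lift_pt C y2 v, frame m C); split.
  split; first by split; apply: lift_pt_sphere => //; exact/sphereP.
  exact/frame_spheres/gram_bundle_elliptope/g1.
by rewrite /gram /= lift_pt_dotv // !frame_lift_pt // frame_gram.
Qed.

Lemma profileC Y y1 y2 t : gram_dom (y1, y2, Y) -> -1 <= t <= 1 ->
  profile Y y1 y2 t = profile Y y2 y1 t.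
Proof.
move=> g ht; have [_ /= Yp] := g.1.
have [[[x y] Z] [hp e]] := profile_realize g ht.
have hq : pts (y, x, Z) by case: hp => [[]].
have e' : gram (y, x, Z) = (qform Y y2 y1 + radius Y y2 * radius Y y1 * t, y2, y1, Y).
  move: e; rewrite /gram /= => -[e1 -> -> ->].
  by rewrite dotvC e1 qformC // [radius Y y1 * _]mulrC.
rewrite /profile -e -e' !descentE //=; have [_ /(_ Z)[_]] := hK; apply.
  by case: hp => [[]].
by case: hp => [[]].
Qed.

Lemma profile_continuous :
  {within [set q : 'cV[R]_r * 'cV[R]_r * 'M[R]_r * R | gram_dom q.1 /\ -1 <= q.2 <= 1],
    continuous (fun q => profile q.1.2 q.1.1.1 q.1.1.2 q.2)}.
Proof.
set D := mkset _.
apply/within_continuousP => -[[[y1 y2] Y] t] [/= gq ht] e e0.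
pose G (q : 'cV[R]_r * 'cV[R]_r * 'M[R]_r * R) : R * 'cV[R]_r * 'cV[R]_r * 'M[R]_r :=
  (qform q.1.2 q.1.1.1 q.1.1.2 + radius q.1.2 q.1.1.1 * radius q.1.2 q.1.1.2 * q.2,
   q.1.1.1, q.1.1.2, q.1.2).
have Gim q : D q -> (gram @` pts) (G q).
  move: q => [[[z1 z2] Z] s] [/= g hs].
  by have [p [hp e']] := profile_realize g hs; exists p.
pose q0 := (y1, y2, Y, t).
have [_ /= Yp] := gq.1.
have h1 : (fun q : 'cV[R]_r * 'cV[R]_r * 'M[R]_r * R => q.1) @ q0 --> q0.1 by exact: cvg_fst.
have ct : (fun q : 'cV[R]_r * 'cV[R]_r * 'M[R]_r * R => q.2) @ q0 --> t by exact: cvg_snd.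
have [p1 p2 p3] := proj_cvg (q0.1).
have c1 : (fun q : 'cV[R]_r * 'cV[R]_r * 'M[R]_r * R => q.1.1.1) @ q0 --> y1 by exact: cvg_comp h1 p1.
have c2 : (fun q : 'cV[R]_r * 'cV[R]_r * 'M[R]_r * R => q.1.1.2) @ q0 --> y2 by exact: cvg_comp h1 p2.
have cY : (fun q : 'cV[R]_r * 'cV[R]_r * 'M[R]_r * R => q.1.2) @ q0 --> Y by exact: cvg_comp h1 p3.
have cI : (fun q : 'cV[R]_r * 'cV[R]_r * 'M[R]_r * R => invmx q.1.2) @ q0 --> invmx Y.
  by exact: cvg_invmx (pdmx_unit Yp) cY.
have cq (a b : 'cV[R]_r) (f g : 'cV[R]_r * 'cV[R]_r * 'M[R]_r * R -> 'cV[R]_r) :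
    f @ q0 --> a -> g @ q0 --> b -> (fun q => qform q.1.2 (f q) (g q)) @ q0 --> qform Y a b.
  by move=> fa gb; exact: cvg_dotv fa (cvg_mulmx cI gb).
have cr (a : 'cV[R]_r) (f : 'cV[R]_r * 'cV[R]_r * 'M[R]_r * R -> 'cV[R]_r) :
    f @ q0 --> a -> (fun q => radius q.1.2 (f q)) @ q0 --> radius Y a.
  move=> fa; have c : (fun q => 1 - qform q.1.2 (f q) (f q)) @ q0 --> 1 - qform Y a a.
    by apply: cvgB; [exact: cvg_cst | exact: cq].
  exact: cvg_comp c (@sqrt_continuous R _).
have cG : G @ q0 --> G q0.
  have cs : (fun q => qform q.1.2 q.1.1.1 q.1.1.2 + radius q.1.2 q.1.1.1 * radius q.1.2 q.1.1.2 * q.2) @ q0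
     --> qform Y y1 y2 + radius Y y1 * radius Y y2 * t.
    by apply: cvgD; [exact: cq | apply: cvgM => //; apply: cvgM; exact: cr].
  exact: cvg_pair (cvg_pair (cvg_pair cs c1) c2) cY.
have /within_continuousP dc := descent_continuous.
have Gq0 : (gram @` pts) (G q0) by exact: Gim.
have near1 : \forall q \near q0, (gram @` pts) (G q) -> `|descent (G q0) - descent (G q)| <= e
  := cG _ (dc _ Gq0 e e0).
by apply: filterS near1 => q hq Dq; exact: hq (Gim _ Dq).
Qed.

Lemma profile_papx Y y1 y2 : gram_dom (y1, y2, Y) -> papx (profile Y y1 y2).
Proof.
move=> g; apply: continuous_papx; apply/within_continuousP => t ht e e0.
have /within_continuousP pc := profile_continuous.
have [[U V] /= [Up Vt] UV] := pc (y1, y2, Y, t) (conj g ht) e e0.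
apply: filterS Vt => s Vs hs.
exact: UV (y1, y2, Y, s) (conj (nbhs_singleton Up) Vs) (conj g hs).
Qed.

(** K is tested at all the points with inner products y_a and direction v_k, with coefficients c_k
    z_a. *)
Lemma profile_sphere_pd (I : finType) (Y : 'M[R]_r) (y : I -> 'cV[R]_r) (z : I -> R) :
  (forall a, gram_bundle (y a, Y)) ->
  sphere_pd m (fun t => \sum_(p : I * I) z p.1 * z p.2 * profile Y (y p.1) (y p.2) t).
Proof.
move=> gy N v c v1.
case: N v c v1 => [|N] v c v1; first by rewrite big_ord0.
(* An index is needed to know that Y is positive definite; for empty I the sum is 0. *)
have [i0|noI] := pickP (fun _ : I => true); last first.
  apply: sumr_ge0 => k _; apply: sumr_ge0 => l _; rewrite big1 ?mulr0 // => -[a b] _.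
  by have := noI a.
move=> _; have [_ /= Yp] := gy i0; have [C CY] := pdmx_cholesky Yp.
move: gy; rewrite -CY => gy.
pose x (p : 'I_N.+1 * I) := lift_pt C (y p.2) (v p.1).
have Vx p : fiber (@sphere_bundle R n r) (frame m C) (x p).
  split; first by apply: lift_pt_sphere => //; exact/sphereP.
  exact/frame_spheres/gram_bundle_elliptope/(gy i0).
have := pd_kernel_form_fin (@Kpd (frame m C)) (fun p => c p.1 * z p.2) Vx.
congr (0 <= _).
transitivity (\sum_k \sum_a \sum_l \sum_b
   c k * z a * (c l * z b) * K (frame m C) (x (k, a)) (x (l, b))).
  rewrite [RHS]pair_bigA; apply: eq_bigr => -[k a] _ /=.
  by rewrite [RHS]pair_bigA; apply: eq_bigr => -[l b] _.
apply: eq_bigr => k _; rewrite exchange_big; apply: eq_bigr => l _ /=.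
rewrite -(pair_bigA _ (fun a b => z a * z b * profile (C^T *m C) (y a) (y b) (dotv (v k) (v l)))) /=.
rewrite mulr_sumr; apply: eq_bigr => a _; rewrite mulr_sumr; apply: eq_bigr => b _.
by rewrite profile_lift //; [ring | exact/sphereP | exact/sphereP].
Qed.

Definition coef i Y y1 y2 := gcoef m i (profile Y y1 y2).

Lemma coef_form_ge0 i (I : finType) (Y : 'M[R]_r) (y : I -> 'cV[R]_r) (z : I -> R) :
  (forall a, gram_bundle (y a, Y)) ->
  0 <= \sum_a \sum_b z a * z b * coef i Y (y a) (y b).
Proof.
move=> gy.
have pp (p : I * I) : papx (profile Y (y p.1) (y p.2)).
  by apply: profile_papx; split; exact: gy.
rewrite pair_bigA -(gcoef_sum m2 i _ (fun p => z p.1 * z p.2) pp).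
apply: gcoef_ge0 => //; first exact: papx_sum.
exact: profile_sphere_pd.
Qed.

Lemma coefC i Y y1 y2 : gram_dom (y1, y2, Y) -> coef i Y y1 y2 = coef i Y y2 y1.
Proof. by move=> g; apply: gcoef_ext => t ht; exact: profileC. Qed.

(** [compact_tube] makes nearby profiles uniformly close in t, and [gcoef] is bounded for the sup
    norm. *)
Lemma coef_continuous i : {within gram_dom, continuous (fun p => coef i p.2 p.1.1 p.1.2)}.
Proof.
apply/within_continuousP => -[[y1 y2] Y] g e e0.
have gn := gnorm_gt0 R m2 i.
have e1 : 0 < e * gnorm R m i by rewrite mulr_gt0.
have tube := compact_tube (H := fun p t => profile p.2 p.1.1 p.1.2 t) g profile_continuous e1.
apply: filterS tube => -[[z1 z2] Z] h gz; have {}h := h gz.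
have p1 := profile_papx g; have p2 := profile_papx gz.
have -> : coef i Y y1 y2 - coef i Z z1 z2 =
    gcoef m i (fun t => 1 * profile Y y1 y2 t + (-1) * profile Z z1 z2 t).
  by rewrite gcoef_lin // mul1r mulN1r.
apply: le_trans (gcoef_norm_le m2 i _ (c := e * gnorm R m i) _) _.
- exact: papx_lin.
- by move=> t ht; rewrite mul1r mulN1r; exact: h.
- by rewrite mulfK // gt_eqF.
Qed.

Lemma profile_pd1 Y y : gram_bundle (y, Y) -> sphere_pd m (profile Y y y).
Proof.
move=> g; have := @profile_sphere_pd unit Y (fun=> y) (fun=> 1) (fun=> g).
congr sphere_pd; apply/funext => t.
by rewrite (bigD1 (tt, tt)) //= big1 ?addr0 ?mul1r // => -[[] []].
Qed.

(** The coefficients at y1, y2 form a p.s.d. 2 by 2 matrix, so the mixed one is bounded by the mean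
    of the diagonal ones, whose sums are bounded by [gcoef_sum_le]. *)
Lemma coef_series Y y1 y2 t : gram_dom (y1, y2, Y) -> -1 <= t <= 1 ->
  (fun N => \sum_(0 <= i < N) coef i Y y1 y2 * (geg R m i).[t]) @ \oo --> profile Y y1 y2 t.
Proof.
move=> g ht; have [/= g1 g2] := g.
pose b i := (coef i Y y1 y1 + coef i Y y2 y2) / 2.
have hb i : `|coef i Y y1 y2| <= b i.
  have H (s : R) : s ^+ 2 = 1 -> 0 <= coef i Y y1 y1 + coef i Y y2 y2 + 2 * s * coef i Y y1 y2.
    move=> s1; have := @coef_form_ge0 i bool Y (fun c => if c then y1 else y2)
      (fun c => if c then 1 else s) (fun c => if c as c0 return gram_bundle (if c0 then y1 else y2, Y) then g1 else g2).
    rewrite !big_bool /= -[s * s]expr2 s1 (coefC i (y1 := y2) (y2 := y1)); last by split.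
    by congr (0 <= _); ring.
  have := H 1; have := H (-1); rewrite sqrrN !expr1n => /(_ erefl) h1 /(_ erefl) h2.
  by rewrite /b ler_norml; lra.
have hB N : \sum_(0 <= i < N) b i <= (profile Y y1 y1 1 + profile Y y2 y2 1) / 2.
  rewrite /b -mulr_suml big_split /= ler_pM2r ?invr_gt0 // !big_mkord.
  by apply: lerD; apply: gcoef_sum_le => //; try (exact: profile_pd1); apply: profile_papx.
apply/cvgrPdist_le => e e0.
have [I0 h] := gegenbauer_series m2 (profile_papx g) hb hB ht e0.
by exists I0.
Qed.

End Forward.

(** * From a series expansion to invariance and positivity *)

Section Backward.
Variables (R : realType) (r m : nat).
Hypothesis m2 : (2 <= m)%N.
Local Notation n := (r + m)%N.
Variable K : 'M[R]_(n, r) -> 'cV[R]_n -> 'cV[R]_n -> R.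
Hypothesis hK : bundle_kernel (@sphere_bundle R n r) K.
Variables (c : nat -> 'M[R]_r -> 'cV[R]_r -> 'cV[R]_r -> R) (a : nat -> R).
Hypothesis a0 : forall i, 0 < a i.
Hypothesis cpd : forall i, bundle_pd (@gram_bundle R r) (c i).
Hypothesis Kseries : forall (x y : 'cV[R]_n) (Z : 'M[R]_(n, r)),
  sphere x -> sphere y -> spheres Z -> pdmx (Z^T *m Z) ->
  series (fun i => c i (Z^T *m Z) (Z^T *m x) (Z^T *m y) *
            (a i *: geg R m i).[perp_cos Z x y]) @ \oo --> K Z x y.

Let m0 : (0 < m)%N. Proof. exact: ltnW. Qed.

Let orth_sphere M (x : 'cV[R]_n) : orthogonal_mx M -> sphere x -> sphere (M *m x).
Proof. by move=> oM /sphereP xx; apply/sphereP; rewrite orth_dotv. Qed.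

Let orth_spheres M (Z : 'M[R]_(n, r)) : orthogonal_mx M -> spheres Z -> spheres (M *m Z).
Proof.
by move=> oM sZ j; rewrite colE -mulmxA -colE; exact: orth_sphere.
Qed.

(** All terms depend on inner products only, so both sides are limits of the same partial sums. *)
Let invariant_generic M x y Z : orthogonal_mx M -> sphere x -> sphere y -> spheres Z ->
  pdmx (Z^T *m Z) -> K (M *m Z) (M *m x) (M *m y) = K Z x y.
Proof.
move=> oM sx sy sZ Zp.
have tM p (A B : 'M[R]_(n, p)) q (B' : 'M[R]_(n, q)) : (M *m A)^T *m (M *m B') = A^T *m B'.
  by rewrite trmx_mul -mulmxA (mulmxA M^T) oM mul1mx.
have sMx := orth_sphere oM sx; have sMy := orth_sphere oM sy.
have ZZ : (M *m Z)^T *m (M *m Z) = Z^T *m Z by rewrite tM.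
have Zx : (M *m Z)^T *m (M *m x) = Z^T *m x by rewrite tM.
have Zy : (M *m Z)^T *m (M *m y) = Z^T *m y by rewrite tM.
have h1 := Kseries sMx sMy (orth_spheres oM sZ).
rewrite ZZ Zx Zy in h1; have {}h1 := h1 Zp.
have pc : perp_cos (M *m Z) (M *m x) (M *m y) = perp_cos Z x y.
  by rewrite !perp_cosE ?ZZ // Zx Zy orth_dotv.
rewrite pc in h1.
exact: (cvg_unique _ h1 (Kseries sx sy sZ Zp)).
Qed.

Lemma series_invariant : orthogonal_invariant K.
Proof.
move=> M x y Z oM sx sy sZ.
have cM p (f : R -> 'M[R]_(n, p)) (b : 'M[R]_(n, p)) : f @ (0 : R)^'+ --> b ->
    (fun e => M *m f e) @ (0 : R)^'+ --> M *m b.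
  by move=> fb; apply: cvg_mulmx => //; exact: cvg_cst.
have gx := path_generic m0 x Z; have gy := path_generic m0 y Z.
have h2 : (fun e => K (M *m Zpath Z e) (M *m xpath x e) (M *m xpath y e)) @ (0 : R)^'+
    --> K (M *m Z) (M *m x) (M *m y).
  apply: bundle_kernel_cvg => //; first last.
  - by apply: cM; exact: Zpath_cvg.
  - by apply: cM; exact: xpath_cvg.
  - by apply: cM; exact: xpath_cvg.
  - apply: filterS2 gx gy => e [sx' sZ' _] [sy' _ _].
    by split; [exact: orth_sphere | exact: orth_sphere | exact: orth_spheres].
  - exact: orth_spheres.
  - exact: orth_sphere.
  - exact: orth_sphere.
have h1 : (fun e => K (M *m Zpath Z e) (M *m xpath x e) (M *m xpath y e)) @ (0 : R)^'+
    --> K Z x y.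
  have E := kernel_path_cvg m0 hK sx sy sZ.
  apply: cvg_trans E; apply: near_eq_cvg; apply: filterS2 gx gy => e [sx' sZ' {}gx] [sy' _ _].
  by rewrite invariant_generic //; exact: generic_pdmx gx.
exact: (cvg_unique _ h2 h1).
Qed.

Lemma pd_generic Z N (x : 'I_N -> 'cV[R]_n) (z : 'I_N -> R) : spheres Z ->
  (forall k, sphere (x k)) -> (forall k, generic (x k) Z) ->
  0 <= \sum_k \sum_l z k * z l * K Z (x k) (x l).
Proof.
move=> sZ sx gx; case: N x z sx gx => [|N] x z sx gx; first by rewrite big_ord0.
have Zp : pdmx (Z^T *m Z) := generic_pdmx (gx ord0).
(* The normalized orthogonal components, nonzero by genericity, are unit vectors with inner products
   [perp_cos]; [perp_gram] moves them to R^m, where [geg_schur] applies. *)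
pose w k := (enorm (perp_proj Z *m x k))^-1 *: (perp_proj Z *m x k).
have Zw k : Z^T *m w k = 0 by rewrite /w -scalemxAr perp_proj_orth // scaler0.
have [v vw] := perp_gram Zp Zw.
have vc k l : dotv (v k) (v l) = perp_cos Z (x k) (x l).
  by rewrite vw /w dotvZl dotvZr /perp_cos invfM; ring.
have v1 k : dotv (v k) (v k) = 1.
  rewrite vw /w dotvZl dotvZr -enorm_sqr; field.
  by rewrite gt_eqF // sqrtr_gt0 lt_neqAle eq_sym dotv_eq0 generic_perp // dotv_ge0.
pose S (p : nat) := \sum_k \sum_l z k * z l * series (fun i => c i (Z^T *m Z) (Z^T *m x k) (Z^T *m x l) *
            (a i *: geg R m i).[perp_cos Z (x k) (x l)]) p.
have cS : S @ \oo --> \sum_k \sum_l z k * z l * K Z (x k) (x l).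
  apply: cvg_bigsum => k; apply: cvg_bigsum => l.
  by apply: cvgM; [exact: cvg_cst | exact: Kseries].
have S0 p : 0 <= S p.
  have -> : S p = \sum_(0 <= i < p) a i * \sum_k \sum_l z k * z l *
     (c i (Z^T *m Z) (Z^T *m x k) (Z^T *m x l) * (geg R m i).[dotv (v k) (v l)]).
    rewrite /S; under eq_bigr => k _.
      under eq_bigr => l _ do rewrite /series /= mulr_sumr.
      rewrite exchange_big; over.
    rewrite exchange_big; apply: eq_bigr => i _ /=; rewrite mulr_sumr; apply: eq_bigr => k _.
    by rewrite mulr_sumr; apply: eq_bigr => l _; rewrite hornerZ vc; ring.
  apply: sumr_ge0 => i _; rewrite mulr_ge0 ?(ltW (a0 i)) //.
  apply: (geg_schur m2 i v1) => y.
  exact: (pd_kernel_form (@cpd i (Z^T *m Z)) (u := fun k => Z^T *m x k) y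
    (fun k => gram_bundle_mem (sx k) sZ Zp)).
by apply: (closed_cvg (fun v : R => 0 <= v) (@closed_ge R 0) _ _ cS); exact: nearW.
Qed.

Lemma series_pd : bundle_pd (@sphere_bundle R n r) K.
Proof.
move=> Z N x xinj fx.
have sx k : sphere (x k) by case: (fx k).
apply: psdmx_form => [i j|z].
  by have [_ /(_ Z)[_]] := hK; apply; exact: fx.
case: N x xinj fx sx z => [|N] x xinj fx sx z; first by rewrite big_ord0.
have sZ : spheres Z by case: (fx ord0).
have cS : (fun e => \sum_k \sum_l z k * z l * K (Zpath Z e) (xpath (x k) e) (xpath (x l) e)) @ (0 : R)^'+
    --> \sum_k \sum_l z k * z l * K Z (x k) (x l).
  apply: cvg_bigsum => k; apply: cvg_bigsum => l.
  by apply: cvgM; [exact: cvg_cst | exact: kernel_path_cvg].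
apply: (closed_cvg (fun v : R => 0 <= v) (@closed_ge R 0) _ _ cS).
have g : \forall e \near (0 : R)^'+, forall k, 
   [/\ sphere (xpath (x k) e), spheres (Zpath Z e) & generic (xpath (x k) e) (Zpath Z e)].
  by apply: filter_forall => k; exact: path_generic.
apply: filterS g => e g; apply: pd_generic => [|k|k].
- by case: (g ord0).
- by case: (g k).
- by case: (g k).
Qed.

End Backward.

Theorem theorem2 (R : realType) (n r : nat) (hnr : (r + 2 <= n)%N)
    (K : 'M[R]_(n, r) -> 'cV[R]_n -> 'cV[R]_n -> R)
    (hK : bundle_kernel (@sphere_bundle R n r) K) :
  (orthogonal_invariant K /\ bundle_pd (@sphere_bundle R n r) K) <->
  (exists c : nat -> 'M[R]_r -> 'cV[R]_r -> 'cV[R]_r -> R,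
    (forall i, bundle_kernel (@gram_bundle R r) (c i) /\
               bundle_pd (@gram_bundle R r) (c i)) /\
    (forall (x y : 'cV[R]_n) (Z : 'M[R]_(n, r)),
      sphere x -> sphere y -> spheres Z -> pdmx (Z^T *m Z) ->
      series (fun i => c i (Z^T *m Z) (Z^T *m x) (Z^T *m y) *
                (gegenbauer ((n%:R - r%:R) / 2 - 1) i).[perp_cos Z x y])
        @ \oo --> K Z x y)).
Proof.
have [m mE] : exists m, n = (r + m)%N by exists (n - r)%N; lia.
subst n; have m2 : (2 <= m)%N by lia.
have [a a0 aE] := @gegenbauer_normalized R m m2.
have -> : (r + m)%:R - r%:R = m%:R :> R by rewrite natrD addrC addKr.
split=> [[Kinv Kpd]|[c [hc Kc]]]; last first.
  have cpd i : bundle_pd (@gram_bundle R r) (c i) by case: (hc i).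
  have Ks x y Z : sphere x -> sphere y -> spheres Z -> pdmx (Z^T *m Z) ->
      series (fun i => c i (Z^T *m Z) (Z^T *m x) (Z^T *m y) *
            (a i *: geg R m i).[perp_cos Z x y]) @ \oo --> K Z x y.
    move=> sx sy sZ Zp; have := Kc x y Z sx sy sZ Zp.
    by under eq_fun do rewrite aE.
  split; [exact: series_invariant Ks | exact: series_pd a0 cpd Ks].
(* Division by a_i compensates for the normalization of [geg]. *)
pose c i Y y1 y2 := coef K i Y y1 y2 / a i.
have cc i : {within @gram_dom R r, continuous (fun p => c i p.2 p.1.1 p.1.2)}.
  have /subspace_continuousP h := @coef_continuous R r m m2 K hK Kinv i.
  by apply/subspace_continuousP => p gp; apply: cvgMr_tmp; exact: h.
exists c; split=> [i|x y Z sx sy sZ Zp].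
  split; last first.
    move=> Y N y yinj fy; apply: psdmx_form => [k l|z].
      by rewrite /c (coefC m2 hK) //; split; exact: fy.
    have := @coef_form_ge0 R r m m2 K hK Kinv Kpd i _ Y y z fy.
    have -> : \sum_k \sum_l z k * z l * c i Y (y k) (y l) =
        (\sum_k \sum_l z k * z l * coef K i Y (y k) (y l)) / a i.
      rewrite mulr_suml; apply: eq_bigr => k _; rewrite mulr_suml; apply: eq_bigr => l _.
      by rewrite /c mulrA.
    by move=> h; rewrite divr_ge0 // ltW.
  split; first exact: cc.
  move=> Y; split; last first.
    by move=> y1 y2 g1 g2; rewrite /c (coefC m2 hK).
  apply/within_continuousP => -[y1 y2] [/= g1 g2] e e0.
  have /within_continuousP h := cc i.
  have [[U V] /= [Up Vt] UV] := h (y1, y2, Y) (conj g1 g2) e e0.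
  apply: filterS Up => -[z1 z2] Uz [/= f1 f2].
  exact: (UV (z1, z2, Y) (conj Uz (nbhs_singleton Vt)) (conj f1 f2)).
have Zx := gram_bundle_mem sx sZ Zp; have Zy := gram_bundle_mem sy sZ Zp.
have := coef_series m2 hK Kinv Kpd (conj Zx Zy) (perp_cos_bound Z x y).
rewrite profile_perp_cos //; set u := fun N => _; set v := series _.
suff -> : v = u by [].
apply/funext => N; apply: eq_bigr => i _.
by rewrite aE hornerZ /c mulrA divfK // gt_eqF.
Qed.
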